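(* Fix $\tau\in\mathbb H$, let $m\in-\frac12\mathbb N$ (i.e. $m\in\{-\frac12,-1,-\frac32,\dots\}$) and $\varepsilon\in\{0,1\}$. Let $\phi:\mathbb C\to\mathbb C$ be a meromorphic function satisfying, for all $\lambda,\mu\in\mathbb Z$ and all $z$, \[\phi(z+\lambda\tau+\mu)=(-1)^{2m\mu+\lambda\varepsilon}e^{-2\pi i m(\lambda^2\tau+2\lambda z)}\phi(z).\] Let $z_0\in\mathbb C$ be such that $\phi$ has no poles on the boundary $\partial P_{z_0}$. Then for every $z\in\mathbb C$ at which $\phi$ is holomorphic, \[\phi(z)=-\sum_{u\in s_{z_0,\tau}}\sum_{n\in\mathbb N}\frac{D_{n,u}}{(n-1)!}\,\mathcal D_v^{\,n-1}\bigl(F_{-m,\varepsilon}(z,v)\bigr)\Big|_{v=u}.\] (Only finitely many terms in the double sum are nonzero.)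
   Context: Notation: $e(x):=e^{2\pi i x}$, $q:=e(\tau)$, and for a variable $x$, $\mathcal D_x:=\frac{1}{2\pi i}\frac{\partial}{\partial x}$. For $z_0\in\mathbb C$, $P_{z_0}:=z_0+[0,1)\tau+[0,1)$ is a fundamental parallelogram for the lattice $\mathbb Z\tau+\mathbb Z$, and $s_{z_0,\tau}$ denotes the (finite) set of poles of $\phi$ lying in $P_{z_0}$. For a pole $u$ of $\phi$, the Laurent coefficients $D_{n,u}$ ($n\ge1$) are defined by $\phi(z)=\sum_{n\ge1}\frac{D_{n,u}}{(2\pi i(z-u))^n}+O(1)$ as $z\to u$ (only finitely many $D_{n,u}$ nonzero). For $M\in\frac12\mathbb N$, the Appell--Lerch sum is \[F_{M,\varepsilon}(z,u)=F_{M,\varepsilon}(z,u;\tau):=e\bigl(M(z-u)\bigr)\sum_{n\in\mathbb Z}\frac{(-1)^{n\varepsilon}e(-2Mnu)\,q^{Mn(n+1)}}{1-q^n e(z-u)}.\] *)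

(* Defs.v *)
From Stdlib Require Import Reals ZArith List Lra.
From Coquelicot Require Import Coquelicot.
Open Scope R_scope.

Definition cexp (w : C) : C :=
  (exp (Re w) * cos (Im w), exp (Re w) * sin (Im w)).
Definition ee (x : C) : C := cexp (2 * PI * Ci * x)%C.

Definition msign (n : Z) : C := if Z.even n then 1%C else (-1)%C.

Definition holo_at (f : C -> C) (w : C) : Prop :=
  exists r : R, 0 < r /\ forall w', Cmod (w' - w) < r ->
    @ex_derive C_AbsRing C_NormedModule f w'.

Definition sum1N (N : nat) (g : nat -> C) : C :=
  fold_right (fun n acc => (g n + acc)%C) 0%C (seq 1 N).

Definition sum_list (s : list C) (g : C -> C) : C :=
  fold_right (fun u acc => (g u + acc)%C) 0%C s.

Definition principal_part (f : C -> C) (u : C) (d : nat -> C) (N : nat) : Prop :=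
  (forall n, (N < n)%nat -> d n = 0%C) /\
  exists r M : R, 0 < r /\ forall w, 0 < Cmod (w - u) < r ->
    Cmod (f w - sum1N N (fun n => d n / Cpow (2 * PI * Ci * (w - u)) n)%C) <= M.

Definition is_pole (f : C -> C) (u : C) : Prop :=
  ~ holo_at f u /\
  (exists r : R, 0 < r /\ forall w, 0 < Cmod (w - u) < r -> holo_at f w) /\
  exists (d : nat -> C) (N : nat), principal_part f u d N /\ exists n, d n <> 0%C.

Definition meromorphic (f : C -> C) : Prop :=
  forall u, holo_at f u \/ is_pole f u.

Definition in_P (z0 tau u : C) : Prop :=
  exists a b : R, 0 <= a < 1 /\ 0 <= b < 1 /\ u = (z0 + RtoC a * tau + RtoC b)%C.

Definition on_boundary_P (z0 tau u : C) : Prop :=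
  exists a b : R, 0 <= a <= 1 /\ 0 <= b <= 1 /\ (a = 0 \/ a = 1 \/ b = 0 \/ b = 1) /\
    u = (z0 + RtoC a * tau + RtoC b)%C.

Definition Csum (a : nat -> C) : C := (Series (fun n => Re (a n)), Series (fun n => Im (a n))).
Definition Zsum (a : Z -> C) : C :=
  (Csum (fun n => a (Z.of_nat n)) + Csum (fun n => a (- Z.of_nat (S n))%Z))%C.

Definition IZC (n : Z) : C := RtoC (IZR n).

Definition AL (k : nat) (eps : Z) (tau z u : C) : C :=
  let M := (RtoC (INR k) / 2)%C in
  (ee (M * (z - u)) *
   Zsum (fun n => msign (n * eps)%Z * ee (- 2 * M * IZC n * u) *
                  ee (M * IZC n * (IZC n + 1) * tau) /
                  (1 - ee (IZC n * tau) * ee (z - u))))%C.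

Fixpoint Dn (j : nat) (g : C -> C) : C -> C :=
  match j with
  | O => g
  | S j' => fun x => (C_derive (Dn j' g) x / (2 * PI * Ci))%C
  end.

(* Main.v *)
(* As a function of [v], the product [f(v) = phi(v) F(z, v)] is elliptic for the lattice
   [Z tau + Z], so its integral around a period parallelogram vanishes. Inside, its poles are
   those of [phi] and the simple pole of [F(z, v)] at [v = z], and the residue theorem is the
   claimed identity. The parallelogram is moved to a generic position to keep all poles off its
   boundary: the residues of [f] do not change under lattice translations. Residues are
   normalised by the constant [W0], the integral of [1 / w] around a fixed parallelogram,
   of which only [W0 <> 0] is needed. *)
Require Import Defs.
From Stdlib Require Import Reals ZArith List Lra Lia Classical ClassicalEpsilon.
From Coquelicot Require Import Coquelicot.
Open Scope R_scope.

(** * Complex differentiation *)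

(** Residues are introduced without Laurent series: [f - c / (w - u)] only has to split into a
    bounded function, which contributes [O(d)] on a box of half-side [d], and a function with a
    primitive, which contributes nothing. Goursat's lemma and the limit [d -> 0] then give the
    residue theorem, and a pole of higher order is lowered by subtracting exact derivatives; this
    produces the factorials and the derivatives of [F(z, v)] in the formula. Lowering the order
    differentiates [F(z, v)] repeatedly, so derivatives of holomorphic functions must be
    holomorphic. The same residue theorem, used on squares ([tau = i]), yields Cauchy's formula,
    hence this regularity and the holomorphy of dominated series, [F] itself included. As a total
    function, [phi] has arbitrary values at its poles. Ellipticity is therefore available at points
    of holomorphy only, and poles are transported through punctured discs. Near [v = z], [F(z, v)]
    is [1 / (2 pi i (v - z)) + O(1)], so [f] has residue [phi(z) / (2 pi i)] there. Since all
    residues sum to zero, the poles of [phi] enter with a minus sign. *)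

Definition cderiv (f : C -> C) (z l : C) : Prop :=
  forall eps, 0 < eps -> exists d, 0 < d /\ forall w, Cmod (w - z) < d ->
    Cmod (f w - f z - l * (w - z)) <= eps * Cmod (w - z).

Definition cdiff (f : C -> C) (z : C) : Prop := exists l, cderiv f z l.

Definition ccont (f : C -> C) (z : C) : Prop :=
  forall eps, 0 < eps -> exists d, 0 < d /\ forall w, Cmod (w - z) < d ->
    Cmod (f w - f z) < eps.

(** The discs of [Cmod] are by conversion the balls of the uniform structure induced by [C_AbsRing],
    the one that [is_derive] over [C_AbsRing] refers to; hence the two [exact]. *)
Lemma locally_Cmod (z : C) (P : C -> Prop) :
  @locally (NormedModule.UniformSpace C_AbsRing (AbsRing_NormedModule C_AbsRing)) z P <->
  exists d, 0 < d /\ forall w, Cmod (w - z) < d -> P w.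
Proof.
  split.
  - intros [d Hd]; exists d; split; [apply cond_pos|]. intros w Hw; apply Hd. exact Hw.
  - intros [d [Hd H]]; exists (mkposreal d Hd). intros w Hw; apply H. exact Hw.
Qed.

(** The bridge to [holo_at] and [C_derive] of the statement; the estimates in between are made on
    the epsilon-delta form. *)
Lemma cderiv_is_derive (f : C -> C) (z l : C) :
  cderiv f z l <-> @is_derive C_AbsRing C_NormedModule f z l.
Proof.
  split.
  - intros H. split; [apply is_linear_scal_l|].
    intros x Hx.
    (* [is_derive] asks for the estimate at every limit point of the filter; [locally z] has no
       other than [z]. *)
    assert (Ex : z = x) by (apply (@is_filter_lim_locally_unique C_AbsRing
      (AbsRing_NormedModule C_AbsRing)); exact Hx).
    subst x. intros eps. apply locally_Cmod.
    destruct (H eps (cond_pos eps)) as [d [Hd H']].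
    exists d; split; [exact Hd|]. intros w Hw. specialize (H' w Hw).
    refine (Rle_trans _ _ _ (Req_le _ _ _) H').
    apply (f_equal Cmod). unfold minus, plus, opp, scal; simpl. unfold mult; simpl.
    change (f w + - f z + - ((w + - z) * l) = f w - f z - l * (w - z))%C. ring.
  - intros [_ H] eps Heps.
    specialize (H z (fun P HP => HP) (mkposreal eps Heps)).
    apply locally_Cmod in H. destruct H as [d [Hd H]].
    exists d; split; [exact Hd|]. intros w Hw. specialize (H w Hw).
    refine (Rle_trans _ _ _ (Req_le _ _ _) H).
    apply (f_equal Cmod). unfold minus, plus, opp, scal; simpl. unfold mult; simpl.
    change (f w - f z - l * (w - z) = f w + - f z + - ((w + - z) * l))%C. ring.
Qed.

Lemma cdiff_ex_derive (f : C -> C) (z : C) :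
  cdiff f z <-> @ex_derive C_AbsRing C_NormedModule f z.
Proof. split; intros [l Hl]; exists l; apply cderiv_is_derive; exact Hl. Qed.

Lemma cderiv_unique (f : C -> C) (z l : C) : cderiv f z l -> C_derive f z = l.
Proof. intros H. apply is_C_derive_unique, cderiv_is_derive, H. Qed.

Lemma cderiv_C_derive (f : C -> C) (z : C) : cdiff f z -> cderiv f z (C_derive f z).
Proof. intros [l Hl]. rewrite (cderiv_unique _ _ _ Hl). exact Hl. Qed.

Lemma Cmod_sub_sym (x y : C) : Cmod (x - y) = Cmod (y - x).
Proof. rewrite <- Cmod_opp. f_equal. ring. Qed.

Lemma Cmod_sub_triangle (x y z : C) : Cmod (x - z) <= Cmod (x - y) + Cmod (y - z).
Proof. replace (x - z)%C with ((x - y) + (y - z))%C by ring. apply Cmod_triangle. Qed.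

Lemma Cmod_le_add (x y : C) : Cmod x <= Cmod y + Cmod (x - y).
Proof. replace x with (y + (x - y))%C at 1 by ring. apply Cmod_triangle. Qed.

Lemma Cmod_self (z : C) : Cmod (z - z) = 0.
Proof. replace (z - z)%C with (RtoC 0) by ring. apply Cmod_0. Qed.

Lemma im_le_Cmod (c : C) : Rabs (Im c) <= Cmod c.
Proof. eapply Rle_trans; [|apply Rmax_Cmod]. apply Rmax_r. Qed.

Lemma Cmod_le_re_im (c : C) : Cmod c <= Rabs (Re c) + Rabs (Im c).
Proof.
  replace c with (RtoC (Re c) + RtoC (Im c) * Ci)%C at 1
    by (destruct c; unfold Cplus, Cmult, RtoC, Ci, Re, Im; simpl; f_equal; ring).
  eapply Rle_trans; [apply Cmod_triangle|]. rewrite Cmod_mult, Cmod_Ci, !Cmod_R. lra.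
Qed.

Lemma Rmult_le_bound (a b A B : R) : 0 <= a <= A -> 0 <= b <= B -> a * b <= A * B.
Proof. intros; apply Rmult_le_compat; lra. Qed.

(** This local Lipschitz bound serves for continuity, for the chain rule and, in [has_res_simple],
    for bounded difference quotients. *)
Lemma cderiv_bounded (f : C -> C) (z l : C) : cderiv f z l ->
  exists d, 0 < d /\ forall w, Cmod (w - z) < d ->
    Cmod (f w - f z) <= (Cmod l + 1) * Cmod (w - z).
Proof.
  intros H. destruct (H 1 Rlt_0_1) as [d [Hd H']]. exists d; split; [exact Hd|].
  intros w Hw. specialize (H' w Hw).
  pose proof (Cmod_le_add (f w - f z) (l * (w - z))). rewrite Cmod_mult in H0. lra.
Qed.

Lemma cdiff_ccont (f : C -> C) (z : C) : cdiff f z -> ccont f z.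
Proof.
  intros [l Hl] eps Heps. destruct (cderiv_bounded _ _ _ Hl) as [d [Hd H]].
  pose proof (Cmod_ge_0 l).
  assert (0 < eps / (Cmod l + 1)) by (apply Rdiv_lt_0_compat; lra).
  exists (Rmin d (eps / (Cmod l + 1))). split; [apply Rmin_pos; lra|].
  intros w Hw. pose proof (Rmin_l d (eps / (Cmod l + 1))).
  pose proof (Rmin_r d (eps / (Cmod l + 1))).
  eapply Rle_lt_trans; [apply H; lra|].
  replace eps with ((Cmod l + 1) * (eps / (Cmod l + 1))) by (field; lra).
  apply Rmult_lt_compat_l; lra.
Qed.

Lemma cderiv_ext_loc (f g : C -> C) (z l : C) (r : R) : 0 < r ->
  (forall w, Cmod (w - z) < r -> f w = g w) -> cderiv f z l -> cderiv g z l.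
Proof.
  intros Hr Hfg H eps Heps. destruct (H eps Heps) as [d [Hd H']].
  exists (Rmin d r). split; [apply Rmin_pos; lra|]. intros w Hw.
  pose proof (Rmin_l d r). pose proof (Rmin_r d r).
  rewrite <- !Hfg; [apply H'; lra | rewrite Cmod_self; lra | lra].
Qed.

Lemma cderiv_ext (f g : C -> C) (z l l' : C) :
  (forall w, f w = g w) -> l = l' -> cderiv f z l -> cderiv g z l'.
Proof. intros Hfg <-. apply (cderiv_ext_loc _ _ _ _ 1 Rlt_0_1). auto. Qed.

Lemma cderiv_const (c z : C) : cderiv (fun _ => c) z 0.
Proof.
  intros eps Heps; exists 1; split; [lra|]. intros w _.
  replace (c - c - 0 * (w - z))%C with (RtoC 0) by ring. rewrite Cmod_0.
  apply Rmult_le_pos; [lra|apply Cmod_ge_0].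
Qed.

Lemma cderiv_id (z : C) : cderiv (fun w => w) z 1.
Proof.
  intros eps Heps; exists 1; split; [lra|]. intros w _.
  replace (w - z - 1 * (w - z))%C with (RtoC 0) by ring. rewrite Cmod_0.
  apply Rmult_le_pos; [lra|apply Cmod_ge_0].
Qed.

Lemma cderiv_plus (f g : C -> C) (z l m : C) :
  cderiv f z l -> cderiv g z m -> cderiv (fun w => f w + g w)%C z (l + m)%C.
Proof.
  intros Hf Hg eps Heps.
  destruct (Hf (eps / 2)) as [d [Hd H]]; [lra|].
  destruct (Hg (eps / 2)) as [d' [Hd' H']]; [lra|].
  exists (Rmin d d'). split; [apply Rmin_pos; lra|]. intros w Hw.
  pose proof (Rmin_l d d'). pose proof (Rmin_r d d').
  replace (f w + g w - (f z + g z) - (l + m) * (w - z))%C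
    with ((f w - f z - l * (w - z)) + (g w - g z - m * (w - z)))%C by ring.
  eapply Rle_trans; [apply Cmod_triangle|].
  specialize (H w ltac:(lra)). specialize (H' w ltac:(lra)). lra.
Qed.

(* The remainder of a product is f(z) r_g + r_f g(w) + l (w - z) (g(w) - g(z)). *)
Lemma cderiv_mult (f g : C -> C) (z l m : C) :
  cderiv f z l -> cderiv g z m -> cderiv (fun w => f w * g w)%C z (l * g z + f z * m)%C.
Proof.
  intros Hf Hg eps Heps.
  pose proof (Cmod_ge_0 l). pose proof (Cmod_ge_0 (f z)). pose proof (Cmod_ge_0 (g z)).
  set (K := Cmod l + Cmod (f z) + Cmod (g z) + 1).
  assert (HK : 0 < K) by (unfold K; lra).
  (* [e <= 1] keeps [|g w|] below [|g z| + 1 <= K]; the 3 shares [eps] among the three terms of the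
     remainder. *)
  assert (He : 0 < Rmin 1 (eps / (3 * K)))
    by (apply Rmin_pos; [lra|apply Rdiv_lt_0_compat; lra]).
  set (e := Rmin 1 (eps / (3 * K))) in *.
  assert (He1 : e <= 1) by apply Rmin_l.
  assert (He2 : e * K <= eps / 3).
  { replace (eps / 3) with (eps / (3 * K) * K) by (field; lra).
    apply Rmult_le_compat_r; [lra|apply Rmin_r]. }
  destruct (Hf e He) as [d [Hd H2]]. destruct (Hg e He) as [d' [Hd' H3]].
  destruct (cdiff_ccont g z (ex_intro _ m Hg) e He) as [d'' [Hd'' H4]].
  exists (Rmin d (Rmin d' d'')). split; [repeat apply Rmin_pos; lra|]. intros w Hw.
  pose proof (Rmin_l d (Rmin d' d'')). pose proof (Rmin_r d (Rmin d' d'')).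
  pose proof (Rmin_l d' d''). pose proof (Rmin_r d' d'').
  specialize (H2 w ltac:(lra)). specialize (H3 w ltac:(lra)). specialize (H4 w ltac:(lra)).
  set (rf := (f w - f z - l * (w - z))%C) in *.
  set (rg := (g w - g z - m * (w - z))%C) in *.
  replace (f w * g w - f z * g z - (l * g z + f z * m) * (w - z))%C
    with (f z * rg + (rf * g w + l * (w - z) * (g w - g z)))%C by (unfold rf, rg; ring).
  eapply Rle_trans; [apply Cmod_triangle|].
  eapply Rle_trans; [apply Rplus_le_compat_l, Cmod_triangle|].
  rewrite !Cmod_mult. pose proof (Cmod_le_add (g w) (g z)) as H9.
  pose proof (Cmod_ge_0 (w - z)). set (h := Cmod (w - z)) in *.
  pose proof (Cmod_ge_0 rf). pose proof (Cmod_ge_0 rg). pose proof (Cmod_ge_0 (g w)).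
  pose proof (Cmod_ge_0 (g w - g z)).
  assert (Cmod (f z) * Cmod rg <= K * (e * h)) by (apply Rmult_le_bound; unfold K; lra).
  assert (Cmod rf * Cmod (g w) <= (e * h) * K) by (apply Rmult_le_bound; unfold K; lra).
  assert (Cmod l * h * Cmod (g w - g z) <= (K * h) * e).
  { apply Rmult_le_bound; [split; [apply Rmult_le_pos; lra|]|lra].
    apply Rmult_le_compat_r; unfold K; lra. }
  assert (e * K * h <= eps / 3 * h) by (apply Rmult_le_compat_r; lra).
  nra.
Qed.

Lemma cderiv_scal (f : C -> C) (c z l : C) :
  cderiv f z l -> cderiv (fun w => c * f w)%C z (c * l)%C.
Proof.
  intros H. eapply cderiv_ext; [intro; reflexivity| |
    apply (cderiv_mult (fun _ => c) f z 0 l (cderiv_const c z) H)]. ring.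
Qed.

Lemma cderiv_comp (f g : C -> C) (z l m : C) :
  cderiv g z m -> cderiv f (g z) l -> cderiv (fun w => f (g w)) z (l * m)%C.
Proof.
  intros Hg Hf eps Heps.
  pose proof (Cmod_ge_0 l). pose proof (Cmod_ge_0 m).
  destruct (cderiv_bounded _ _ _ Hg) as [d [Hd H1]].
  destruct (Hf (eps / (2 * (Cmod m + 1)))) as [d' [Hd' H2]];
    [apply Rdiv_lt_0_compat; lra|].
  destruct (Hg (eps / (2 * (Cmod l + 1)))) as [d2 [Hd2 H3]];
    [apply Rdiv_lt_0_compat; lra|].
  destruct (cdiff_ccont g z (ex_intro _ m Hg) d' Hd') as [d'' [Hd'' H4]].
  exists (Rmin d (Rmin d2 d'')). split; [repeat apply Rmin_pos; lra|]. intros w Hw.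
  pose proof (Rmin_l d (Rmin d2 d'')). pose proof (Rmin_r d (Rmin d2 d'')).
  pose proof (Rmin_l d2 d''). pose proof (Rmin_r d2 d'').
  specialize (H1 w ltac:(lra)). specialize (H3 w ltac:(lra)).
  specialize (H2 (g w) (H4 w ltac:(lra))).
  replace (f (g w) - f (g z) - l * m * (w - z))%C
    with ((f (g w) - f (g z) - l * (g w - g z)) + l * (g w - g z - m * (w - z)))%C by ring.
  eapply Rle_trans; [apply Cmod_triangle|]. rewrite Cmod_mult.
  pose proof (Cmod_ge_0 (w - z)). set (h := Cmod (w - z)) in *.
  assert (E1 : Cmod (f (g w) - f (g z) - l * (g w - g z)) <= eps / 2 * h).
  { eapply Rle_trans; [apply H2|].
    replace (eps / 2 * h) with (eps / (2 * (Cmod m + 1)) * ((Cmod m + 1) * h))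
      by (field; lra).
    apply Rmult_le_compat_l; [|lra]. apply Rlt_le, Rdiv_lt_0_compat; lra. }
  assert (E2 : Cmod l * Cmod (g w - g z - m * (w - z)) <= eps / 2 * h).
  { replace (eps / 2 * h) with ((Cmod l + 1) * (eps / (2 * (Cmod l + 1)) * h))
      by (field; lra).
    apply Rmult_le_bound; [lra|]. split; [apply Cmod_ge_0|lra]. }
  lra.
Qed.

Lemma cderiv_inv_id (z : C) : z <> 0%C -> cderiv (fun w => / w)%C z (- (/ (z * z)))%C.
Proof.
  intros Hz eps Heps. apply Cmod_gt_0 in Hz as Hm. set (a := Cmod z) in *.
  assert (Ha3 : 0 < a * a * a) by (repeat apply Rmult_lt_0_compat; lra).
  assert (Hea : 0 < eps * (a * a * a) / 2)
    by (apply Rdiv_lt_0_compat; [apply Rmult_lt_0_compat|]; lra).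
  (* Once [|w| >= a/2], the remainder [h^2 / (a^2 |w|)] is at most [2 h^2 / a^3]. *)
  exists (Rmin (a / 2) (eps * (a * a * a) / 2)). split; [apply Rmin_pos; lra|].
  intros w Hw. pose proof (Rmin_l (a / 2) (eps * (a * a * a) / 2)).
  pose proof (Rmin_r (a / 2) (eps * (a * a * a) / 2)).
  pose proof (Cmod_le_add z w). rewrite Cmod_sub_sym in H1. fold a in H1.
  assert (Hw2 : a / 2 <= Cmod w) by lra.
  assert (Hw0 : w <> 0%C) by (apply Cmod_gt_0; lra).
  replace (/ w - / z - - / (z * z) * (w - z))%C
    with ((w - z) * (w - z) * / (z * z * w))%C by (field; split; assumption).
  rewrite !Cmod_mult, Cmod_inv, !Cmod_mult by (repeat apply Cmult_neq_0; assumption).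
  fold a. set (h := Cmod (w - z)) in *. assert (0 <= h) by apply Cmod_ge_0.
  assert (0 < a * a * Cmod w) by (repeat apply Rmult_lt_0_compat; lra).
  apply (Rmult_le_reg_r (a * a * Cmod w)); [assumption|].
  rewrite Rmult_assoc, Rinv_l, Rmult_1_r by lra.
  assert (eps * (a * a * a) / 2 <= eps * (a * a * Cmod w)).
  { replace (eps * (a * a * a) / 2) with (eps * (a * a * (a / 2))) by field.
    repeat apply Rmult_le_compat_l; nra. }
  nra.
Qed.

Lemma cderiv_inv (f : C -> C) (z l : C) : f z <> 0%C ->
  cderiv f z l -> cderiv (fun w => / f w)%C z (- (/ (f z * f z)) * l)%C.
Proof. intros Hz H. apply (cderiv_comp (fun w => / w)%C f); [exact H|]. apply cderiv_inv_id, Hz. Qed.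

Lemma cdiff_const (c z : C) : cdiff (fun _ => c) z.
Proof. exists 0%C; apply cderiv_const. Qed.

Lemma cdiff_id (z : C) : cdiff (fun w => w) z.
Proof. exists 1%C; apply cderiv_id. Qed.

Lemma cdiff_plus (f g : C -> C) (z : C) :
  cdiff f z -> cdiff g z -> cdiff (fun w => f w + g w)%C z.
Proof. intros [l Hl] [m Hm]; eexists; apply cderiv_plus; eassumption. Qed.

Lemma cdiff_mult (f g : C -> C) (z : C) :
  cdiff f z -> cdiff g z -> cdiff (fun w => f w * g w)%C z.
Proof. intros [l Hl] [m Hm]; eexists; apply cderiv_mult; eassumption. Qed.

Lemma cdiff_opp (f : C -> C) (z : C) : cdiff f z -> cdiff (fun w => - f w)%C z.
Proof.
  intros [l Hl]; exists (- (1) * l)%C.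
  apply (cderiv_ext (fun w => - (1) * f w)%C _ _ (- (1) * l)%C); [intro; ring|reflexivity|].
  apply cderiv_scal, Hl.
Qed.

Lemma cdiff_minus (f g : C -> C) (z : C) :
  cdiff f z -> cdiff g z -> cdiff (fun w => f w - g w)%C z.
Proof. intros Hf Hg. apply cdiff_plus; [exact Hf|apply cdiff_opp, Hg]. Qed.

Lemma cdiff_comp (f g : C -> C) (z : C) :
  cdiff g z -> cdiff f (g z) -> cdiff (fun w => f (g w)) z.
Proof. intros [l Hl] [m Hm]; eexists; apply cderiv_comp; eassumption. Qed.

Lemma cdiff_div (f g : C -> C) (z : C) : g z <> 0%C ->
  cdiff f z -> cdiff g z -> cdiff (fun w => f w / g w)%C z.
Proof.
  intros Hz Hf [m Hm]. apply cdiff_mult; [exact Hf|]. eexists; apply cderiv_inv; eassumption.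
Qed.

Lemma cdiff_pow (f : C -> C) (z : C) (n : nat) : cdiff f z -> cdiff (fun w => f w ^ n)%C z.
Proof.
  intros Hf. induction n as [|n IH]; [exact (cdiff_const 1 z)|].
  apply (cdiff_mult f (fun w => f w ^ n)%C); assumption.
Qed.

Lemma cdiff_ext_loc (f g : C -> C) (z : C) (r : R) : 0 < r ->
  (forall w, Cmod (w - z) < r -> f w = g w) -> cdiff f z -> cdiff g z.
Proof. intros Hr H [l Hl]; exists l; eapply cderiv_ext_loc; eassumption. Qed.

Lemma ccont_mult (f g : C -> C) (z : C) :
  ccont f z -> ccont g z -> ccont (fun w => f w * g w)%C z.
Proof.
  intros Hf Hg eps Heps.
  pose proof (Cmod_ge_0 (f z)). pose proof (Cmod_ge_0 (g z)).
  set (K := Cmod (f z) + Cmod (g z) + 1).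
  assert (HK : 0 < K) by (unfold K; lra).
  assert (He : 0 < Rmin 1 (eps / (2 * K)))
    by (apply Rmin_pos; [lra|apply Rdiv_lt_0_compat; lra]).
  set (e := Rmin 1 (eps / (2 * K))) in *.
  assert (He1 : e <= 1) by apply Rmin_l.
  assert (He2 : K * e <= eps / 2).
  { replace (eps / 2) with (K * (eps / (2 * K))) by (field; lra).
    apply Rmult_le_compat_l; [lra|apply Rmin_r]. }
  destruct (Hf e He) as [d [Hd H1]]. destruct (Hg e He) as [d' [Hd' H2]].
  exists (Rmin d d'). split; [apply Rmin_pos; lra|]. intros w Hw.
  pose proof (Rmin_l d d'). pose proof (Rmin_r d d').
  specialize (H1 w ltac:(lra)). specialize (H2 w ltac:(lra)).
  replace (f w * g w - f z * g z)%C with (f w * (g w - g z) + (f w - f z) * g z)%C by ring.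
  eapply Rle_lt_trans; [apply Cmod_triangle|]. rewrite !Cmod_mult.
  pose proof (Cmod_le_add (f w) (f z)).
  pose proof (Cmod_ge_0 (f w)). pose proof (Cmod_ge_0 (f w - f z)).
  pose proof (Cmod_ge_0 (g w - g z)).
  assert (Cmod (f w) * Cmod (g w - g z) <= (Cmod (f z) + 1) * e) by (apply Rmult_le_bound; lra).
  assert (Cmod (f w - f z) * Cmod (g z) <= e * Cmod (g z)) by (apply Rmult_le_compat_r; lra).
  unfold K in He2. nra.
Qed.

Lemma ccont_plus (f g : C -> C) (z : C) :
  ccont f z -> ccont g z -> ccont (fun w => f w + g w)%C z.
Proof.
  intros Hf Hg eps Heps.
  destruct (Hf (eps / 2)) as [d [Hd H1]]; [lra|]. destruct (Hg (eps / 2)) as [d' [Hd' H2]]; [lra|].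
  exists (Rmin d d'). split; [apply Rmin_pos; lra|]. intros w Hw.
  pose proof (Rmin_l d d'). pose proof (Rmin_r d d').
  specialize (H1 w ltac:(lra)). specialize (H2 w ltac:(lra)).
  replace (f w + g w - (f z + g z))%C with ((f w - f z) + (g w - g z))%C by ring.
  eapply Rle_lt_trans; [apply Cmod_triangle|]. lra.
Qed.

Lemma ccont_const (c z : C) : ccont (fun _ => c) z.
Proof. apply cdiff_ccont, cdiff_const. Qed.

(** * The complex exponential *)

Lemma cexp_plus (a b : C) : cexp (a + b) = (cexp a * cexp b)%C.
Proof.
  unfold cexp. rewrite re_plus, im_plus, exp_plus, cos_plus, sin_plus.
  unfold Cmult; simpl. f_equal; ring.
Qed.

Lemma cexp_0 : cexp 0 = 1%C.
Proof. unfold cexp; simpl. rewrite exp_0, cos_0, sin_0. unfold RtoC. f_equal; ring. Qed.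

Lemma Cmod_cexp (w : C) : Cmod (cexp w) = exp (Re w).
Proof.
  unfold Cmod, cexp; simpl.
  replace (_ + _) with (exp (Re w) * exp (Re w) * (Rsqr (sin (Im w)) + Rsqr (cos (Im w))))
    by (unfold Rsqr; ring).
  rewrite sin2_cos2, Rmult_1_r. apply sqrt_square, Rlt_le, exp_pos.
Qed.

Lemma derive_at_0 (f : R -> R) (l e : R) : derivable_pt_lim f 0 l -> 0 < e ->
  exists d, 0 < d /\ forall h, Rabs h < d -> Rabs (f h - f 0 - l * h) <= e * Rabs h.
Proof.
  intros H He. destruct (H e He) as [d Hd]. exists d; split; [apply cond_pos|].
  intros h Hh. destruct (Req_dec h 0) as [->|Hn].
  - replace (f 0 - f 0 - l * 0) with 0 by ring. rewrite Rabs_R0. lra.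
  - specialize (Hd h Hn Hh). rewrite Rplus_0_l in Hd.
    replace (f h - f 0 - l * h) with (((f h - f 0) / h - l) * h) by (field; assumption).
    rewrite Rabs_mult. apply Rmult_le_compat_r; [apply Rabs_pos|lra].
Qed.

(** Only the point 0 needs the real derivatives of [exp], [cos] and [sin]; the functional equation
    moves the result to every point in [cderiv_cexp]. *)
Lemma cderiv_cexp_0 : cderiv cexp 0 1.
Proof.
  intros eps Heps.
  (* The real and imaginary parts of the remainder will be at most [4 e h] and [5 e h]; 20 leaves
     room for the sum. *)
  assert (He : 0 < Rmin 1 (eps / 20)) by (apply Rmin_pos; lra).
  set (e := Rmin 1 (eps / 20)) in *.
  assert (He1 : e <= 1) by apply Rmin_l. assert (He2 : e <= eps / 20) by apply Rmin_r.
  destruct (derive_at_0 exp 1 e) as [d1 [Hd1 H1]]; [|lra|].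
  { generalize (derivable_pt_lim_exp 0). rewrite exp_0; auto. }
  destruct (derive_at_0 cos 0 e) as [d2 [Hd2 H2]]; [|lra|].
  { generalize (derivable_pt_lim_cos 0). rewrite sin_0, Ropp_0; auto. }
  destruct (derive_at_0 sin 1 e) as [d3 [Hd3 H3]]; [|lra|].
  { generalize (derivable_pt_lim_sin 0). rewrite cos_0; auto. }
  (* The entry [e] forces [h <= e], which turns the product [(x + r1) (y + r3)] of two first-order
     terms into a small multiple of [h]. *)
  exists (Rmin e (Rmin d1 (Rmin d2 d3))). split; [repeat apply Rmin_pos; lra|].
  intros w Hw.
  pose proof (Rmin_l e (Rmin d1 (Rmin d2 d3))). pose proof (Rmin_r e (Rmin d1 (Rmin d2 d3))).
  pose proof (Rmin_l d1 (Rmin d2 d3)). pose proof (Rmin_r d1 (Rmin d2 d3)).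
  pose proof (Rmin_l d2 d3). pose proof (Rmin_r d2 d3).
  replace (w - 0)%C with w in * by ring. rewrite cexp_0.
  pose proof (re_le_Cmod w). pose proof (im_le_Cmod w).
  specialize (H1 (Re w) ltac:(lra)). specialize (H2 (Im w) ltac:(lra)).
  specialize (H3 (Im w) ltac:(lra)).
  rewrite exp_0 in H1. rewrite cos_0 in H2. rewrite sin_0 in H3.
  eapply Rle_trans; [apply Cmod_le_re_im|].
  unfold Cminus. rewrite !re_plus, !im_plus, !re_opp, !im_opp.
  replace (1 * w)%C with w by ring.
  unfold cexp; simpl Re; simpl Im.
  set (x := Re w) in *. set (y := Im w) in *. set (h := Cmod w) in *.
  change (fst w) with x. change (snd w) with y.
  set (r1 := exp x - 1 - 1 * x) in *. set (r2 := cos y - 1 - 0 * y) in *.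
  set (r3 := sin y - 0 - 1 * y) in *.
  replace (exp x * cos y + - (1) + - x) with (r1 + r2 * (1 + x + r1)) by (unfold r1, r2; ring).
  replace (exp x * sin y + - 0 + - y) with ((x + r1) * (y + r3) + r3) by (unfold r1, r3; ring).
  assert (HM : forall a, a <= h -> e * a <= e * h) by (intros; apply Rmult_le_compat_l; lra).
  assert (Hr1 : Rabs r1 <= e * h) by (eapply Rle_trans; [exact H1|auto]).
  assert (Hr2 : Rabs r2 <= e * h) by (eapply Rle_trans; [exact H2|auto]).
  assert (Hr3 : Rabs r3 <= e * h) by (eapply Rle_trans; [exact H3|auto]).
  assert (0 <= h) by apply Cmod_ge_0.
  assert (Heh : e * h <= h) by nra. assert (Hh1 : h <= e) by lra.
  assert (A1 : Rabs (1 + x + r1) <= 3).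
  { eapply Rle_trans; [apply Rabs_triang|].
    eapply Rle_trans; [apply Rplus_le_compat_r, Rabs_triang|]. rewrite Rabs_R1. lra. }
  assert (A2 : Rabs (x + r1) <= 2 * e).
  { eapply Rle_trans; [apply Rabs_triang|]. lra. }
  assert (A3 : Rabs (y + r3) <= 2 * h).
  { eapply Rle_trans; [apply Rabs_triang|]. lra. }
  assert (B1 : Rabs (r1 + r2 * (1 + x + r1)) <= e * h + e * h * 3).
  { eapply Rle_trans; [apply Rabs_triang|]. rewrite Rabs_mult.
    apply Rplus_le_compat; [lra|]. apply Rmult_le_bound; split; auto using Rabs_pos. }
  assert (B2 : Rabs ((x + r1) * (y + r3) + r3) <= 2 * e * (2 * h) + e * h).
  { eapply Rle_trans; [apply Rabs_triang|]. rewrite Rabs_mult.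
    apply Rplus_le_compat; [|lra]. apply Rmult_le_bound; split; auto using Rabs_pos. }
  assert (e * h <= eps / 20 * h) by (apply Rmult_le_compat_r; lra).
  assert (0 <= eps * h) by (apply Rmult_le_pos; lra). lra.
Qed.

Lemma cderiv_cexp (z : C) : cderiv cexp z (cexp z).
Proof.
  apply (cderiv_ext (fun w => cexp z * cexp (w - z))%C _ _ (cexp z * (1 * 1))%C);
    [intro w; rewrite <- cexp_plus; f_equal; ring|ring|].
  apply cderiv_scal, (cderiv_comp cexp).
  - apply (cderiv_ext (fun w => w + - z)%C _ _ (1 + 0)%C); [reflexivity|ring|].
    apply cderiv_plus; [apply cderiv_id|apply cderiv_const].
  - replace (z - z)%C with (RtoC 0) by ring. apply cderiv_cexp_0.
Qed.

Lemma cdiff_ee (f : C -> C) (z : C) : cdiff f z -> cdiff (fun w => ee (f w)) z.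
Proof.
  intros H. apply (cdiff_comp cexp).
  - apply cdiff_mult; [apply cdiff_const|exact H].
  - eexists; apply cderiv_cexp.
Qed.

(** * Integrals over boundaries of parallelograms *)

(** Componentwise, so that the real theory of [RInt] applies to each part. *)
Definition CI (f : R -> C) (a b : R) : C :=
  (RInt (fun t => Re (f t)) a b, RInt (fun t => Im (f t)) a b).

Definition rcont (f : R -> C) (t : R) : Prop :=
  continuous (fun t => Re (f t)) t /\ continuous (fun t => Im (f t)) t.

Definition rcont_on (f : R -> C) (a b : R) : Prop := forall t, a <= t <= b -> rcont f t.

Lemma rcont_on_ex_RInt (f : R -> C) (a b : R) : a <= b -> rcont_on f a b ->
  ex_RInt (fun t => Re (f t)) a b /\ ex_RInt (fun t => Im (f t)) a b.
Proof.
  intros Hab H; split; apply @ex_RInt_continuous; rewrite Rmin_left, Rmax_right by lra;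
    intros t Ht; apply (H t Ht).
Qed.

Lemma CI_ext (f g : R -> C) (a b : R) : a <= b ->
  (forall t, a <= t <= b -> f t = g t) -> CI f a b = CI g a b.
Proof.
  intros Hab H; unfold CI; f_equal; apply RInt_ext; rewrite Rmin_left, Rmax_right by lra;
    intros t Ht; rewrite H by lra; reflexivity.
Qed.

Lemma CI_plus (f g : R -> C) (a b : R) : a <= b -> rcont_on f a b -> rcont_on g a b ->
  CI (fun t => f t + g t)%C a b = (CI f a b + CI g a b)%C.
Proof.
  intros Hab Hf Hg. destruct (rcont_on_ex_RInt f a b Hab Hf), (rcont_on_ex_RInt g a b Hab Hg).
  unfold CI, Cplus; simpl; f_equal.
  - exact (RInt_plus (fun t => Re (f t)) (fun t => Re (g t)) a b ltac:(assumption) ltac:(assumption)).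
  - exact (RInt_plus (fun t => Im (f t)) (fun t => Im (g t)) a b ltac:(assumption) ltac:(assumption)).
Qed.

Lemma CI_scal (c : C) (f : R -> C) (a b : R) : a <= b -> rcont_on f a b ->
  CI (fun t => c * f t)%C a b = (c * CI f a b)%C.
Proof.
  intros Hab Hf. destruct (rcont_on_ex_RInt f a b Hab Hf) as [H1 H2].
  assert (Hs : forall (k : R) (h : R -> R), ex_RInt h a b -> ex_RInt (fun t => k * h t) a b)
    by (intros; apply (@ex_RInt_scal R_NormedModule); assumption).
  assert (Es : forall (k : R) (h : R -> R), ex_RInt h a b ->
    RInt (fun t => k * h t) a b = k * RInt h a b)
    by (intros k h Hh; apply (@RInt_scal R_CompleteNormedModule h a b k Hh)).
  unfold CI. apply injective_projections; simpl.
  - rewrite <- !Es by assumption.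
    rewrite (RInt_ext _ (fun t => minus (fst c * Re (f t)) (snd c * Im (f t)))).
    + exact (RInt_minus (fun t => fst c * Re (f t)) (fun t => snd c * Im (f t)) a b
        (Hs _ _ H1) (Hs _ _ H2)).
    + intros; reflexivity.
  - rewrite <- !Es by assumption.
    rewrite (RInt_ext _ (fun t => plus (fst c * Im (f t)) (snd c * Re (f t)))).
    + exact (RInt_plus (fun t => fst c * Im (f t)) (fun t => snd c * Re (f t)) a b
        (Hs _ _ H2) (Hs _ _ H1)).
    + intros; reflexivity.
Qed.

Lemma CI_Chasles (f : R -> C) (a c b : R) : a <= c <= b -> rcont_on f a b ->
  CI f a b = (CI f a c + CI f c b)%C.
Proof.
  intros Hc Hf.
  destruct (rcont_on_ex_RInt f a c) as [H1 H2]; [lra|intros t Ht; apply Hf; lra|].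
  destruct (rcont_on_ex_RInt f c b) as [H3 H4]; [lra|intros t Ht; apply Hf; lra|].
  unfold CI, Cplus; simpl; f_equal; symmetry.
  - exact (RInt_Chasles (fun t => Re (f t)) a c b H1 H3).
  - exact (RInt_Chasles (fun t => Im (f t)) a c b H2 H4).
Qed.

(** The factor 2 comes from bounding real and imaginary part separately; only the order of magnitude
    matters later. *)
Lemma CI_bound (f : R -> C) (a b M : R) : a <= b -> rcont_on f a b ->
  (forall t, a <= t <= b -> Cmod (f t) <= M) -> Cmod (CI f a b) <= 2 * M * (b - a).
Proof.
  intros Hab Hf HM. destruct (rcont_on_ex_RInt f a b Hab Hf) as [H1 H2].
  eapply Rle_trans; [apply Cmod_le_re_im|]. unfold CI; simpl Re; simpl Im.
  assert (Rabs (RInt (fun t => Re (f t)) a b) <= (b - a) * M).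
  { apply abs_RInt_le_const; [assumption..|]. intros t Ht.
    eapply Rle_trans; [apply re_le_Cmod|auto]. }
  assert (Rabs (RInt (fun t => Im (f t)) a b) <= (b - a) * M).
  { apply abs_RInt_le_const; [assumption..|]. intros t Ht.
    eapply Rle_trans; [apply im_le_Cmod|auto]. }
  simpl in *; lra.
Qed.

Lemma CI_derive (F f : R -> C) (a b : R) : a <= b -> rcont_on f a b ->
  (forall t, a <= t <= b -> is_derive (fun t => Re (F t)) t (Re (f t)) /\
    is_derive (fun t => Im (F t)) t (Im (f t))) ->
  CI f a b = (F b - F a)%C.
Proof.
  intros Hab Hf HF. unfold CI, Cminus, Cplus, Copp; simpl; f_equal; apply is_RInt_unique.
  - apply (is_RInt_derive (fun t => Re (F t)) (fun t => Re (f t)));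
      rewrite Rmin_left, Rmax_right by lra; intros t Ht; [apply HF|apply Hf]; exact Ht.
  - apply (is_RInt_derive (fun t => Im (F t)) (fun t => Im (f t)));
      rewrite Rmin_left, Rmax_right by lra; intros t Ht; [apply HF|apply Hf]; exact Ht.
Qed.

Lemma CI_comp_lin (f : R -> C) (u v a b : R) : 0 <= u -> a <= b ->
  rcont_on f (u * a + v) (u * b + v) ->
  CI (fun t => RtoC u * f (u * t + v)%R)%C a b = CI f (u * a + v) (u * b + v).
Proof.
  intros Hu Hab Hf.
  destruct (rcont_on_ex_RInt f (u * a + v) (u * b + v)) as [H1 H2]; [nra|exact Hf|].
  unfold CI; f_equal.
  - rewrite <- (RInt_comp_lin (fun t => Re (f t)) u v a b H1). apply RInt_ext.
    intros; rewrite re_scal_l; reflexivity.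
  - rewrite <- (RInt_comp_lin (fun t => Im (f t)) u v a b H2). apply RInt_ext.
    intros; rewrite im_scal_l; reflexivity.
Qed.

Definition pt (tau : C) (x y : R) : C := (RtoC x + RtoC y * tau)%C.

(** Meant for [g] a side of a parallelogram and [h] the real or imaginary part of [f] along it. *)
Lemma continuous_of_Cmod (h : R -> R) (g : R -> C) (f : C -> C) (t K : R) :
  (forall s, Cmod (g s - g t) <= K * Rabs (s - t)) ->
  (forall s, Rabs (h s - h t) <= Cmod (f (g s) - f (g t))) ->
  ccont f (g t) -> continuous h t.
Proof.
  intros Hg Hh Hf. apply continuity_pt_filterlim. intros eps Heps.
  destruct (Hf eps Heps) as [d [Hd H]]. assert (HK : 0 < Rabs K + 1) by (pose proof (Rabs_pos K); lra).
  exists (d / (Rabs K + 1)). split; [apply Rdiv_lt_0_compat; lra|].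
  intros s [_ Hs]. simpl in *. unfold Rdist in *.
  eapply Rle_lt_trans; [apply Hh|]. apply H. eapply Rle_lt_trans; [apply Hg|].
  pose proof (RRle_abs K). pose proof (Rabs_pos (s - t)).
  apply Rle_lt_trans with ((Rabs K + 1) * Rabs (s - t)); [nra|].
  replace d with ((Rabs K + 1) * (d / (Rabs K + 1))) by (field; lra).
  apply Rmult_lt_compat_l; lra.
Qed.

Lemma rcont_line (f : C -> C) (g : R -> C) (t K : R) :
  (forall s, Cmod (g s - g t) <= K * Rabs (s - t)) ->
  ccont f (g t) -> rcont (fun s => f (g s)) t.
Proof.
  intros Hg Hf. split; apply (continuous_of_Cmod _ g f t K Hg); auto; intros s.
  - unfold Rminus. rewrite <- re_opp, <- re_plus. apply re_le_Cmod.
  - unfold Rminus. rewrite <- im_opp, <- im_plus. apply im_le_Cmod.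
Qed.

Lemma rcont_pt_x (f : C -> C) (tau : C) (x y : R) :
  ccont f (pt tau x y) -> rcont (fun s => f (pt tau s y)) x.
Proof.
  apply (rcont_line f (fun s => pt tau s y) x 1). intros s. unfold pt.
  replace (RtoC s + RtoC y * tau - (RtoC x + RtoC y * tau))%C with (RtoC (s - x))
    by (rewrite RtoC_minus; ring). rewrite Cmod_R; lra.
Qed.

Lemma rcont_pt_y (f : C -> C) (tau : C) (x y : R) :
  ccont f (pt tau x y) -> rcont (fun s => f (pt tau x s)) y.
Proof.
  apply (rcont_line f (fun s => pt tau x s) y (Cmod tau)). intros s. unfold pt.
  replace (RtoC x + RtoC s * tau - (RtoC x + RtoC y * tau))%C with (tau * RtoC (s - y))%C
    by (rewrite RtoC_minus; ring). rewrite Cmod_mult, Cmod_R; lra.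
Qed.

Lemma is_derive_line (F : C -> C) (p d l : C) (t : R) :
  cderiv F (p + RtoC t * d)%C l ->
  is_derive (fun s => Re (F (p + RtoC s * d)%C)) t (Re (l * d)%C) /\
  is_derive (fun s => Im (F (p + RtoC s * d)%C)) t (Im (l * d)%C).
Proof.
  intros H.
  (* One proof for [Re] and [Im], as both are real-linear and bounded by [Cmod]. In the tolerance
     chosen below, [Cmod d + 1] covers [d = 0] and the half of [eps] makes the last inequality
     strict. *)
  assert (A : forall (h : C -> R) , (forall a b, h (a - b)%C = h a - h b) ->
    (forall (r : R) c, h (RtoC r * c)%C = r * h c) -> (forall c, Rabs (h c) <= Cmod c) ->
    is_derive (fun s => h (F (p + RtoC s * d)%C)) t (h (l * d)%C)).
  { intros h Hm Hs Hb. apply is_derive_Reals. intros eps Heps.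
    pose proof (Cmod_ge_0 d) as Hd0.
    destruct (H (eps / 2 / (Cmod d + 1))) as [r [Hr Hl]];
      [repeat apply Rdiv_lt_0_compat; lra|].
    assert (Hpos : 0 < r / (Cmod d + 1)) by (apply Rdiv_lt_0_compat; lra).
    exists (mkposreal _ Hpos). intros s Hs0 Hs1. simpl in Hs1.
    specialize (Hl (p + RtoC (t + s) * d)%C).
    replace (p + RtoC (t + s) * d - (p + RtoC t * d))%C with (RtoC s * d)%C in Hl
      by (rewrite RtoC_plus; ring).
    rewrite Cmod_mult, Cmod_R in Hl. pose proof (Rabs_pos_lt s Hs0) as Hsp.
    assert (Hlt : Rabs s * Cmod d < r).
    { replace r with (r / (Cmod d + 1) * (Cmod d + 1)) by (field; lra). nra. }
    specialize (Hl Hlt).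
    set (A := F (p + RtoC (t + s) * d)%C) in *. set (B := F (p + RtoC t * d)%C) in *.
    replace ((h A - h B) / s - h (l * d)%C) with (h (A - B - l * (RtoC s * d))%C / s).
    2:{ rewrite !Hm. replace (l * (RtoC s * d))%C with (RtoC s * (l * d))%C by ring.
        rewrite Hs. field; exact Hs0. }
    unfold Rdiv at 1. rewrite Rabs_mult, Rabs_inv.
    apply (Rmult_lt_reg_r (Rabs s)); [assumption|].
    rewrite Rmult_assoc, Rinv_l, Rmult_1_r by lra.
    eapply Rle_lt_trans; [apply Hb|]. eapply Rle_lt_trans; [exact Hl|].
    replace (eps / 2 / (Cmod d + 1) * (Rabs s * Cmod d))
      with (eps / 2 * Rabs s * (Cmod d / (Cmod d + 1))) by (field; lra).
    assert (Cmod d / (Cmod d + 1) <= 1).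
    { apply (Rmult_le_reg_r (Cmod d + 1)); [lra|]. unfold Rdiv.
      rewrite Rmult_assoc, Rinv_l; lra. }
    assert (0 < eps / 2 * Rabs s) by (apply Rmult_lt_0_compat; lra). nra. }
  split; apply (A (fun c => _ c)).
  - intros a b; unfold Cminus; rewrite re_plus, re_opp; ring.
  - apply re_scal_l.
  - apply re_le_Cmod.
  - intros a b; unfold Cminus; rewrite im_plus, im_opp; ring.
  - apply im_scal_l.
  - apply im_le_Cmod.
Qed.

(* The integral of [g] over the positively oriented boundary of the parallelogram
   [{x + y tau | x0 <= x <= x1, y0 <= y <= y1}]. *)
Definition box (tau : C) (g : C -> C) (x0 x1 y0 y1 : R) : C :=
  (CI (fun x => g (pt tau x y0)) x0 x1 + tau * CI (fun y => g (pt tau x1 y)) y0 y1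
   - CI (fun x => g (pt tau x y1)) x0 x1 - tau * CI (fun y => g (pt tau x0 y)) y0 y1)%C.

Definition on_edge (x0 x1 y0 y1 x y : R) : Prop :=
  x0 <= x <= x1 /\ y0 <= y <= y1 /\ (x = x0 \/ x = x1 \/ y = y0 \/ y = y1).

Definition edge_cont (tau : C) (g : C -> C) (x0 x1 y0 y1 : R) : Prop :=
  forall x y, on_edge x0 x1 y0 y1 x y -> ccont g (pt tau x y).

Lemma edge_cont_sides (tau : C) (g : C -> C) (x0 x1 y0 y1 : R) :
  x0 <= x1 -> y0 <= y1 -> edge_cont tau g x0 x1 y0 y1 ->
  rcont_on (fun x => g (pt tau x y0)) x0 x1 /\ rcont_on (fun x => g (pt tau x y1)) x0 x1 /\
  rcont_on (fun y => g (pt tau x0 y)) y0 y1 /\ rcont_on (fun y => g (pt tau x1 y)) y0 y1.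
Proof.
  intros Hx Hy H. unfold edge_cont, on_edge in H.
  split; [|split; [|split]]; intros t Ht; try (apply rcont_pt_x, H; lra); apply rcont_pt_y, H; lra.
Qed.

Lemma box_plus (tau : C) (f g : C -> C) (x0 x1 y0 y1 : R) :
  x0 <= x1 -> y0 <= y1 -> edge_cont tau f x0 x1 y0 y1 -> edge_cont tau g x0 x1 y0 y1 ->
  box tau (fun w => f w + g w)%C x0 x1 y0 y1 = (box tau f x0 x1 y0 y1 + box tau g x0 x1 y0 y1)%C.
Proof.
  intros Hx Hy Hf Hg. apply edge_cont_sides in Hf; [|lra|lra]. apply edge_cont_sides in Hg; [|lra|lra].
  destruct Hf as [F1 [F2 [F3 F4]]], Hg as [G1 [G2 [G3 G4]]].
  unfold box. rewrite (CI_plus (fun x => f (pt tau x y0)) (fun x => g (pt tau x y0))),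
    (CI_plus (fun x => f (pt tau x y1)) (fun x => g (pt tau x y1))),
    (CI_plus (fun y => f (pt tau x0 y)) (fun y => g (pt tau x0 y))),
    (CI_plus (fun y => f (pt tau x1 y)) (fun y => g (pt tau x1 y))) by assumption.
  ring.
Qed.

Lemma box_scal (tau c : C) (f : C -> C) (x0 x1 y0 y1 : R) :
  x0 <= x1 -> y0 <= y1 -> edge_cont tau f x0 x1 y0 y1 ->
  box tau (fun w => c * f w)%C x0 x1 y0 y1 = (c * box tau f x0 x1 y0 y1)%C.
Proof.
  intros Hx Hy Hf. apply edge_cont_sides in Hf; [|lra|lra]. destruct Hf as [F1 [F2 [F3 F4]]].
  unfold box. rewrite (CI_scal c (fun x => f (pt tau x y0))), (CI_scal c (fun x => f (pt tau x y1))),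
    (CI_scal c (fun y => f (pt tau x0 y))), (CI_scal c (fun y => f (pt tau x1 y))) by assumption.
  ring.
Qed.

Lemma box_ext (tau : C) (f g : C -> C) (x0 x1 y0 y1 : R) :
  x0 <= x1 -> y0 <= y1 ->
  (forall x y, on_edge x0 x1 y0 y1 x y -> f (pt tau x y) = g (pt tau x y)) ->
  box tau f x0 x1 y0 y1 = box tau g x0 x1 y0 y1.
Proof.
  intros Hx Hy H. unfold box, on_edge in *.
  rewrite (CI_ext (fun x => f (pt tau x y0)) (fun x => g (pt tau x y0))),
    (CI_ext (fun x => f (pt tau x y1)) (fun x => g (pt tau x y1))),
    (CI_ext (fun y => f (pt tau x0 y)) (fun y => g (pt tau x0 y))),
    (CI_ext (fun y => f (pt tau x1 y)) (fun y => g (pt tau x1 y)));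
    try reflexivity; try lra; intros t Ht; apply H; lra.
Qed.

(** The 4 is the 2 of [CI_bound] times two parallel sides. *)
Lemma box_bound (tau : C) (g : C -> C) (x0 x1 y0 y1 M : R) :
  x0 <= x1 -> y0 <= y1 -> edge_cont tau g x0 x1 y0 y1 ->
  (forall x y, on_edge x0 x1 y0 y1 x y -> Cmod (g (pt tau x y)) <= M) ->
  Cmod (box tau g x0 x1 y0 y1) <= 4 * M * ((x1 - x0) + Cmod tau * (y1 - y0)).
Proof.
  intros Hx Hy Hg HM. apply edge_cont_sides in Hg; [|lra|lra]. destruct Hg as [F1 [F2 [F3 F4]]].
  unfold on_edge in HM.
  assert (B1 := CI_bound _ _ _ M Hx F1 ltac:(intros; apply HM; lra)).
  assert (B2 := CI_bound _ _ _ M Hx F2 ltac:(intros; apply HM; lra)).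
  assert (B3 := CI_bound _ _ _ M Hy F3 ltac:(intros; apply HM; lra)).
  assert (B4 := CI_bound _ _ _ M Hy F4 ltac:(intros; apply HM; lra)).
  pose proof (Cmod_ge_0 tau).
  apply (Rmult_le_compat_l (Cmod tau)) in B3; [|lra].
  apply (Rmult_le_compat_l (Cmod tau)) in B4; [|lra].
  unfold box. unfold Cminus.
  eapply Rle_trans; [apply Cmod_triangle|].
  eapply Rle_trans; [apply Rplus_le_compat_r, Cmod_triangle|].
  eapply Rle_trans; [apply Rplus_le_compat_r, Rplus_le_compat_r, Cmod_triangle|].
  rewrite !Cmod_opp, !Cmod_mult. lra.
Qed.

(** The two integrals along the cut have opposite signs and cancel as terms, so continuity matters
    on the outer boundary only. *)
Lemma box_cut_x (tau : C) (g : C -> C) (x0 c x1 y0 y1 : R) :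
  x0 <= c <= x1 -> y0 <= y1 -> edge_cont tau g x0 x1 y0 y1 ->
  box tau g x0 x1 y0 y1 = (box tau g x0 c y0 y1 + box tau g c x1 y0 y1)%C.
Proof.
  intros Hx Hy Hg. apply edge_cont_sides in Hg; [|lra|lra]. destruct Hg as [F1 [F2 [F3 F4]]].
  unfold box. rewrite (CI_Chasles _ x0 c x1 Hx F1), (CI_Chasles _ x0 c x1 Hx F2). ring.
Qed.

Lemma box_cut_y (tau : C) (g : C -> C) (x0 x1 y0 c y1 : R) :
  x0 <= x1 -> y0 <= c <= y1 -> edge_cont tau g x0 x1 y0 y1 ->
  box tau g x0 x1 y0 y1 = (box tau g x0 x1 y0 c + box tau g x0 x1 c y1)%C.
Proof.
  intros Hx Hy Hg. apply edge_cont_sides in Hg; [|lra|lra]. destruct Hg as [F1 [F2 [F3 F4]]].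
  unfold box. rewrite (CI_Chasles _ y0 c y1 Hy F3), (CI_Chasles _ y0 c y1 Hy F4). ring.
Qed.

(** Each side contributes the increment of [Q] between its ends, and the four increments cancel. As
    [Q] is a primitive on the boundary only, the lemma applies around a singularity of [q]. *)
Lemma box_derive (tau : C) (Q q : C -> C) (x0 x1 y0 y1 : R) :
  x0 <= x1 -> y0 <= y1 -> edge_cont tau q x0 x1 y0 y1 ->
  (forall x y, on_edge x0 x1 y0 y1 x y -> cderiv Q (pt tau x y) (q (pt tau x y))) ->
  box tau q x0 x1 y0 y1 = 0%C.
Proof.
  intros Hx Hy Hq HQ. pose proof (edge_cont_sides _ _ _ _ _ _ Hx Hy Hq) as [F1 [F2 [F3 F4]]].
  unfold on_edge in HQ.
  assert (A : forall y, y = y0 \/ y = y1 -> rcont_on (fun x => q (pt tau x y)) x0 x1 ->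
    CI (fun x => q (pt tau x y)) x0 x1 = (Q (pt tau x1 y) - Q (pt tau x0 y))%C).
  { intros y Hyy Hc. apply (CI_derive (fun x => Q (pt tau x y))); [lra|exact Hc|].
    intros x Hxx.
    assert (E : forall s, pt tau s y = (RtoC y * tau + RtoC s * 1)%C) by (intro; unfold pt; ring).
    destruct (is_derive_line Q (RtoC y * tau)%C 1%C (q (pt tau x y)) x) as [D1 D2].
    { rewrite <- E. apply HQ; lra. }
    rewrite Cmult_1_r in D1, D2.
    split; eapply is_derive_ext; [|exact D1| |exact D2]; intro s; simpl; rewrite E; reflexivity. }
  assert (B : forall x, x = x0 \/ x = x1 -> rcont_on (fun y => q (pt tau x y)) y0 y1 ->
    (tau * CI (fun y => q (pt tau x y)) y0 y1 = Q (pt tau x y1) - Q (pt tau x y0))%C).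
  { intros x Hxx Hc. rewrite <- CI_scal by assumption.
    rewrite (CI_ext _ (fun y => q (pt tau x y) * tau)%C) by (lra || (intros; ring)).
    apply (CI_derive (fun y => Q (pt tau x y))); [lra| |].
    - intros y Hyy.
      apply (rcont_pt_y (fun w => q w * tau)%C). apply ccont_mult; [|apply ccont_const].
      apply Hq. unfold on_edge. lra.
    - intros y Hyy. apply (is_derive_line Q (RtoC x) tau (q (pt tau x y)) y). apply HQ; lra. }
  unfold box. rewrite !A, !B by tauto. ring.
Qed.

(** * Goursat's lemma *)

Lemma nested_intervals (u v : nat -> R) :
  (forall n, u n <= u (S n) /\ v (S n) <= v n /\ u n <= v n) ->
  exists l, forall n, u n <= l <= v n.
Proof.
  intros H.
  assert (Hu : forall n m, (n <= m)%nat -> u n <= u m)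
    by (intros n m Hnm; induction Hnm as [|m _ IH]; [lra|destruct (H m); lra]).
  assert (Hv : forall n m, (n <= m)%nat -> v m <= v n)
    by (intros n m Hnm; induction Hnm as [|m _ IH]; [lra|destruct (H m); lra]).
  assert (Huv : forall n m, u n <= v m).
  { intros n m. destruct (Nat.le_ge_cases n m) as [Hnm|Hnm].
    - specialize (Hu _ _ Hnm). destruct (H m). lra.
    - specialize (Hv _ _ Hnm). destruct (H n). lra. }
  destruct (completeness (fun x => exists n, x = u n)) as [l [Hl1 Hl2]].
  - exists (v O). intros x [n ->]. apply Huv.
  - exists (u O), O. reflexivity.
  - exists l. intros n. split; [apply Hl1; exists n; reflexivity|].
    apply Hl2. intros x [m ->]. apply Huv.
Qed.

(** The bisection scheme of Goursat's argument: [P n x y] speaks of the n-th box, with corner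
    [(x, y)] and sides [X / 2^n] and [Y / 2^n], and the limit point lies in all the chosen boxes. *)
Lemma nested_boxes (P : nat -> R -> R -> Prop) (x0 y0 X Y : R) :
  0 <= X -> 0 <= Y -> P O x0 y0 ->
  (forall n x y, P n x y -> exists x' y',
     (x' = x \/ x' = x + X / 2 ^ S n) /\ (y' = y \/ y' = y + Y / 2 ^ S n) /\ P (S n) x' y') ->
  exists xs ys, forall n, exists x y,
    P n x y /\ x <= xs <= x + X / 2 ^ n /\ y <= ys <= y + Y / 2 ^ n.
Proof.
  intros HX HY H0 Hs.
  set (nxt := fun n (p q : R * R) =>
    (fst q = fst p \/ fst q = fst p + X / 2 ^ S n) /\
    (snd q = snd p \/ snd q = snd p + Y / 2 ^ S n) /\ P (S n) (fst q) (snd q)).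
  (* [epsilon] picks a successor; [Hn] shows that the pick is good while [P] holds, and [HP] carries
     [P] along the sequence. *)
  set (s := fix s n := match n with O => (x0, y0)
    | S n => epsilon (inhabits (x0, y0)) (nxt n (s n)) end).
  assert (Hn : forall n, P n (fst (s n)) (snd (s n)) -> nxt n (s n) (s (S n))).
  { intros n Hp. simpl. apply epsilon_spec.
    destruct (Hs n _ _ Hp) as [x' [y' H]]. exists (x', y'). exact H. }
  assert (HP : forall n, P n (fst (s n)) (snd (s n))).
  { induction n as [|n IH]; [exact H0|]. apply (Hn n IH). }
  assert (Hh : forall Z n, 0 <= Z -> 0 <= Z / 2 ^ S n /\ Z / 2 ^ n = Z / 2 ^ S n + Z / 2 ^ S n).
  { intros Z n HZ. assert (0 < 2 ^ n) by (apply pow_lt; lra). simpl. split; [|field; lra].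
    apply Rdiv_le_0_compat; lra. }
  destruct (nested_intervals (fun n => fst (s n)) (fun n => fst (s n) + X / 2 ^ n)) as [xs Hxs].
  { intros n. destruct (Hn n (HP n)) as [A _]. destruct (Hh X n HX). lra. }
  destruct (nested_intervals (fun n => snd (s n)) (fun n => snd (s n) + Y / 2 ^ n)) as [ys Hys].
  { intros n. destruct (Hn n (HP n)) as [_ [A _]]. destruct (Hh Y n HY). lra. }
  exists xs, ys. intros n. exists (fst (s n)), (snd (s n)). auto.
Qed.

Lemma Cmod_pt_sub (tau : C) (x y x' y' : R) :
  Cmod (pt tau x y - pt tau x' y') <= Rabs (x - x') + Cmod tau * Rabs (y - y').
Proof.
  replace (pt tau x y - pt tau x' y')%C with (RtoC (x - x') + tau * RtoC (y - y'))%C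
    by (unfold pt; rewrite !RtoC_minus; ring).
  eapply Rle_trans; [apply Cmod_triangle|]. rewrite Cmod_mult, !Cmod_R. lra.
Qed.

Lemma edge_cont_cdiff (tau : C) (g : C -> C) (x0 x1 y0 y1 : R) :
  (forall x y, on_edge x0 x1 y0 y1 x y -> cdiff g (pt tau x y)) -> edge_cont tau g x0 x1 y0 y1.
Proof. intros H x y Hxy. apply cdiff_ccont, H, Hxy. Qed.

(** An affine function has a quadratic primitive. In [goursat] this removes the first-order
    approximation of [g]. *)
Lemma box_affine (tau a b p : C) (x0 x1 y0 y1 : R) : x0 <= x1 -> y0 <= y1 ->
  box tau (fun w => a + b * (w - p))%C x0 x1 y0 y1 = 0%C.
Proof.
  intros Hx Hy.
  assert (Hd : forall z, cderiv (fun w => a * w + b / 2 * ((w + - p) * (w + - p)))%C z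
    (a + b * (z - p))%C).
  { intros z. assert (D : cderiv (fun w => w + - p)%C z (1 + 0)%C)
      by (apply cderiv_plus; [apply cderiv_id|apply cderiv_const]).
    eapply cderiv_ext; [intro; reflexivity| |apply cderiv_plus;
      [apply cderiv_scal, cderiv_id|apply cderiv_scal, cderiv_mult; exact D]].
    cbv beta. field. }
  apply (box_derive tau (fun w => a * w + b / 2 * ((w + - p) * (w + - p)))%C); [lra|lra| |auto].
  apply edge_cont_cdiff. intros x y _.
  apply cdiff_plus; [apply cdiff_const|]. apply cdiff_mult; [apply cdiff_const|].
  apply cdiff_minus; [apply cdiff_id|apply cdiff_const].
Qed.

(** A nonzero integral would leave at least [c / 4^n] on some n-th subbox, while differentiability
    at the limit point makes these integrals [o(4^-n)]. *)
Lemma goursat (tau : C) (g : C -> C) (x0 x1 y0 y1 : R) : x0 <= x1 -> y0 <= y1 ->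
  (forall x y, x0 <= x <= x1 -> y0 <= y <= y1 -> cdiff g (pt tau x y)) ->
  box tau g x0 x1 y0 y1 = 0%C.
Proof.
  intros Hx Hy Hg. apply NNPP. intros Hne. apply Cmod_gt_0 in Hne.
  set (c := Cmod (box tau g x0 x1 y0 y1)) in *. set (X := x1 - x0). set (Y := y1 - y0).
  pose proof (Cmod_ge_0 tau) as Ht. assert (HX : 0 <= X) by (unfold X; lra).
  assert (HY : 0 <= Y) by (unfold Y; lra).
  (* The invariant: the subbox lies in the original box, and its integral has modulus at least
     [c / 4^n]. *)
  destruct (nested_boxes (fun n x y => x0 <= x /\ x + X / 2 ^ n <= x1 /\ y0 <= y /\
      y + Y / 2 ^ n <= y1 /\ c / 4 ^ n <= Cmod (box tau g x (x + X / 2 ^ n) y (y + Y / 2 ^ n)))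
      x0 y0 X Y HX HY) as [xs [ys Hlim]].
  - simpl. rewrite !Rdiv_1_r. replace (x0 + X) with x1 by (unfold X; ring).
    replace (y0 + Y) with y1 by (unfold Y; ring). fold c. lra.
  - intros n x y [H1 [H2 [H3 [H4 H5]]]].
    assert (H2n : 0 < 2 ^ n) by (apply pow_lt; lra).
    assert (EX : X / 2 ^ n = X / 2 ^ S n + X / 2 ^ S n) by (simpl; field; lra).
    assert (EY : Y / 2 ^ n = Y / 2 ^ S n + Y / 2 ^ S n) by (simpl; field; lra).
    assert (HX' : 0 <= X / 2 ^ S n) by (apply Rdiv_le_0_compat; [lra|simpl; lra]).
    assert (HY' : 0 <= Y / 2 ^ S n) by (apply Rdiv_le_0_compat; [lra|simpl; lra]).
    rewrite EX in H2, H5. rewrite EY in H4, H5. set (a := X / 2 ^ S n) in *.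
    set (b := Y / 2 ^ S n) in *.
    assert (Hc : forall u u' v v', x <= u -> u' <= x + (a + a) -> y <= v -> v' <= y + (b + b) ->
      edge_cont tau g u u' v v').
    { intros u u' v v' I1 I2 I3 I4. apply edge_cont_cdiff. unfold on_edge.
      intros; apply Hg; lra. }
    rewrite (box_cut_x tau g x (x + a)) in H5 by (lra || (apply Hc; lra)).
    rewrite (box_cut_y tau g x (x + a) y (y + b) (y + (b + b))),
      (box_cut_y tau g (x + a) (x + (a + a)) y (y + b) (y + (b + b))) in H5
      by (lra || (apply Hc; lra)).
    replace (x + (a + a)) with (x + a + a) in H5 by ring.
    replace (y + (b + b)) with (y + b + b) in H5 by ring.
    assert (E4 : c / 4 ^ n = 4 * (c / 4 ^ S n)) by (simpl; field; apply pow_nonzero; lra).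
    rewrite E4 in H5. set (e := c / 4 ^ S n) in *.
    (* The four quarters sum to the box, so they cannot all fall below a quarter of its modulus. *)
    assert (Ht4 : e <= Cmod (box tau g x (x + a) y (y + b)) \/
      e <= Cmod (box tau g x (x + a) (y + b) (y + b + b)) \/
      e <= Cmod (box tau g (x + a) (x + a + a) y (y + b)) \/
      e <= Cmod (box tau g (x + a) (x + a + a) (y + b) (y + b + b))).
    { apply NNPP. intros Hno.
      pose proof (Cmod_triangle (box tau g x (x + a) y (y + b) + box tau g x (x + a) (y + b) (y + b + b))
        (box tau g (x + a) (x + a + a) y (y + b) + box tau g (x + a) (x + a + a) (y + b) (y + b + b))).
      pose proof (Cmod_triangle (box tau g x (x + a) y (y + b)) (box tau g x (x + a) (y + b) (y + b + b))).
      pose proof (Cmod_triangle (box tau g (x + a) (x + a + a) y (y + b))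
        (box tau g (x + a) (x + a + a) (y + b) (y + b + b))).
      apply not_or_and in Hno. destruct Hno as [N1 Hno].
      apply not_or_and in Hno. destruct Hno as [N2 Hno].
      apply not_or_and in Hno. destruct Hno as [N3 N4]. lra. }
    destruct Ht4 as [Hb|[Hb|[Hb|Hb]]].
    + exists x, y. repeat split; try lra; auto.
    + exists x, (y + b). repeat split; try lra; auto.
    + exists (x + a), y. repeat split; try lra; auto.
    + exists (x + a), (y + b). repeat split; try lra; auto.
  - assert (Hin : x0 <= xs <= x1 /\ y0 <= ys <= y1).
    { destruct (Hlim O) as [x [y H]]. simpl in H. rewrite !Rdiv_1_r in H. lra. }
    destruct (Hg xs ys (proj1 Hin) (proj2 Hin)) as [l Hl].
    (* With [h = 2^-n], [K h] is half the perimeter of the n-th box and bounds the distance of its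
       edge from [p], so the integral of the remainder is at most [4 e K^2 h^2]. As
       [c = 8 e (K^2 + 1)], this is less than the [c h^2] of the invariant; the [+ 1] covers
       degenerate boxes. *)
    set (K := X + Cmod tau * Y). assert (HK : 0 <= K) by (unfold K; nra).
    set (p := pt tau xs ys) in *.
    assert (He : 0 < c / (8 * (K * K + 1))) by (apply Rdiv_lt_0_compat; nra).
    set (e := c / (8 * (K * K + 1))) in *.
    destruct (Hl e He) as [d [Hd Hr]].
    destruct (pow_lt_1_zero (1 / 2) ltac:(rewrite Rabs_right; lra) (d / (K + 1))) as [n Hn];
      [apply Rdiv_lt_0_compat; lra|].
    specialize (Hn n (Nat.le_refl n)).
    destruct (Hlim n) as [x [y [[I1 [I2 [I3 [I4 I5]]]] [I6 I7]]]].
    assert (H2n : 0 < 2 ^ n) by (apply pow_lt; lra).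
    replace ((1 / 2) ^ n) with (/ 2 ^ n) in Hn
      by (unfold Rdiv; rewrite Rmult_1_l, pow_inv; reflexivity).
    assert (Hinv : 0 < / 2 ^ n) by (apply Rinv_0_lt_compat; lra).
    rewrite Rabs_right in Hn by lra.
    set (h := / 2 ^ n) in *. unfold Rdiv in I2, I4, I5, I6, I7. fold h in I2, I4, I5, I6, I7.
    assert (HXh : 0 <= X * h) by (apply Rmult_le_pos; lra).
    assert (HYh : 0 <= Y * h) by (apply Rmult_le_pos; lra).
    assert (Hdist : forall u v, on_edge x (x + X * h) y (y + Y * h) u v ->
      Cmod (pt tau u v - p) <= K * h).
    { intros u v Huv. unfold on_edge in Huv.
      eapply Rle_trans; [apply Cmod_pt_sub|].
      assert (Rabs (u - xs) <= X * h) by (apply Rabs_le; lra).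
      assert (Rabs (v - ys) <= Y * h) by (apply Rabs_le; lra).
      replace (K * h) with (X * h + Cmod tau * (Y * h)) by (unfold K; ring).
      apply Rplus_le_compat; [lra|]. apply Rmult_le_compat_l; lra. }
    assert (HKh : K * h < d).
    { replace d with ((K + 1) * (d / (K + 1))) by (field; lra). nra. }
    set (aff := fun w => (g p + l * (w - p))%C).
    assert (Haff : forall z, cdiff aff z).
    { intro z. apply cdiff_plus; [apply cdiff_const|]. apply cdiff_mult; [apply cdiff_const|].
      apply cdiff_minus; [apply cdiff_id|apply cdiff_const]. }
    assert (Hgd : forall u v, on_edge x (x + X * h) y (y + Y * h) u v -> cdiff g (pt tau u v)).
    { intros u v Huv. unfold on_edge in Huv. apply Hg; lra. }
    assert (Eb : box tau g x (x + X * h) y (y + Y * h) =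
      box tau (fun w => g w - aff w)%C x (x + X * h) y (y + Y * h)).
    { rewrite (box_ext tau g (fun w => (g w - aff w) + aff w)%C) by (lra || (intros; ring)).
      rewrite box_plus; [| lra | lra | |].
      - unfold aff at 2. rewrite box_affine by lra. apply Cplus_0_r.
      - apply edge_cont_cdiff. intros u v Huv. apply cdiff_minus; auto.
      - apply edge_cont_cdiff. intros u v Huv. auto. }
    rewrite Eb in I5.
    assert (Hb : Cmod (box tau (fun w => g w - aff w)%C x (x + X * h) y (y + Y * h)) <=
      4 * (e * (K * h)) * ((x + X * h - x) + Cmod tau * (y + Y * h - y))).
    { apply box_bound; [lra|lra| |].
      - apply edge_cont_cdiff. intros u v Huv. apply cdiff_minus; auto.
      - intros u v Huv. specialize (Hdist u v Huv).
        replace (g (pt tau u v) - aff (pt tau u v))%C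
          with (g (pt tau u v) - g p - l * (pt tau u v - p))%C by (unfold aff; ring).
        eapply Rle_trans; [apply Hr; lra|]. apply Rmult_le_compat_l; lra. }
    replace (x + X * h - x + Cmod tau * (y + Y * h - y)) with (K * h) in Hb by (unfold K; ring).
    replace (c * / 4 ^ n) with (c * (h * h)) in I5.
    2:{ unfold h. rewrite <- Rinv_mult. f_equal. f_equal.
        replace 4 with (2 * 2) by ring. rewrite Rpow_mult_distr. reflexivity. }
    assert (Hfin : c * (h * h) <= 4 * e * (K * K) * (h * h)) by (eapply Rle_trans; [exact I5|lra]).
    assert (Hhh : 0 < h * h) by nra.
    apply Rmult_le_reg_r in Hfin; [|exact Hhh].
    assert (Ec : c = 8 * e * (K * K + 1)) by (unfold e; field; nra).
    assert (0 <= e * (K * K)) by (apply Rmult_le_pos; nra). lra.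
Qed.

(** * The residue theorem *)

Definition cy (tau u : C) : R := Im u / Im tau.
Definition cx (tau u : C) : R := Re u - cy tau u * Re tau.

Lemma pt_coord (tau u : C) : 0 < Im tau -> pt tau (cx tau u) (cy tau u) = u.
Proof.
  intros Ht. unfold pt, cx, cy. destruct u as [a b], tau as [t s]; simpl in *.
  unfold Cplus, Cmult, RtoC; simpl. f_equal; field; lra.
Qed.

Lemma coord_pt (tau : C) (x y : R) : 0 < Im tau ->
  cx tau (pt tau x y) = x /\ cy tau (pt tau x y) = y.
Proof.
  intros Ht. unfold pt, cx, cy. destruct tau as [t s]; simpl in *. split; field; lra.
Qed.

Lemma pt_inj (tau : C) (x y x' y' : R) : 0 < Im tau ->
  pt tau x y = pt tau x' y' -> x = x' /\ y = y'.
Proof.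
  intros Ht E. destruct (coord_pt tau x y Ht) as [A B], (coord_pt tau x' y' Ht) as [A' B'].
  rewrite E in A, B. split; congruence.
Qed.

Lemma re_pt (tau : C) (x y : R) : Re (pt tau x y) = x + y * Re tau.
Proof. unfold pt. rewrite re_plus, re_scal_l, re_RtoC. reflexivity. Qed.

Lemma im_pt (tau : C) (x y : R) : Im (pt tau x y) = y * Im tau.
Proof. unfold pt. rewrite im_plus, im_scal_l, im_RtoC. ring. Qed.

Definition W0 (tau : C) : C := box tau (fun w => / w)%C (-1) 1 (-1) 1.

Lemma pt_sub (tau : C) (x y x' y' : R) :
  (pt tau x y - pt tau x' y')%C = pt tau (x - x') (y - y').
Proof. unfold pt. rewrite !RtoC_minus. ring. Qed.

Lemma pt_neq_0 (tau : C) (x y : R) : 0 < Im tau -> x <> 0 \/ y <> 0 -> pt tau x y <> 0%C.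
Proof.
  intros Ht H E. replace (RtoC 0) with (pt tau 0 0) in E by (unfold pt; ring).
  apply pt_inj in E; [|exact Ht]. lra.
Qed.

(** The form [dw / (w - p)] is invariant under scaling about [p], so the size of the box does not
    matter. *)
Lemma box_inv_scale (tau : C) (a b d : R) : 0 < Im tau -> 0 < d ->
  box tau (fun w => / (w - pt tau a b))%C (a - d) (a + d) (b - d) (b + d) = W0 tau.
Proof.
  intros Ht Hd.
  assert (Hc : edge_cont tau (fun w => / (w - pt tau a b))%C (a - d) (a + d) (b - d) (b + d)).
  { apply edge_cont_cdiff. unfold on_edge. intros x y Hxy.
    eexists; apply cderiv_inv; [|apply cderiv_plus; [apply cderiv_id|apply cderiv_const]].
    change (pt tau x y - pt tau a b <> 0)%C. rewrite pt_sub. apply pt_neq_0; [exact Ht|lra]. }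
  assert (Hs : forall s t, s = -1 \/ s = 1 \/ t = -1 \/ t = 1 ->
    (RtoC d * / (pt tau (d * s + a) (d * t + b) - pt tau a b))%C = (/ pt tau s t)%C).
  { intros s t Hst. assert (Hp : pt tau s t <> 0%C) by (apply pt_neq_0; [exact Ht|lra]).
    rewrite pt_sub. replace (pt tau (d * s + a - a) (d * t + b - b)) with (RtoC d * pt tau s t)%C
      by (unfold pt; rewrite !RtoC_minus, !RtoC_plus, !RtoC_mult; ring).
    assert (RtoC d <> 0%C) by (intro E; apply RtoC_inj in E; lra). field; auto. }
  apply edge_cont_sides in Hc; [|lra|lra]. destruct Hc as [H1 [H2 [H3 H4]]].
  (* These put the bounds into the shape [u * a + v] that [CI_comp_lin] matches, with the sides of
     [W0] as the unscaled interval. *)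
  assert (Em : forall v, v - d = d * -1 + v) by (intro; ring).
  assert (Ep : forall v, v + d = d * 1 + v) by (intro; ring).
  unfold W0, box. rewrite !Em, !Ep in *.
  rewrite <- !CI_comp_lin by (lra || assumption).
  f_equal; [f_equal; [f_equal|]|].
  - apply CI_ext; [lra|]. intros t Htt. apply Hs; lra.
  - f_equal. apply CI_ext; [lra|]. intros t Htt. apply Hs; lra.
  - apply CI_ext; [lra|]. intros t Htt. apply Hs; lra.
  - f_equal. apply CI_ext; [lra|]. intros t Htt. apply Hs; lra.
Qed.

(* Each of the four sides turns counterclockwise around [0], so contributes a positive imaginary part. *)
Lemma W0_neq_0 (tau : C) : 0 < Im tau -> W0 tau <> 0%C.
Proof.
  intros Ht E.
  assert (Hc : edge_cont tau (fun w => / w)%C (-1) 1 (-1) 1).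
  { apply edge_cont_cdiff. unfold on_edge. intros x y Hxy.
    eexists; apply cderiv_inv; [|apply cderiv_id]. apply pt_neq_0; [exact Ht|lra]. }
  apply edge_cont_sides in Hc; [|lra|lra]. destruct Hc as [H1 [H2 [H3 H4]]].
  assert (Hcs : forall (c : C) (f : R -> C) t, rcont f t -> rcont (fun t => c * f t)%C t).
  { intros c f t [A B]. split.
    - apply (continuous_ext (fun t => minus (Re c * Re (f t)) (Im c * Im (f t))));
        [intro; reflexivity|].
      apply @continuous_minus; [apply (@continuous_scal_r R_UniformSpace R_AbsRing R_NormedModule (Re c) (fun t => Re (f t)))|
        apply (@continuous_scal_r R_UniformSpace R_AbsRing R_NormedModule (Im c) (fun t => Im (f t)))]; assumption.
    - apply (continuous_ext (fun t => plus (Re c * Im (f t)) (Im c * Re (f t))));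
        [intro; reflexivity|].
      apply @continuous_plus; [apply (@continuous_scal_r R_UniformSpace R_AbsRing R_NormedModule (Re c) (fun t => Im (f t)))|
        apply (@continuous_scal_r R_UniformSpace R_AbsRing R_NormedModule (Im c) (fun t => Re (f t)))]; assumption. }
  assert (Hpos : forall (c : C) (f : R -> C), rcont_on f (-1) 1 ->
    (forall t, -1 <= t <= 1 -> 0 < Im (c * f t)%C) -> 0 < Im (c * CI f (-1) 1)%C).
  { intros c f Hf Hp. rewrite <- CI_scal by (lra || assumption).
    unfold CI; simpl. apply RInt_gt_0; [lra| |].
    - intros t Htt. apply Hp; lra.
    - intros t Htt. apply (Hcs c f t (Hf t Htt)). }
  (* [Im (c / w)] has the sign of the imaginary part of [c] times the conjugate of [w], which is the
     second premise. *)
  assert (Hi : forall c w : C, w <> 0%C ->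
    0 < Im c * Re w - Re c * Im w -> 0 < Im (c * / w)%C).
  { intros c w Hw Hp. apply Cmod_gt_0 in Hw.
    assert (Hm : 0 < Re w ^ 2 + Im w ^ 2) by (rewrite <- Cmod2_alt; apply pow_lt, Hw).
    destruct c as [c1 c2], w as [w1 w2]; simpl in *.
    replace (c1 * (- w2 / (w1 * (w1 * 1) + w2 * (w2 * 1))) + c2 * (w1 / (w1 * (w1 * 1) + w2 * (w2 * 1))))
      with ((c2 * w1 - c1 * w2) / (w1 * (w1 * 1) + w2 * (w2 * 1))) by (field; lra).
    apply Rdiv_lt_0_compat; lra. }
  (* The factors are the directions of travel on the bottom, top, left and right sides, in the order
     of [edge_cont_sides]. *)
  assert (I1 := Hpos 1%C _ H1). assert (I2 := Hpos (- (1))%C _ H2).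
  assert (I3 := Hpos (- tau)%C _ H3). assert (I4 := Hpos tau _ H4).
  assert (S : 0 < Im (W0 tau)).
  { unfold W0, box. unfold Cminus. rewrite !im_plus.
    rewrite Cmult_1_l in I1.
    replace (- (1) * CI (fun x => / pt tau x 1) (-1) 1)%C with (- CI (fun x => / pt tau x 1) (-1) 1)%C
      in I2 by ring.
    replace (- tau * CI (fun y => / pt tau (-1) y) (-1) 1)%C
      with (- (tau * CI (fun y => / pt tau (-1) y) (-1) 1))%C in I3 by ring.
    specialize (I1 ltac:(intros; apply Hi; [apply pt_neq_0; lra|rewrite re_pt, im_pt, ?im_opp, ?re_opp, ?im_RtoC, ?re_RtoC; nra])).
    specialize (I2 ltac:(intros; apply Hi; [apply pt_neq_0; lra|rewrite re_pt, im_pt, ?im_opp, ?re_opp, ?im_RtoC, ?re_RtoC; nra])).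
    specialize (I3 ltac:(intros; apply Hi; [apply pt_neq_0; lra|rewrite re_pt, im_pt, ?im_opp, ?re_opp, ?im_RtoC, ?re_RtoC; nra])).
    specialize (I4 ltac:(intros; apply Hi; [apply pt_neq_0; lra|rewrite re_pt, im_pt, ?im_opp, ?re_opp, ?im_RtoC, ?re_RtoC; nra])).
    lra. }
  rewrite E in S. simpl in S. lra.
Qed.

(* [f] is, up to a bounded function and a function with a primitive, [c / (w - u)] near [u]. *)
Definition has_res (f : C -> C) (u c : C) : Prop :=
  exists (Q q : C -> C) (r M : R), 0 < r /\ forall w, 0 < Cmod (w - u) < r ->
    cderiv Q w (q w) /\ cdiff q w /\ Cmod (f w - c / (w - u) - q w) <= M.

(** The polar term gives [c W0] for every [d], the term with a primitive gives 0, and the bounded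
    rest is integrated over a path of length [O(d)]. *)
Lemma has_res_small_box (tau : C) (f : C -> C) (u c : C) : 0 < Im tau -> has_res f u c ->
  exists d1 K, 0 < d1 /\ 0 <= K /\ forall d, 0 < d < d1 ->
    edge_cont tau f (cx tau u - d) (cx tau u + d) (cy tau u - d) (cy tau u + d) ->
    Cmod (box tau f (cx tau u - d) (cx tau u + d) (cy tau u - d) (cy tau u + d) - c * W0 tau) <= K * d.
Proof.
  intros Ht [Q [q [r [M [Hr H]]]]]. set (a := cx tau u). set (b := cy tau u).
  assert (Eu : u = pt tau a b) by (symmetry; apply pt_coord, Ht).
  pose proof (Cmod_ge_0 tau).
  (* A box of half-side [d] stays within [d (1 + |tau|)] of [u]. The second witness is [box_bound]
     with half-perimeter [2 d (1 + |tau|)]. *)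
  exists (r / (1 + Cmod tau)), (8 * Rabs M * (1 + Cmod tau)).
  split; [apply Rdiv_lt_0_compat; lra|]. split; [pose proof (Rabs_pos M); nra|].
  intros d Hd Hf.
  assert (Hdr : d * (1 + Cmod tau) < r).
  { replace r with (r / (1 + Cmod tau) * (1 + Cmod tau)) by (field; lra).
    apply Rmult_lt_compat_r; lra. }
  assert (Hin : forall x y, on_edge (a - d) (a + d) (b - d) (b + d) x y ->
    0 < Cmod (pt tau x y - u) < r).
  { unfold on_edge. intros x y Hxy. rewrite Eu. split.
    - apply Cmod_gt_0. rewrite pt_sub. apply pt_neq_0; [exact Ht|lra].
    - eapply Rle_lt_trans; [apply Cmod_pt_sub|].
      assert (Rabs (x - a) <= d) by (apply Rabs_le; lra).
      assert (Rabs (y - b) <= d) by (apply Rabs_le; lra).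
      apply (Rmult_le_compat_l (Cmod tau)) in H2; lra. }
  assert (Hinv : forall x y, on_edge (a - d) (a + d) (b - d) (b + d) x y ->
    ccont (fun w => / (w - u))%C (pt tau x y)).
  { intros x y Hxy. apply cdiff_ccont. eexists; apply cderiv_inv;
      [|apply cderiv_plus; [apply cderiv_id|apply cderiv_const]].
    apply Cmod_gt_0, (Hin x y Hxy). }
  set (g := fun w => (f w + (- c) * / (w - u) + (- (1)) * q w)%C).
  assert (Hq : edge_cont tau q (a - d) (a + d) (b - d) (b + d))
    by (apply edge_cont_cdiff; intros x y Hxy; apply (H _ (Hin x y Hxy))).
  assert (Hcg : edge_cont tau g (a - d) (a + d) (b - d) (b + d)).
  { intros x y Hxy. apply ccont_plus; [apply ccont_plus; [apply Hf, Hxy|]|].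
    - apply ccont_mult; [apply ccont_const|apply Hinv, Hxy].
    - apply ccont_mult; [apply ccont_const|apply Hq, Hxy]. }
  assert (Ebox : box tau f (a - d) (a + d) (b - d) (b + d) =
    (box tau g (a - d) (a + d) (b - d) (b + d) + c * W0 tau)%C).
  { rewrite (box_ext tau f (fun w => (g w + c * / (w - u)) + q w)%C)
      by (lra || (intros; unfold g; ring)).
    rewrite box_plus; [|lra|lra| |exact Hq].
    - rewrite (box_plus tau g (fun w => c * / (w - u))%C); [|lra|lra|exact Hcg|].
      + rewrite box_scal; [|lra|lra|exact Hinv].
        rewrite Eu, box_inv_scale by lra.
        rewrite (box_derive tau Q q); [ring|lra|lra|exact Hq|].
        intros x y Hxy. apply (H _ (Hin x y Hxy)).
      + intros x y Hxy. apply ccont_mult; [apply ccont_const|apply Hinv, Hxy].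
    - intros x y Hxy. apply ccont_plus; [apply Hcg, Hxy|].
      apply ccont_mult; [apply ccont_const|apply Hinv, Hxy]. }
  rewrite Ebox. replace (_ + c * W0 tau - c * W0 tau)%C
    with (box tau g (a - d) (a + d) (b - d) (b + d)) by ring.
  eapply Rle_trans; [apply (box_bound tau g _ _ _ _ (Rabs M)); [lra|lra|exact Hcg|]|].
  - intros x y Hxy. eapply Rle_trans; [|apply RRle_abs].
    eapply Rle_trans; [|apply (H _ (Hin x y Hxy))]. right. f_equal. unfold g, Cdiv. ring.
  - right. ring.
Qed.

Definition inside (tau : C) (x0 x1 y0 y1 : R) (u : C) : Prop :=
  x0 < cx tau u < x1 /\ y0 < cy tau u < y1.

(** The list stays fixed while boxes are cut: each box selects its own points from it, and the
    selections add up when no point lies on the cut. *)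
Definition res_sum (tau : C) (c : C -> C) (l : list C) (x0 x1 y0 y1 : R) : C :=
  sum_list l (fun u => if excluded_middle_informative (inside tau x0 x1 y0 y1 u) then c u else 0%C).

Lemma sum_list_ext (l : list C) (f g : C -> C) :
  (forall u, In u l -> f u = g u) -> sum_list l f = sum_list l g.
Proof.
  induction l as [|u l IH]; intros H; [reflexivity|]. simpl.
  rewrite (H u), IH; [reflexivity|intros v Hv; apply H; right; exact Hv|left; reflexivity].
Qed.

Lemma sum_list_plus (l : list C) (f g : C -> C) :
  sum_list l (fun u => f u + g u)%C = (sum_list l f + sum_list l g)%C.
Proof. induction l as [|u l IH]; simpl; [ring|rewrite IH; ring]. Qed.

Lemma res_sum_all (tau : C) (c : C -> C) (l : list C) (x0 x1 y0 y1 : R) :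
  (forall u, In u l -> inside tau x0 x1 y0 y1 u) -> res_sum tau c l x0 x1 y0 y1 = sum_list l c.
Proof.
  intros H. apply sum_list_ext. intros u Hu.
  destruct excluded_middle_informative; [reflexivity|]. exfalso; auto.
Qed.

Lemma res_sum_none (tau : C) (c : C -> C) (l : list C) (x0 x1 y0 y1 : R) :
  (forall u, In u l -> ~ inside tau x0 x1 y0 y1 u) -> res_sum tau c l x0 x1 y0 y1 = 0%C.
Proof.
  intros H. transitivity (sum_list l (fun _ => 0%C)).
  - apply sum_list_ext. intros u Hu.
    destruct excluded_middle_informative; [|reflexivity]. exfalso; eapply H; eauto.
  - clear. induction l as [|u l IH]; simpl; [reflexivity|rewrite IH; ring].
Qed.

Lemma res_sum_cut_x (tau : C) (c : C -> C) (l : list C) (x0 e x1 y0 y1 : R) :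
  x0 <= e <= x1 -> (forall u, In u l -> cx tau u <> e) ->
  res_sum tau c l x0 x1 y0 y1 = (res_sum tau c l x0 e y0 y1 + res_sum tau c l e x1 y0 y1)%C.
Proof.
  intros He H. unfold res_sum. rewrite <- sum_list_plus. apply sum_list_ext.
  intros u Hu. specialize (H u Hu). unfold inside.
  repeat destruct excluded_middle_informative; try ring; exfalso;
    destruct (Rtotal_order (cx tau u) e) as [?|[?|?]]; lra.
Qed.

Lemma res_sum_cut_y (tau : C) (c : C -> C) (l : list C) (x0 x1 y0 e y1 : R) :
  y0 <= e <= y1 -> (forall u, In u l -> cy tau u <> e) ->
  res_sum tau c l x0 x1 y0 y1 = (res_sum tau c l x0 x1 y0 e + res_sum tau c l x0 x1 e y1)%C.
Proof.
  intros He H. unfold res_sum. rewrite <- sum_list_plus. apply sum_list_ext.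
  intros u Hu. specialize (H u Hu). unfold inside.
  repeat destruct excluded_middle_informative; try ring; exfalso;
    destruct (Rtotal_order (cy tau u) e) as [?|[?|?]]; lra.
Qed.

(** A coordinate of [v] that equals that of [u] is missed by the lines at distance [d]; one that
    differs is at a fixed distance, which [d0] stays below. At least one coordinate differs, as
    [v <> u]. *)
Lemma generic_cut (tau u : C) (l : list C) : 0 < Im tau -> ~ In u l ->
  exists d0, 0 < d0 /\ forall d, 0 < d < d0 -> forall v, In v l ->
    cx tau v <> cx tau u - d /\ cx tau v <> cx tau u + d /\
    cy tau v <> cy tau u - d /\ cy tau v <> cy tau u + d /\
    ~ (cx tau u - d <= cx tau v <= cx tau u + d /\ cy tau u - d <= cy tau v <= cy tau u + d).
Proof.
  intros Ht. induction l as [|v l IH]; intros Hu.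
  - exists 1. split; [lra|]. intros d _ v [].
  - destruct IH as [d0 [Hd0 H]]; [intro Hi; apply Hu; right; exact Hi|].
    assert (Hpos : exists e, 0 < e /\ forall d, 0 < d < e ->
      cx tau v <> cx tau u - d /\ cx tau v <> cx tau u + d /\
      cy tau v <> cy tau u - d /\ cy tau v <> cy tau u + d /\
      ~ (cx tau u - d <= cx tau v <= cx tau u + d /\ cy tau u - d <= cy tau v <= cy tau u + d)).
    { assert (Hg : forall p q : R, exists e, 0 < e /\ forall d, 0 < d < e ->
        p <> q - d /\ p <> q + d /\ (p <> q -> ~ (q - d <= p <= q + d))).
      { intros p q. destruct (Req_dec p q) as [->|Hn].
        - exists 1. split; [lra|]. intros; repeat split; try lra.
        - exists (Rabs (p - q)). split; [apply Rabs_pos_lt; lra|]. unfold Rabs.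
          destruct Rcase_abs; intros; repeat split; lra. }
      destruct (Hg (cx tau v) (cx tau u)) as [e1 [He1 H1]].
      destruct (Hg (cy tau v) (cy tau u)) as [e2 [He2 H2]].
      exists (Rmin e1 e2). split; [apply Rmin_pos; lra|]. intros d Hd.
      pose proof (Rmin_l e1 e2). pose proof (Rmin_r e1 e2).
      destruct (H1 d ltac:(lra)) as [A1 [A2 A3]]. destruct (H2 d ltac:(lra)) as [B1 [B2 B3]].
      repeat split; auto. intros [C1 C2].
      assert (Ex : cx tau v = cx tau u) by (apply NNPP; intro; apply A3; assumption).
      assert (Ey : cy tau v = cy tau u) by (apply NNPP; intro; apply B3; assumption).
      apply Hu. left. rewrite <- (pt_coord tau v Ht), <- (pt_coord tau u Ht), Ex, Ey. reflexivity. }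
    destruct Hpos as [e [He Hv]]. exists (Rmin d0 e). split; [apply Rmin_pos; lra|].
    pose proof (Rmin_l d0 e). pose proof (Rmin_r d0 e).
    intros d Hd w [<-|Hw]; [apply Hv; lra|apply (H d); [lra|exact Hw]].
Qed.

(** Induction on the list. A small box around the first point [u] is cut out; the four pieces around
    it fall under the induction hypothesis, and the small box has the integral [c u W0] up to [K d].
    The list may contain points outside the box, because all pieces share it. *)
Theorem residue_theorem (tau : C) (f c : C -> C) (l : list C) :
  0 < Im tau -> NoDup l -> (forall u, In u l -> has_res f u (c u)) ->
  forall x0 x1 y0 y1, x0 <= x1 -> y0 <= y1 ->
  (forall x y, on_edge x0 x1 y0 y1 x y -> ~ In (pt tau x y) l) ->
  (forall x y, x0 <= x <= x1 -> y0 <= y <= y1 -> ~ In (pt tau x y) l -> cdiff f (pt tau x y)) ->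
  box tau f x0 x1 y0 y1 = (W0 tau * res_sum tau c l x0 x1 y0 y1)%C.
Proof.
  intros Ht. induction l as [|u l IH]; intros Hnd Hres x0 x1 y0 y1 Hx Hy Hedge Hf.
  - rewrite goursat; [unfold res_sum; simpl; ring|lra|lra|]. intros; apply Hf; auto.
  - inversion_clear Hnd as [|? ? Hul Hndl].
    assert (IH' := IH Hndl (fun v Hv => Hres v (or_intror Hv))). clear IH.
    set (a := cx tau u). set (b := cy tau u).
    assert (Eu : u = pt tau a b) by (symmetry; apply pt_coord, Ht).
    assert (Ecr : forall x y, cx tau (pt tau x y) = x /\ cy tau (pt tau x y) = y)
      by (intros; apply coord_pt, Ht).
    assert (Hnu : forall x y, x <> a \/ y <> b -> u <> pt tau x y).
    { intros x y Hxy E. rewrite Eu in E. apply pt_inj in E; [lra|exact Ht]. }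
    destruct (classic (inside tau x0 x1 y0 y1 u)) as [Hin|Hin].
    + destruct (has_res_small_box tau f u (c u) Ht (Hres u (or_introl eq_refl)))
        as [d1 [K [Hd1 [HK Hsm]]]].
      destruct (generic_cut tau u l Ht Hul) as [d0 [Hd0 Hcut]].
      fold a b in Hsm, Hcut. unfold inside in Hin. fold a b in Hin.
      set (d2 := Rmin (Rmin d0 d1) (Rmin (Rmin (a - x0) (x1 - a)) (Rmin (b - y0) (y1 - b)))).
      assert (Hd2 : 0 < d2) by (unfold d2; repeat apply Rmin_pos; lra).
      assert (Hle : d2 <= d0 /\ d2 <= d1 /\ d2 <= a - x0 /\ d2 <= x1 - a /\ d2 <= b - y0 /\ d2 <= y1 - b).
      { unfold d2, Rmin. repeat destruct Rle_dec; lra. }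
      clearbody d2.
      assert (Hest : forall d, 0 < d < d2 ->
        Cmod (box tau f x0 x1 y0 y1 - W0 tau * res_sum tau c (u :: l) x0 x1 y0 y1) <= K * d).
      { intros d Hd. specialize (Hcut d ltac:(lra)).
        (* Neither the border nor the lines of the four cuts meet the list: [u] is at distance [d]
           from these lines, and the other points avoid them by the choice of [d]. *)
        assert (Hni : forall x y, x0 <= x <= x1 -> y0 <= y <= y1 ->
          x = x0 \/ x = x1 \/ y = y0 \/ y = y1 \/ x = a - d \/ x = a + d \/ y = b - d \/ y = b + d ->
          ~ In (pt tau x y) (u :: l)).
        { intros x y H1 H2 H3 H4.
          destruct (classic (x = x0 \/ x = x1 \/ y = y0 \/ y = y1)) as [H5|H5].
          - apply (Hedge x y); [unfold on_edge; lra|exact H4].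
          - destruct H4 as [H4|H4]; [revert H4; apply Hnu; lra|].
            specialize (Hcut _ H4). destruct (Ecr x y) as [-> ->] in Hcut. lra. }
        assert (Hec : forall X0 X1 Y0 Y1, x0 <= X0 -> X1 <= x1 -> y0 <= Y0 -> Y1 <= y1 ->
          X0 <= X1 -> Y0 <= Y1 ->
          (X0 = x0 \/ X0 = a - d \/ X0 = a + d) -> (X1 = x1 \/ X1 = a - d \/ X1 = a + d) ->
          (Y0 = y0 \/ Y0 = b - d \/ Y0 = b + d) -> (Y1 = y1 \/ Y1 = b - d \/ Y1 = b + d) ->
          (forall x y, on_edge X0 X1 Y0 Y1 x y -> ~ In (pt tau x y) (u :: l)) /\
          edge_cont tau f X0 X1 Y0 Y1).
        { intros X0 X1 Y0 Y1 I1 I2 I3 I4 I5 I6 D1 D2 D3 D4.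
          assert (Hi : forall x y, on_edge X0 X1 Y0 Y1 x y -> ~ In (pt tau x y) (u :: l)).
          { intros x y [J1 [J2 J3]].
            apply Hni; [clear - I1 I2 J1; lra|clear - I3 I4 J2; lra|].
            destruct J3 as [E|[E|[E|E]]]; rewrite E; clear - D1 D2 D3 D4; tauto. }
          split; [exact Hi|]. apply edge_cont_cdiff. intros x y Hxy. apply Hf; [| |apply Hi, Hxy];
          destruct Hxy as [J1 [J2 _]]; [clear - I1 I2 J1|clear - I3 I4 J2]; lra. }
        (* The last premise says that the piece leaves [u] out, so that the shorter list contains
           all its singularities. *)
        assert (Hpiece : forall X0 X1 Y0 Y1, x0 <= X0 -> X1 <= x1 -> y0 <= Y0 -> Y1 <= y1 ->
          X0 <= X1 -> Y0 <= Y1 ->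
          (X0 = x0 \/ X0 = a - d \/ X0 = a + d) -> (X1 = x1 \/ X1 = a - d \/ X1 = a + d) ->
          (Y0 = y0 \/ Y0 = b - d \/ Y0 = b + d) -> (Y1 = y1 \/ Y1 = b - d \/ Y1 = b + d) ->
          (X1 < a \/ a < X0 \/ Y1 < b \/ b < Y0) ->
          box tau f X0 X1 Y0 Y1 = (W0 tau * res_sum tau c l X0 X1 Y0 Y1)%C).
        { intros X0 X1 Y0 Y1 I1 I2 I3 I4 I5 I6 D1 D2 D3 D4 D5. apply IH'; [exact I5|exact I6| |].
          - intros x y Hxy Hi.
            apply (proj1 (Hec X0 X1 Y0 Y1 I1 I2 I3 I4 I5 I6 D1 D2 D3 D4) x y Hxy).
            right; exact Hi.
          - intros x y J1 J2 Hi. clear D1 D2 D3 D4. apply Hf; [lra|lra|].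
            intros [E|Hi']; [|auto]. revert E. apply Hnu. lra. }
        (* Two full-height strips left and right of [u], and the middle strip cut into three; the
           centre piece is the small box. *)
        rewrite (box_cut_x tau f x0 (a - d) x1) by (lra || (apply Hec; lra)).
        rewrite (box_cut_x tau f (a - d) (a + d) x1) by (lra || (apply Hec; lra)).
        rewrite (box_cut_y tau f (a - d) (a + d) y0 (b - d) y1) by (lra || (apply Hec; lra)).
        rewrite (box_cut_y tau f (a - d) (a + d) (b - d) (b + d) y1) by (lra || (apply Hec; lra)).
        rewrite (Hpiece x0 (a - d) y0 y1), (Hpiece (a + d) x1 y0 y1),
          (Hpiece (a - d) (a + d) y0 (b - d)), (Hpiece (a - d) (a + d) (b + d) y1) by lra.
        assert (Er : res_sum tau c (u :: l) x0 x1 y0 y1 = (c u + res_sum tau c l x0 x1 y0 y1)%C).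
        { unfold res_sum; simpl. destruct excluded_middle_informative as [_|n]; [reflexivity|].
          exfalso; apply n. unfold inside. fold a b. lra. }
        rewrite Er.
        rewrite (res_sum_cut_x tau c l x0 (a - d) x1) by (lra || (intros; apply Hcut; assumption)).
        rewrite (res_sum_cut_x tau c l (a - d) (a + d) x1) by (lra || (intros; apply Hcut; assumption)).
        rewrite (res_sum_cut_y tau c l (a - d) (a + d) y0 (b - d) y1)
          by (lra || (intros; apply Hcut; assumption)).
        rewrite (res_sum_cut_y tau c l (a - d) (a + d) (b - d) (b + d) y1)
          by (lra || (intros; apply Hcut; assumption)).
        rewrite (res_sum_none tau c l (a - d) (a + d) (b - d) (b + d)).
        2:{ intros v Hv Hiv. apply (Hcut v Hv). unfold inside in Hiv. lra. }
        eapply Rle_trans; [|apply (Hsm d); [lra|apply Hec; lra]].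
        right. f_equal. ring. }
      (* A fixed modulus bounded by [K d] for all small [d] vanishes. *)
      apply Ceq_minus. apply NNPP. intros Hne. apply Cmod_gt_0 in Hne.
      set (m := Cmod _) in Hne, Hest.
      assert (He : 0 < Rmin (d2 / 2) (m / (2 * (K + 1)))).
      { apply Rmin_pos; [lra|apply Rdiv_lt_0_compat; lra]. }
      pose proof (Rmin_l (d2 / 2) (m / (2 * (K + 1)))).
      pose proof (Rmin_r (d2 / 2) (m / (2 * (K + 1)))).
      specialize (Hest (Rmin (d2 / 2) (m / (2 * (K + 1)))) ltac:(lra)).
      assert (K * Rmin (d2 / 2) (m / (2 * (K + 1))) <= (K + 1) * (m / (2 * (K + 1))))
        by (apply Rmult_le_compat; lra).
      replace ((K + 1) * (m / (2 * (K + 1)))) with (m / 2) in H1 by (field; lra). lra.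
    + assert (Hout : forall x y, x0 <= x <= x1 -> y0 <= y <= y1 -> u <> pt tau x y).
      { intros x y H1 H2 E. destruct (classic (on_edge x0 x1 y0 y1 x y)) as [He|He].
        - apply (Hedge x y He). left; exact E.
        - apply Hin. rewrite E. unfold inside. destruct (Ecr x y) as [-> ->].
          unfold on_edge in He. lra. }
      rewrite (IH' x0 x1 y0 y1 Hx Hy).
      * f_equal. unfold res_sum; simpl. destruct excluded_middle_informative; [tauto|ring].
      * intros x y Hxy Hi. apply (Hedge x y Hxy). right; exact Hi.
      * intros x y H1 H2 Hi. apply Hf; [exact H1|exact H2|]. intros [E|Hi']; [|auto].
        apply (Hout x y H1 H2 E).
Qed.

(** * Cauchy's formula *)

Lemma holo_at_cdiff (f : C -> C) (u : C) :
  holo_at f u <-> exists r, 0 < r /\ forall w, Cmod (w - u) < r -> cdiff f w.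
Proof.
  split; intros [r [Hr H]]; exists r; (split; [exact Hr|]); intros w Hw;
    apply cdiff_ex_derive, H, Hw.
Qed.

Lemma holo_at_cdiff_self (f : C -> C) (u : C) : holo_at f u -> cdiff f u.
Proof.
  intros H. apply holo_at_cdiff in H. destruct H as [r [Hr H]]. apply H.
  rewrite Cmod_self. exact Hr.
Qed.

Lemma holo_at_open (f : C -> C) (u : C) : holo_at f u ->
  exists r, 0 < r /\ forall w, Cmod (w - u) < r -> holo_at f w.
Proof.
  intros [r [Hr H]]. exists (r / 2). split; [lra|]. intros w Hw.
  exists (r / 2). split; [lra|]. intros w' Hw'. apply H.
  pose proof (Cmod_sub_triangle w' w u). lra.
Qed.

(** For local results the box with [Ci] in place of [tau] suffices: its edge stays between the
    distances [d] and [2 d] from the centre. *)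
Definition square (g : C -> C) (v : C) (d : R) : C :=
  box Ci g (Re v - d) (Re v + d) (Im v - d) (Im v + d).

Lemma Im_Ci_pos : 0 < Im Ci.
Proof. simpl; lra. Qed.

Lemma pt_Ci (v : C) : v = pt Ci (Re v) (Im v).
Proof. destruct v; unfold pt, Ci, RtoC, Cplus, Cmult; simpl. f_equal; ring. Qed.

Lemma square_dist (v : C) (d x y : R) : 0 < d ->
  Re v - d <= x <= Re v + d -> Im v - d <= y <= Im v + d ->
  Cmod (pt Ci x y - v) <= 2 * d /\
  (on_edge (Re v - d) (Re v + d) (Im v - d) (Im v + d) x y -> d <= Cmod (pt Ci x y - v)).
Proof.
  intros Hd Hx Hy.
  assert (Ep : (pt Ci x y - v)%C = pt Ci (x - Re v) (y - Im v))
    by (rewrite (pt_Ci v) at 1; apply pt_sub).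
  rewrite Ep. split.
  - eapply Rle_trans; [apply Cmod_le_re_im|]. rewrite re_pt, im_pt. simpl.
    rewrite Rmult_0_r, Rplus_0_r, Rmult_1_r.
    assert (Rabs (x - Re v) <= d) by (apply Rabs_le; lra).
    assert (Rabs (y - Im v) <= d) by (apply Rabs_le; lra). simpl in *. lra.
  - unfold on_edge. intros [_ [_ H]].
    pose proof (re_le_Cmod (pt Ci (x - Re v) (y - Im v))) as A.
    pose proof (im_le_Cmod (pt Ci (x - Re v) (y - Im v))) as B.
    rewrite re_pt in A. rewrite im_pt in B. change (Re Ci) with 0 in A. change (Im Ci) with 1 in B.
    assert (Rabs (x - Re v + (y - Im v) * 0) = d \/ Rabs ((y - Im v) * 1) = d) as [E|E]; [|lra|lra].
    destruct H as [H|[H|[H|H]]].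
    + left. replace (x - Re v + (y - Im v) * 0) with (- d) by lra.
      rewrite Rabs_Ropp. apply Rabs_right; lra.
    + left. replace (x - Re v + (y - Im v) * 0) with d by lra. apply Rabs_right; lra.
    + right. replace ((y - Im v) * 1) with (- d) by lra. rewrite Rabs_Ropp. apply Rabs_right; lra.
    + right. replace ((y - Im v) * 1) with d by lra. apply Rabs_right; lra.
Qed.

Lemma square_bound (g : C -> C) (v : C) (d M : R) : 0 < d ->
  edge_cont Ci g (Re v - d) (Re v + d) (Im v - d) (Im v + d) ->
  (forall w, d <= Cmod (w - v) <= 2 * d -> Cmod (g w) <= M) ->
  Cmod (square g v d) <= 16 * M * d.
Proof.
  intros Hd Hg HM. unfold square.
  eapply Rle_trans; [apply (box_bound Ci g _ _ _ _ M); [lra|lra|exact Hg|]|].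
  - intros x y Hxy. apply HM.
    pose proof Hxy as [H1 [H2 _]]. destruct (square_dist v d x y Hd H1 H2); split; auto.
  - rewrite Cmod_Ci. right; ring.
Qed.

Lemma cdiff_shift_comp (K : C -> C) (v w : C) :
  cdiff K (w - v)%C -> cdiff (fun w => K (w - v)%C) w.
Proof.
  intros H. apply (cdiff_comp K (fun w => w - v)%C); [|exact H].
  apply cdiff_minus; [apply cdiff_id|apply cdiff_const].
Qed.

Lemma cderiv_of_quadratic (f : C -> C) (z l : C) (r B : R) : 0 < r ->
  (forall w, Cmod (w - z) < r ->
     Cmod (f w - f z - l * (w - z)) <= B * (Cmod (w - z) * Cmod (w - z))) -> cderiv f z l.
Proof.
  intros Hr H eps Heps. pose proof (Rabs_pos B) as HB. pose proof (RRle_abs B) as HB'.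
  assert (He : 0 < eps / (Rabs B + 1)) by (apply Rdiv_lt_0_compat; lra).
  exists (Rmin r (eps / (Rabs B + 1))). split; [apply Rmin_pos; lra|]. intros w Hw.
  pose proof (Rmin_l r (eps / (Rabs B + 1))). pose proof (Rmin_r r (eps / (Rabs B + 1))).
  pose proof (Cmod_ge_0 (w - z)). eapply Rle_trans; [apply H; lra|].
  rewrite <- Rmult_assoc. apply Rmult_le_compat_r; [lra|].
  apply Rle_trans with ((Rabs B + 1) * (eps / (Rabs B + 1))); [|right; field; lra].
  apply Rle_trans with ((Rabs B + 1) * Cmod (w - z)); [apply Rmult_le_compat_r|
    apply Rmult_le_compat_l]; lra.
Qed.

(** Differentiation under the integral sign in the parameter [v] of a kernel [K (w - v)]; because of
    the sign of [v], [K'] is minus the derivative of [K]. The second-order remainder of the kernel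
    is uniform along the edge, so it survives integration. *)
Lemma square_kernel_quadratic (h K K' : C -> C) (v0 : C) (d M B : R) :
  0 < d -> 0 <= M -> 0 <= B ->
  edge_cont Ci h (Re v0 - d) (Re v0 + d) (Im v0 - d) (Im v0 + d) ->
  (forall w, d <= Cmod (w - v0) <= 2 * d -> Cmod (h w) <= M) ->
  (forall a : C, a <> 0%C -> cdiff K a /\ cdiff K' a) ->
  (forall a e : C, d / 2 <= Cmod a -> Cmod e <= d / 4 ->
     Cmod (K (a - e) - K a - e * K' a)%C <= B * (Cmod e * Cmod e)) ->
  forall v, Cmod (v - v0) < d / 2 ->
  forall v', Cmod (v' - v) < Rmin (d / 4) (d / 2 - Cmod (v - v0)) ->
  Cmod (square (fun w => h w * K (w - v'))%C v0 d - square (fun w => h w * K (w - v))%C v0 d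
     - square (fun w => h w * K' (w - v))%C v0 d * (v' - v))
  <= 16 * (M * B) * d * (Cmod (v' - v) * Cmod (v' - v)).
Proof.
  intros Hd HM HB Hh HhM HK HKe v Hv v' Hv'.
  pose proof (Rmin_l (d / 4) (d / 2 - Cmod (v - v0))).
  pose proof (Rmin_r (d / 4) (d / 2 - Cmod (v - v0))).
  set (e := (v' - v)%C) in *.
  assert (Hv'0 : Cmod (v' - v0) < d / 2)
    by (pose proof (Cmod_sub_triangle v' v v0); unfold e in *; lra).
  assert (Hfar : forall z w, Cmod (z - v0) < d / 2 -> d <= Cmod (w - v0) -> d / 2 <= Cmod (w - z)).
  { intros z w Hz Hw. pose proof (Cmod_sub_triangle w z v0). lra. }
  assert (Hne : forall z w, Cmod (z - v0) < d / 2 -> d <= Cmod (w - v0) -> (w - z <> 0)%C).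
  { intros z w Hz Hw. apply Cmod_gt_0. specialize (Hfar z w Hz Hw). lra. }
  assert (Hec : forall (L : C -> C) z, (forall a : C, a <> 0%C -> cdiff L a) -> Cmod (z - v0) < d / 2 ->
    edge_cont Ci (fun w => h w * L (w - z))%C (Re v0 - d) (Re v0 + d) (Im v0 - d) (Im v0 + d)).
  { intros L z HL Hz x y Hxy. apply ccont_mult; [apply Hh, Hxy|].
    apply cdiff_ccont, cdiff_shift_comp, HL, Hne; [exact Hz|].
    pose proof Hxy as [H3 [H4 _]]. apply (square_dist v0 d x y Hd H3 H4), Hxy. }
  assert (HcK := Hec K v (fun a Ha => proj1 (HK a Ha)) Hv).
  assert (HcK2 := Hec K v' (fun a Ha => proj1 (HK a Ha)) Hv'0).
  assert (HcK' := Hec K' v (fun a Ha => proj2 (HK a Ha)) Hv).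
  (* The three integrals become a single one, of [h] times the remainder of the kernel. *)
  set (g := fun w => (h w * K (w - v') + (- (1)) * (h w * K (w - v)) + (- e) * (h w * K' (w - v)))%C).
  assert (Hsc : forall c (k : C -> C),
    edge_cont Ci k (Re v0 - d) (Re v0 + d) (Im v0 - d) (Im v0 + d) ->
    edge_cont Ci (fun w => c * k w)%C (Re v0 - d) (Re v0 + d) (Im v0 - d) (Im v0 + d)).
  { intros c k Hk x y Hxy. apply ccont_mult; [apply ccont_const|apply Hk, Hxy]. }
  assert (Hcg1 : edge_cont Ci (fun w => h w * K (w - v') + (- (1)) * (h w * K (w - v)))%C
      (Re v0 - d) (Re v0 + d) (Im v0 - d) (Im v0 + d)).
  { intros x y Hxy. apply (ccont_plus (fun w => h w * K (w - v'))%C); [apply HcK2, Hxy|].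
    apply (Hsc _ _ HcK), Hxy. }
  assert (Hcg : edge_cont Ci g (Re v0 - d) (Re v0 + d) (Im v0 - d) (Im v0 + d)).
  { intros x y Hxy. apply ccont_plus; [apply Hcg1, Hxy|]. apply (Hsc _ _ HcK'), Hxy. }
  assert (Esq : (square (fun w => h w * K (w - v'))%C v0 d - square (fun w => h w * K (w - v))%C v0 d
     - square (fun w => h w * K' (w - v))%C v0 d * e)%C = square g v0 d).
  { unfold square, g. rewrite (box_plus Ci (fun w => h w * K (w - v') + (- (1)) * (h w * K (w - v)))%C);
      [|lra|lra|exact Hcg1|apply Hsc, HcK'].
    rewrite (box_plus Ci (fun w => h w * K (w - v'))%C); [|lra|lra|exact HcK2|apply Hsc, HcK].
    rewrite !box_scal by (lra || assumption). ring. }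
  rewrite Esq.
  eapply Rle_trans; [apply (square_bound g v0 d (M * (B * (Cmod e * Cmod e)))); [exact Hd|exact Hcg|]|].
  - intros w Hw. unfold g.
    replace (h w * K (w - v') + - (1) * (h w * K (w - v)) + - e * (h w * K' (w - v)))%C
      with (h w * (K ((w - v) - e) - K (w - v) - e * K' (w - v)))%C.
    2:{ replace (w - v - e)%C with (w - v')%C by (unfold e; ring). ring. }
    rewrite Cmod_mult. apply Rmult_le_bound; split; try apply Cmod_ge_0; [apply HhM, Hw|].
    apply HKe; [apply Hfar; [exact Hv|lra]|lra].
  - right. ring.
Qed.

Lemma Cmod_inv_le (a : C) (r : R) : 0 < r -> r <= Cmod a -> a <> 0%C /\ Cmod (/ a) <= / r.
Proof.
  intros Hr Ha. assert (Hne : a <> 0%C) by (apply Cmod_gt_0; lra). split; [exact Hne|].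
  rewrite Cmod_inv by exact Hne. apply Rinv_le_contravar; lra.
Qed.

Lemma kernel_1 (d : R) (a e : C) : 0 < d -> d / 2 <= Cmod a -> Cmod e <= d / 4 ->
  Cmod (/ (a - e) - / a - e * / (a * a))%C
    <= (/ (d / 2) * / (d / 2) * / (d / 4)) * (Cmod e * Cmod e).
Proof.
  intros Hd Ha He.
  assert (Hae : d / 4 <= Cmod (a - e)).
  { pose proof (Cmod_le_add a (a - e)). replace (a - (a - e))%C with e in H by ring. lra. }
  destruct (Cmod_inv_le a (d / 2)) as [Na Ba]; [lra|lra|].
  destruct (Cmod_inv_le (a - e) (d / 4)) as [Ne Be]; [lra|lra|].
  replace (/ (a - e) - / a - e * / (a * a))%C with (/ a * / a * / (a - e) * (e * e))%C by (field; auto).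
  rewrite !Cmod_mult. apply Rmult_le_compat_r; [apply Rmult_le_pos; apply Cmod_ge_0|].
  apply Rmult_le_bound; [split|split; [apply Cmod_ge_0|exact Be]].
  - apply Rmult_le_pos; apply Cmod_ge_0.
  - apply Rmult_le_bound; split; auto using Cmod_ge_0.
Qed.

(** The remainder is exactly [e^2 (3 - 2 e/a) / (a^2 (a - e)^2)]; since [|e| <= |a|], 5 bounds the
    factor in the middle. *)
Lemma kernel_2 (d : R) (a e : C) : 0 < d -> d / 2 <= Cmod a -> Cmod e <= d / 4 ->
  Cmod (/ ((a - e) * (a - e)) - / (a * a) - e * (2 * / (a * a * a)))%C
    <= (5 * (/ (d / 2) * / (d / 2) * (/ (d / 4) * / (d / 4)))) * (Cmod e * Cmod e).
Proof.
  intros Hd Ha He.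
  assert (Hae : d / 4 <= Cmod (a - e)).
  { pose proof (Cmod_le_add a (a - e)). replace (a - (a - e))%C with e in H by ring. lra. }
  destruct (Cmod_inv_le a (d / 2)) as [Na Ba]; [lra|lra|].
  destruct (Cmod_inv_le (a - e) (d / 4)) as [Ne Be]; [lra|lra|].
  replace (/ ((a - e) * (a - e)) - / (a * a) - e * (2 * / (a * a * a)))%C
    with ((3 - 2 * (e * / a)) * (/ a * / a * (/ (a - e) * / (a - e))) * (e * e))%C by (field; auto).
  rewrite !Cmod_mult. apply Rmult_le_compat_r; [apply Rmult_le_pos; apply Cmod_ge_0|].
  apply Rmult_le_bound; split; try apply Cmod_ge_0.
  - unfold Cminus. eapply Rle_trans; [apply Cmod_triangle|].
    rewrite Cmod_opp, !Cmod_mult, !Cmod_R.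
    rewrite (Rabs_right 3), (Rabs_right 2) by lra.
    assert (Cmod e * Cmod (/ a) <= 1); [|lra].
    replace 1 with (d / 2 * / (d / 2)) by (field; lra).
    apply Rmult_le_bound; split; try apply Cmod_ge_0; lra.
  - repeat apply Rmult_le_pos; apply Cmod_ge_0.
  - apply Rmult_le_bound; split; try (apply Rmult_le_pos; apply Cmod_ge_0);
      apply Rmult_le_bound; split; auto using Cmod_ge_0.
Qed.

Lemma cdiff_inv_powers (a : C) : a <> 0%C ->
  cdiff (fun a => / (a * a))%C a /\ cdiff (fun a => 2 * / (a * a * a))%C a.
Proof.
  intros Ha.
  assert (H2 : cdiff (fun a => a * a)%C a) by (apply cdiff_mult; apply cdiff_id).
  assert (H3 : cdiff (fun a => a * a * a)%C a) by (apply cdiff_mult; [exact H2|apply cdiff_id]).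
  destruct H2 as [l2 H2], H3 as [l3 H3]. split.
  - eexists; apply (cderiv_inv (fun a => a * a)%C); [|exact H2].
    apply Cmult_neq_0; assumption.
  - apply cdiff_mult; [apply cdiff_const|].
    eexists; apply (cderiv_inv (fun a => a * a * a)%C); [|exact H3].
    repeat apply Cmult_neq_0; assumption.
Qed.

Definition cauchy_int (h : C -> C) (v0 : C) (d : R) (v : C) : C :=
  square (fun w => h w * / (w - v))%C v0 d.

(** The kernel [1 / (w - v)] gives the derivative [B], and the kernel [1 / (w - v)^2] differentiates
    [B] once more. [E] is uniform in [v]. *)
Lemma cdiff_cauchy_int (h : C -> C) (v0 : C) (d M : R) : 0 < d -> 0 <= M ->
  edge_cont Ci h (Re v0 - d) (Re v0 + d) (Im v0 - d) (Im v0 + d) ->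
  (forall w, d <= Cmod (w - v0) <= 2 * d -> Cmod (h w) <= M) ->
  exists (B : C -> C) (E : R), forall v, Cmod (v - v0) < d / 2 -> cdiff B v /\
    forall v', Cmod (v' - v) < Rmin (d / 4) (d / 2 - Cmod (v - v0)) ->
    Cmod (cauchy_int h v0 d v' - cauchy_int h v0 d v - B v * (v' - v))
      <= E * (Cmod (v' - v) * Cmod (v' - v)).
Proof.
  intros Hd HM Hh HhM. exists (fun v => square (fun w => h w * / ((w - v) * (w - v)))%C v0 d).
  exists (16 * (M * (/ (d / 2) * / (d / 2) * / (d / 4))) * d).
  assert (0 < / (d / 2)) by (apply Rinv_0_lt_compat; lra).
  assert (0 < / (d / 4)) by (apply Rinv_0_lt_compat; lra).
  intros v Hv. split.
  - eexists. apply (cderiv_of_quadratic _ _ _ (Rmin (d / 4) (d / 2 - Cmod (v - v0)))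
      (16 * (M * (5 * (/ (d / 2) * / (d / 2) * (/ (d / 4) * / (d / 4))))) * d));
      [apply Rmin_pos; lra|].
    apply (square_kernel_quadratic h (fun a => / (a * a))%C (fun a => 2 * / (a * a * a))%C);
      try assumption.
    + repeat apply Rmult_le_pos; lra.
    + intros a Ha. apply cdiff_inv_powers, Ha.
    + intros a e Ha He. apply kernel_2; assumption.
  - apply (square_kernel_quadratic h (fun a => / a)%C (fun a => / (a * a))%C); try assumption.
    + repeat apply Rmult_le_pos; lra.
    + intros a Ha. split; [eexists; apply cderiv_inv_id, Ha|].
      apply cdiff_inv_powers, Ha.
    + intros a e Ha He. apply kernel_1; assumption.
Qed.

(** The difference quotient of [f] at [v] is bounded, so the part with a primitive can be taken to
    be 0. *)
Lemma has_res_simple (f : C -> C) (v : C) : cdiff f v -> has_res (fun w => f w * / (w - v))%C v (f v).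
Proof.
  intros [l Hl]. destruct (cderiv_bounded _ _ _ Hl) as [d [Hd H]].
  exists (fun _ => 0%C), (fun _ => 0%C), d, (Cmod l + 1). split; [exact Hd|].
  intros w [Hw1 Hw2]. split; [apply cderiv_const|]. split; [apply cdiff_const|].
  specialize (H w Hw2).
  assert (w - v <> 0)%C by (apply Cmod_gt_0, Hw1).
  replace (f w * / (w - v) - f v / (w - v) - 0)%C with ((f w - f v) / (w - v))%C by (field; assumption).
  rewrite Cmod_div by assumption. apply (Rmult_le_reg_r (Cmod (w - v))); [exact Hw1|].
  unfold Rdiv. rewrite Rmult_assoc, Rinv_l; lra.
Qed.

(** The residue theorem with the single point [v]; [W0 Ci] stands where [2 pi i] usually does. *)
Lemma cauchy_formula (f : C -> C) (v0 : C) (d : R) : 0 < d ->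
  (forall w, Cmod (w - v0) <= 2 * d -> cdiff f w) ->
  forall v, Cmod (v - v0) < d / 2 -> cauchy_int f v0 d v = (W0 Ci * f v)%C.
Proof.
  intros Hd Hf v Hv. unfold cauchy_int, square.
  assert (Hre : Rabs (Re v - Re v0) < d / 2).
  { eapply Rle_lt_trans; [|exact Hv]. unfold Rminus; rewrite <- re_opp, <- re_plus. apply re_le_Cmod. }
  assert (Him : Rabs (Im v - Im v0) < d / 2).
  { eapply Rle_lt_trans; [|exact Hv]. unfold Rminus; rewrite <- im_opp, <- im_plus. apply im_le_Cmod. }
  apply Rabs_def2 in Hre. apply Rabs_def2 in Him.
  assert (Ecx : cx Ci v = Re v) by (unfold cx; simpl; ring).
  assert (Ecy : cy Ci v = Im v) by (unfold cy; simpl; field).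
  rewrite (residue_theorem Ci _ (fun _ => f v) (v :: nil)); try lra.
  - f_equal. rewrite res_sum_all; [simpl; ring|].
    intros u [<-|[]]. unfold inside. rewrite Ecx, Ecy. lra.
  - exact Im_Ci_pos.
  - constructor; [intros []|constructor].
  - intros u [<-|[]]. apply has_res_simple, Hf. lra.
  - intros x y Hxy [E|[]]. rewrite E in Ecx, Ecy. destruct (coord_pt Ci x y Im_Ci_pos) as [E1 E2].
    unfold on_edge in Hxy. rewrite E in Hre, Him. rewrite <- Ecx, E1 in Hre.
    rewrite <- Ecy, E2 in Him. lra.
  - intros x y Hx Hy Hni. apply cdiff_mult; [apply Hf, (square_dist v0 d x y Hd Hx Hy)|].
    eexists; apply cderiv_inv; [|apply cderiv_plus; [apply cderiv_id|apply cderiv_const]].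
    intros E. apply Hni. left. symmetry. apply Ceq_minus, E.
Qed.

(** Cauchy's formula is a premise, in place of differentiability, so that the lemma also serves
    uniform limits, which inherit the formula before they are known to be differentiable. *)
Lemma cdiff_C_derive_of_cauchy (f : C -> C) (v0 : C) (d M : R) : 0 < d -> 0 <= M ->
  edge_cont Ci f (Re v0 - d) (Re v0 + d) (Im v0 - d) (Im v0 + d) ->
  (forall w, d <= Cmod (w - v0) <= 2 * d -> Cmod (f w) <= M) ->
  (forall v, Cmod (v - v0) < d / 2 -> cauchy_int f v0 d v = (W0 Ci * f v)%C) ->
  exists E, forall v, Cmod (v - v0) < d / 2 -> cdiff f v /\ cdiff (C_derive f) v /\
    forall v', Cmod (v' - v) < Rmin (d / 4) (d / 2 - Cmod (v - v0)) ->
    Cmod (f v' - f v - C_derive f v * (v' - v)) <= E * (Cmod (v' - v) * Cmod (v' - v)).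
Proof.
  intros Hd HM Hc HfM Hcau.
  destruct (cdiff_cauchy_int f v0 d M Hd HM Hc HfM) as [B [E HB]].
  assert (HW : W0 Ci <> 0%C) by apply W0_neq_0, Im_Ci_pos.
  assert (Hq : forall v, Cmod (v - v0) < d / 2 ->
    forall v', Cmod (v' - v) < Rmin (d / 4) (d / 2 - Cmod (v - v0)) ->
    Cmod (f v' - f v - / W0 Ci * B v * (v' - v))
      <= Cmod (/ W0 Ci) * E * (Cmod (v' - v) * Cmod (v' - v))).
  { intros v Hv v' Hv'. destruct (HB v Hv) as [_ H1]. specialize (H1 v' Hv').
    pose proof (Cmod_sub_triangle v' v v0). pose proof (Rmin_r (d / 4) (d / 2 - Cmod (v - v0))).
    rewrite !Hcau in H1 by lra.
    replace (f v' - f v - / W0 Ci * B v * (v' - v))%C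
      with (/ W0 Ci * (W0 Ci * f v' - W0 Ci * f v - B v * (v' - v)))%C by (field; exact HW).
    rewrite Cmod_mult, Rmult_assoc. apply Rmult_le_compat_l; [apply Cmod_ge_0|exact H1]. }
  assert (Hd1 : forall v, Cmod (v - v0) < d / 2 -> cderiv f v (/ W0 Ci * B v)%C).
  { intros v Hv. eapply cderiv_of_quadratic; [|apply Hq, Hv]. apply Rmin_pos; lra. }
  exists (Cmod (/ W0 Ci) * E). intros v Hv. split; [eexists; apply Hd1, Hv|]. split.
  - apply (cdiff_ext_loc (fun v => / W0 Ci * B v)%C _ _ (d / 2 - Cmod (v - v0))); [lra| |].
    + intros w Hw. symmetry. apply cderiv_unique, Hd1. pose proof (Cmod_sub_triangle w v v0). lra.
    + apply cdiff_mult; [apply cdiff_const|]. apply HB, Hv.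
  - rewrite (cderiv_unique _ _ _ (Hd1 v Hv)). apply Hq, Hv.
Qed.

(** The differentiability of [C_derive f] feeds [holo_at_C_derive]; the quadratic bound is what
    [AL_pole] uses to cancel a double zero. *)
Lemma holo_at_quadratic (f : C -> C) (u : C) : holo_at f u ->
  exists r E, 0 < r /\ forall v, Cmod (v - u) < r -> cdiff (C_derive f) v /\
    Cmod (f v - f u - C_derive f u * (v - u)) <= E * (Cmod (v - u) * Cmod (v - u)).
Proof.
  intros H. apply holo_at_cdiff in H. destruct H as [r [Hr H]].
  destruct (cdiff_ccont f u (H u ltac:(rewrite Cmod_self; exact Hr)) 1 Rlt_0_1) as [d' [Hd' Hb]].
  pose proof (Rmin_l r d'). pose proof (Rmin_r r d').
  assert (0 < Rmin r d') by (apply Rmin_pos; lra). set (d := Rmin r d' / 4).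
  assert (Hd : 0 < d) by (unfold d; lra). pose proof (Cmod_ge_0 (f u)).
  assert (Hin : forall w, Cmod (w - u) <= 2 * d -> cdiff f w) by (intros; apply H; unfold d in *; lra).
  destruct (cdiff_C_derive_of_cauchy f u d (Cmod (f u) + 1)) as [E HE]; [exact Hd|lra| | | |].
  - apply edge_cont_cdiff. intros x y [Hx [Hy _]]. apply Hin, (square_dist u d x y Hd Hx Hy).
  - intros w Hw. pose proof (Cmod_le_add (f w) (f u)).
    specialize (Hb w ltac:(unfold d in *; lra)). lra.
  - apply cauchy_formula; assumption.
  - exists (d / 4), E. split; [lra|]. intros v Hv. split; [apply HE; lra|].
    apply HE; rewrite Cmod_self; [lra|]. rewrite Rmin_left; lra.
Qed.

Lemma holo_at_C_derive (f : C -> C) (u : C) : holo_at f u -> holo_at (C_derive f) u.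
Proof.
  intros H. apply holo_at_quadratic in H. destruct H as [r [E [Hr H]]].
  apply holo_at_cdiff. exists r. split; [exact Hr|]. apply H.
Qed.

(** * Residues at poles of higher order, uniform limits *)

Lemma has_res_plus (f g : C -> C) (u a b : C) :
  has_res f u a -> has_res g u b -> has_res (fun w => f w + g w)%C u (a + b)%C.
Proof.
  intros [Q [q [r [M [Hr H]]]]] [Q' [q' [r' [M' [Hr' H']]]]].
  exists (fun w => Q w + Q' w)%C, (fun w => q w + q' w)%C, (Rmin r r'), (M + M').
  split; [apply Rmin_pos; lra|]. intros w Hw.
  pose proof (Rmin_l r r'). pose proof (Rmin_r r r').
  destruct (H w ltac:(lra)) as [A1 [A2 A3]]. destruct (H' w ltac:(lra)) as [B1 [B2 B3]].
  split; [apply cderiv_plus; assumption|]. split; [apply cdiff_plus; assumption|].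
  replace (f w + g w - (a + b) / (w - u) - (q w + q' w))%C
    with ((f w - a / (w - u) - q w) + (g w - b / (w - u) - q' w))%C by (unfold Cdiv; ring).
  eapply Rle_trans; [apply Cmod_triangle|lra].
Qed.

Lemma has_res_scal (f : C -> C) (u a k : C) :
  has_res f u a -> has_res (fun w => k * f w)%C u (k * a)%C.
Proof.
  intros [Q [q [r [M [Hr H]]]]].
  exists (fun w => k * Q w)%C, (fun w => k * q w)%C, r, (Cmod k * M).
  split; [exact Hr|]. intros w Hw. destruct (H w Hw) as [A1 [A2 A3]].
  split; [apply cderiv_scal; assumption|].
  split; [apply cdiff_mult; [apply cdiff_const|assumption]|].
  replace (k * f w - k * a / (w - u) - k * q w)%C
    with (k * (f w - a / (w - u) - q w))%C by (unfold Cdiv; ring).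
  rewrite Cmod_mult. apply Rmult_le_compat_l; [apply Cmod_ge_0|assumption].
Qed.

(** This is how principal parts, known only up to [O(1)], enter the computation of residues. *)
Lemma has_res_bounded_diff (f g : C -> C) (u a : C) :
  (exists r M, 0 < r /\ forall w, 0 < Cmod (w - u) < r -> Cmod (g w - f w) <= M) ->
  has_res f u a -> has_res g u a.
Proof.
  intros [r' [M' [Hr' H']]] [Q [q [r [M [Hr H]]]]].
  exists Q, q, (Rmin r r'), (M + M').
  split; [apply Rmin_pos; lra|]. intros w Hw.
  pose proof (Rmin_l r r'). pose proof (Rmin_r r r').
  destruct (H w ltac:(lra)) as [A1 [A2 A3]]. specialize (H' w ltac:(lra)).
  split; [assumption|]. split; [assumption|].
  replace (g w - a / (w - u) - q w)%C with ((f w - a / (w - u) - q w) + (g w - f w))%C by ring.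
  eapply Rle_trans; [apply Cmod_triangle|lra].
Qed.

Lemma has_res_ext (f g : C -> C) (u a : C) :
  (exists r, 0 < r /\ forall w, 0 < Cmod (w - u) < r -> f w = g w) ->
  has_res f u a -> has_res g u a.
Proof.
  intros [r [Hr H]]. apply has_res_bounded_diff. exists r, 0. split; [exact Hr|].
  intros w Hw. rewrite H by exact Hw. rewrite Cmod_self. lra.
Qed.

Lemma has_res_primitive (Q q : C -> C) (u : C) (r : R) : 0 < r ->
  (forall w, 0 < Cmod (w - u) < r -> cderiv Q w (q w) /\ cdiff q w) -> has_res q u 0.
Proof.
  intros Hr H. exists Q, q, r, 0. split; [exact Hr|]. intros w Hw.
  destruct (H w Hw) as [A B]. split; [exact A|split; [exact B|]].
  replace (q w - 0 / (w - u) - q w)%C with (RtoC 0) by (unfold Cdiv; ring). rewrite Cmod_0; lra.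
Qed.

Lemma cderiv_pow_S (f : C -> C) (z l : C) (n : nat) : cderiv f z l ->
  cderiv (fun w => f w ^ S n)%C z (RtoC (INR (S n)) * f z ^ n * l)%C.
Proof.
  intros H. induction n as [|n IH].
  - eapply cderiv_ext; [| |exact H]; [intro; simpl; ring|simpl; ring].
  - eapply cderiv_ext; [| |apply (cderiv_mult _ _ _ _ _ H IH)]; [intro; reflexivity|].
    rewrite (S_INR (S n)), RtoC_plus. simpl Cpow. ring.
Qed.

Definition twopii : C := (2 * PI * Ci)%C.

Lemma twopii_neq_0 : twopii <> 0%C.
Proof.
  intros E. apply (f_equal Im) in E. unfold twopii in E. simpl in E. pose proof PI_RGT_0. lra.
Qed.

(** [Dn] adds derivatives on the outside, whereas the induction in [has_res_pole] replaces [F] by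
    its derivative on the inside. *)
Lemma Dn_shift (j : nat) (g : C -> C) : Dn j (Dn 1 g) = Dn (S j) g.
Proof. induction j as [|j IH]; [reflexivity|]. simpl in *. rewrite IH. reflexivity. Qed.

Lemma holo_at_div_const (f : C -> C) (u c : C) : holo_at f u -> holo_at (fun w => f w / c)%C u.
Proof.
  intros H. apply holo_at_cdiff in H. destruct H as [r [Hr H]].
  apply holo_at_cdiff. exists r. split; [exact Hr|]. intros w Hw.
  apply cdiff_mult; [apply H, Hw|apply cdiff_const].
Qed.

(* Induction on the order of the pole: with [G = F / (w - u)^(n+1)],
   [F / (w - u)^(n+2) = (F' / (w - u)^(n+1) - G') / (n+1)]. *)
Lemma has_res_pole (n : nat) (u : C) : forall F, holo_at F u ->
  has_res (fun w => F w / (twopii * (w - u)) ^ S n)%C u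
    (Dn n F u / (RtoC (INR (fact n)) * twopii))%C.
Proof.
  pose proof twopii_neq_0 as Hk.
  assert (Hne : forall w, 0 < Cmod (w - u) -> (twopii * (w - u))%C <> 0%C).
  { intros w Hw. apply Cmult_neq_0; [exact Hk|apply Cmod_gt_0, Hw]. }
  induction n as [|n IH]; intros F HF.
  - simpl Dn. replace (F u / (RtoC (INR (fact 0)) * twopii))%C with (/ twopii * F u)%C
      by (simpl; field; exact Hk).
    apply (has_res_ext (fun w => / twopii * (F w * / (w - u)))%C).
    + exists 1. split; [lra|]. intros w Hw. specialize (Hne w (proj1 Hw)).
      assert (w - u <> 0)%C by (apply Cmod_gt_0, Hw). simpl. field. auto.
    + apply has_res_scal, has_res_simple, holo_at_cdiff_self, HF.
  - assert (HF1 := holo_at_div_const _ _ twopii (holo_at_C_derive _ _ HF)).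
    specialize (IH _ HF1). change (fun w => C_derive F w / twopii)%C with (Dn 1 F) in *.
    rewrite Dn_shift in IH. apply holo_at_cdiff in HF1. destruct HF1 as [r1 [Hr1 HF1]].
    apply holo_at_cdiff in HF. destruct HF as [r0 [Hr0 HF]].
    assert (Hn : RtoC (INR (S n)) <> 0%C).
    { intros E. apply RtoC_inj in E. revert E. apply not_0_INR. discriminate. }
    assert (Hfn : RtoC (INR (fact n)) <> 0%C).
    { intros E. apply RtoC_inj in E. revert E. apply INR_fact_neq_0. }
    (* This is the derivative of [- F / ((n+1) 2 pi i (2 pi i (w - u))^(n+1))]; the division by
       [2 pi i] in [Dn 1 F] matches the inner derivative of the power. *)
    set (q := fun w => (F w / (twopii * (w - u)) ^ S (S n)
      - / RtoC (INR (S n)) * (Dn 1 F w / (twopii * (w - u)) ^ S n))%C).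
    assert (Hlin : forall w, cderiv (fun w => twopii * (w - u))%C w twopii).
    { intros w. eapply cderiv_ext; [intro; reflexivity| |apply cderiv_scal, cderiv_plus;
        [apply cderiv_id|apply cderiv_const]]. ring. }
    assert (Hq : has_res q u 0).
    { apply (has_res_primitive (fun w => - / (RtoC (INR (S n)) * twopii) *
        (F w * / (twopii * (w - u)) ^ S n))%C q u (Rmin r0 r1)); [apply Rmin_pos; lra|].
      intros w Hw. pose proof (Rmin_l r0 r1). pose proof (Rmin_r r0 r1).
      specialize (Hne w (proj1 Hw)).
      assert (Hp : forall m, ((twopii * (w - u)) ^ m)%C <> 0%C) by (intro; apply Cpow_nz, Hne).
      assert (Hcd : forall m, cdiff (fun w => (twopii * (w - u)) ^ m)%C w).
      { intro m. apply (cdiff_pow (fun w => twopii * (w - u))%C). eexists; apply Hlin. }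
      assert (HFw : cdiff F w) by (apply HF; lra).
      split.
      - eapply cderiv_ext; [intro; reflexivity| |apply cderiv_scal, cderiv_mult;
          [apply cderiv_C_derive, HFw|apply cderiv_inv;
            [apply Hp|apply cderiv_pow_S, Hlin]]].
        unfold q. simpl Dn. change (2 * PI * Ci)%C with twopii.
        specialize (Hp n). simpl Cpow. field. repeat split; try assumption.
        intros E; apply Hne; rewrite E; ring.
      - apply cdiff_minus; [apply cdiff_div; auto|].
        apply cdiff_mult; [apply cdiff_const|apply cdiff_div; auto].
        apply HF1; lra. }
    apply (has_res_ext (fun w => q w + / RtoC (INR (S n)) * (Dn 1 F w / (twopii * (w - u)) ^ S n))%C).
    + exists 1. split; [lra|]. intros w _. unfold q. ring.
    + replace (Dn (S n) F u / (RtoC (INR (fact (S n))) * twopii))%C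
        with (0 + / RtoC (INR (S n)) * (Dn (S n) F u / (RtoC (INR (fact n)) * twopii)))%C.
      * apply has_res_plus; [exact Hq|]. apply has_res_scal, IH.
      * rewrite fact_simpl, mult_INR, RtoC_mult. field. auto.
Qed.

(** * Complex series and their uniform limits *)

Fixpoint psum (N : nat) (a : nat -> C) : C :=
  match N with O => 0%C | S N => (psum N a + a N)%C end.

(** [Series] is total, so [Csum a] is the value of a sum only under this condition. *)
Definition summable (a : nat -> C) : Prop :=
  ex_series (fun n => Re (a n)) /\ ex_series (fun n => Im (a n)).

Lemma summable_dominated (a : nat -> C) (A : nat -> R) :
  (forall n, Cmod (a n) <= A n) -> ex_series A ->
  summable a /\ Cmod (Csum a) <= 2 * Series A.
Proof.
  intros Ha HA.
  assert (E1 : ex_series (fun n => Rabs (Re (a n)))).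
  { apply (@ex_series_le R_AbsRing R_CompleteNormedModule _ A); [|exact HA]. intros n.
    unfold norm; simpl. unfold abs; simpl. rewrite Rabs_Rabsolu.
    eapply Rle_trans; [apply re_le_Cmod|apply Ha]. }
  assert (E2 : ex_series (fun n => Rabs (Im (a n)))).
  { apply (@ex_series_le R_AbsRing R_CompleteNormedModule _ A); [|exact HA]. intros n.
    unfold norm; simpl. unfold abs; simpl. rewrite Rabs_Rabsolu.
    eapply Rle_trans; [apply im_le_Cmod|apply Ha]. }
  split; [split; apply ex_series_Rabs; assumption|].
  eapply Rle_trans; [apply Cmod_le_re_im|]. unfold Csum; simpl Re; simpl Im.
  assert (Rabs (Series (fun n => Re (a n))) <= Series A).
  { eapply Rle_trans; [apply Series_Rabs, E1|]. apply Series_le; [|exact HA]. intros n.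
    split; [apply Rabs_pos|]. eapply Rle_trans; [apply re_le_Cmod|apply Ha]. }
  assert (Rabs (Series (fun n => Im (a n))) <= Series A).
  { eapply Rle_trans; [apply Series_Rabs, E2|]. apply Series_le; [|exact HA]. intros n.
    split; [apply Rabs_pos|]. eapply Rle_trans; [apply im_le_Cmod|apply Ha]. }
  simpl in *. lra.
Qed.

Lemma summable_tail (a : nat -> C) (N : nat) :
  summable a <-> summable (fun n => a (N + n)%nat).
Proof.
  unfold summable.
  rewrite (ex_series_incr_n (fun n => Re (a n)) N), (ex_series_incr_n (fun n => Im (a n)) N).
  reflexivity.
Qed.

Lemma Csum_tail (a : nat -> C) (N : nat) : summable a ->
  Csum a = (psum N a + Csum (fun n => a (N + n)%nat))%C.
Proof.
  intros Ha. induction N as [|N IH]; [simpl; rewrite Cplus_0_l; reflexivity|].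
  rewrite IH. simpl psum. rewrite <- Cplus_assoc. f_equal.
  apply (summable_tail a N) in Ha. destruct Ha as [H1 H2].
  unfold Csum. rewrite (Series_incr_1 _ H1), (Series_incr_1 _ H2). rewrite Nat.add_0_r.
  apply injective_projections; simpl; f_equal; apply Series_ext; intros n;
    rewrite Nat.add_succ_r; reflexivity.
Qed.

Lemma Series_tail_small (A : nat -> R) (eps : R) : ex_series A -> 0 < eps ->
  exists N, Rabs (Series (fun n => A (N + n)%nat)) < eps.
Proof.
  intros HA He. pose proof (Series_correct _ HA) as Hs.
  assert (Hl : is_lim_seq (sum_n A) (Series A)) by exact Hs.
  apply is_lim_seq_spec in Hl. destruct (Hl (mkposreal eps He)) as [N HN]. simpl in HN.
  exists (S N). specialize (HN N (Nat.le_refl N)).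
  rewrite (Series_incr_n A (S N)) in HN; [|lia|exact HA]. simpl pred in HN.
  rewrite sum_n_Reals in HN.
  replace (sum_f_R0 A N - (sum_f_R0 A N + Series (fun k => A (S N + k)%nat)))
    with (- Series (fun k => A (S N + k)%nat)) in HN by ring.
  rewrite Rabs_Ropp in HN. exact HN.
Qed.

Lemma cdiff_psum (N : nat) (a : nat -> C -> C) (v : C) :
  (forall n, cdiff (a n) v) -> cdiff (fun v => psum N (fun n => a n v)) v.
Proof.
  intros H. induction N as [|N IH]; [exact (cdiff_const 0 v)|].
  apply (cdiff_plus (fun v => psum N (fun n => a n v))); [exact IH|apply H].
Qed.

(* Weierstrass: the Cauchy formula passes to the uniform limit. *)
Lemma cdiff_Csum_dominated (a : nat -> C -> C) (A : nat -> R) (v0 : C) (r : R) : 0 < r ->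
  ex_series A ->
  (forall n v, Cmod (v - v0) < r -> cdiff (a n) v /\ Cmod (a n v) <= A n) ->
  holo_at (fun v => Csum (fun n => a n v)) v0.
Proof.
  intros Hr HA Ha. set (S := fun v => Csum (fun n => a n v)).
  set (d := r / 4). assert (Hd : 0 < d) by (unfold d; lra).
  assert (Hin : forall w, Cmod (w - v0) <= 2 * d -> Cmod (w - v0) < r) by (unfold d; intros; lra).
  assert (HS : forall v, Cmod (v - v0) < r -> summable (fun n => a n v) /\ Cmod (S v) <= 2 * Series A).
  { intros v Hv. apply summable_dominated; [|exact HA]. intro n. apply Ha, Hv. }
  assert (Hunif : forall eps, 0 < eps -> exists N, forall v, Cmod (v - v0) < r ->
    Cmod (S v - psum N (fun n => a n v)) < eps).
  { intros eps He. destruct (Series_tail_small A (eps / 2) HA ltac:(lra)) as [N HN].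
    exists N. intros v Hv. unfold S. rewrite (Csum_tail _ N) by apply (HS v Hv).
    replace (psum N (fun n => a n v) + Csum (fun n => a (N + n)%nat v) - psum N (fun n => a n v))%C
      with (Csum (fun n => a (N + n)%nat v)) by ring.
    apply Rle_lt_trans with (2 * Series (fun n => A (N + n)%nat)).
    - apply (summable_dominated (fun n => a (N + n)%nat v)); [intro; apply Ha, Hv|].
      apply (ex_series_incr_n A N), HA.
    - pose proof (RRle_abs (Series (fun n => A (N + n)%nat))). lra. }
  assert (Hcd : forall N v, Cmod (v - v0) < r -> cdiff (fun v => psum N (fun n => a n v)) v).
  { intros N v Hv. apply cdiff_psum. intro n. apply Ha, Hv. }
  assert (Hcont : forall v, Cmod (v - v0) < r -> ccont S v).
  { intros v Hv eps He. destruct (Hunif (eps / 3) ltac:(lra)) as [N HN].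
    destruct (cdiff_ccont _ _ (Hcd N v Hv) (eps / 3) ltac:(lra)) as [e [He' Hc]].
    exists (Rmin e (r - Cmod (v - v0))). split; [apply Rmin_pos; lra|]. intros w Hw.
    pose proof (Rmin_l e (r - Cmod (v - v0))). pose proof (Rmin_r e (r - Cmod (v - v0))).
    specialize (Hc w ltac:(lra)). pose proof (Cmod_sub_triangle w v v0).
    pose proof (HN v Hv) as N1. pose proof (HN w ltac:(lra)) as N2.
    set (p := fun v => psum N (fun n => a n v)) in *.
    change (psum N (fun n => a n v)) with (p v) in *. change (psum N (fun n => a n w)) with (p w) in *.
    replace (S w - S v)%C with ((S w - p w) + ((p w - p v) + - (S v - p v)))%C by ring.
    eapply Rle_lt_trans; [apply Cmod_triangle|].
    eapply Rle_lt_trans; [apply Rplus_le_compat_l, Cmod_triangle|]. rewrite Cmod_opp. lra. }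
  assert (Hedge : edge_cont Ci S (Re v0 - d) (Re v0 + d) (Im v0 - d) (Im v0 + d)).
  { intros x y [Hx [Hy _]]. apply Hcont, Hin, (square_dist v0 d x y Hd Hx Hy). }
  assert (HA0 : 0 <= 2 * Series A).
  { eapply Rle_trans; [apply Cmod_ge_0|apply (HS v0)]. rewrite Cmod_self; lra. }
  apply holo_at_cdiff. exists (d / 2). split; [lra|].
  destruct (cdiff_C_derive_of_cauchy S v0 d (2 * Series A)) as [E HE];
    [exact Hd|exact HA0|exact Hedge| | |intros v Hv; apply (HE v Hv)].
  - intros w Hw. apply HS, Hin. lra.
  - intros v Hv. apply Ceq_minus. apply NNPP. intros Hne. apply Cmod_gt_0 in Hne.
    set (m := Cmod _) in Hne. pose proof (Cmod_ge_0 (W0 Ci)) as HW.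
    (* [K - 1] is the factor by which the sup distance between [S] and [p] enters the defect [m] of
       Cauchy's formula, so a distance below [m / (2 K)] forces [m < m / 2]. *)
    set (K := 16 * / (d / 2) * d + Cmod (W0 Ci) + 1).
    assert (Hid : 0 < / (d / 2)) by (apply Rinv_0_lt_compat; lra).
    assert (HK : 0 < K) by (unfold K; nra).
    destruct (Hunif (m / (2 * K))) as [N HN]; [apply Rdiv_lt_0_compat; lra|].
    set (p := fun v => psum N (fun n => a n v)) in *.
    assert (Hp : cauchy_int p v0 d v = (W0 Ci * p v)%C).
    { apply cauchy_formula; [exact Hd| |exact Hv]. intros w Hw. apply Hcd, Hin, Hw. }
    assert (Hfar : forall w, d <= Cmod (w - v0) -> d / 2 <= Cmod (w - v)).
    { intros w Hw. pose proof (Cmod_sub_triangle w v v0). lra. }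
    assert (Hinv : forall x y, on_edge (Re v0 - d) (Re v0 + d) (Im v0 - d) (Im v0 + d) x y ->
      ccont (fun w => / (w - v))%C (pt Ci x y)).
    { intros x y Hxy. pose proof Hxy as [Hx [Hy _]]. apply cdiff_ccont. eexists; apply cderiv_inv;
        [|apply cderiv_plus; [apply cderiv_id|apply cderiv_const]].
      apply Cmod_gt_0. eapply Rlt_le_trans; [|apply Hfar, (square_dist v0 d x y Hd Hx Hy), Hxy]. lra. }
    assert (Hpe : edge_cont Ci p (Re v0 - d) (Re v0 + d) (Im v0 - d) (Im v0 + d)).
    { intros x y [Hx [Hy _]]. apply cdiff_ccont, Hcd, Hin, (square_dist v0 d x y Hd Hx Hy). }
    set (g := fun w => ((S w + - (1) * p w) * / (w - v))%C).
    assert (Hg : edge_cont Ci g (Re v0 - d) (Re v0 + d) (Im v0 - d) (Im v0 + d)).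
    { intros x y Hxy. apply ccont_mult; [|apply Hinv, Hxy].
      apply ccont_plus; [apply Hedge, Hxy|]. apply ccont_mult; [apply ccont_const|apply Hpe, Hxy]. }
    assert (Esum : cauchy_int S v0 d v = (square g v0 d + cauchy_int p v0 d v)%C).
    { unfold cauchy_int, square.
      rewrite <- box_plus; [|lra|lra|exact Hg|].
      - apply box_ext; [lra|lra|]. intros; unfold g; ring.
      - intros x y Hxy. apply ccont_mult; [apply Hpe, Hxy|apply Hinv, Hxy]. }
    assert (Hb : Cmod (square g v0 d) <= 16 * (m / (2 * K) * / (d / 2)) * d).
    { apply square_bound; [exact Hd|exact Hg|]. intros w Hw. unfold g.
      rewrite Cmod_mult. apply Rmult_le_bound; split; try apply Cmod_ge_0.
      - replace (S w + - (1) * p w)%C with (S w - p w)%C by ring.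
        apply Rlt_le, HN, Hin. lra.
      - apply Cmod_inv_le; [lra|apply Hfar; lra]. }
    assert (Hv2 : Cmod (p v - S v) <= m / (2 * K)).
    { rewrite Cmod_sub_sym. apply Rlt_le, HN. unfold d in *; lra. }
    assert (Hm : m <= 16 * (m / (2 * K) * / (d / 2)) * d + Cmod (W0 Ci) * (m / (2 * K))).
    { unfold m at 1. rewrite Esum, Hp.
      replace (square g v0 d + W0 Ci * p v - W0 Ci * S v)%C
        with (square g v0 d + W0 Ci * (p v - S v))%C by ring.
      eapply Rle_trans; [apply Cmod_triangle|]. rewrite Cmod_mult.
      apply Rplus_le_compat; [exact Hb|]. apply Rmult_le_compat_l; lra. }
    assert (Em : 16 * (m / (2 * K) * / (d / 2)) * d + Cmod (W0 Ci) * (m / (2 * K)) = m / (2 * K) * (K - 1))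
      by (unfold K; ring).
    assert (m / (2 * K) * K = m / 2) by (field; lra).
    assert (0 < m / (2 * K)) by (apply Rdiv_lt_0_compat; lra). lra.
Qed.

(** * The Appell--Lerch sum *)

Lemma ee_plus (a b : C) : ee (a + b) = (ee a * ee b)%C.
Proof. unfold ee. rewrite <- cexp_plus. f_equal. ring. Qed.

Lemma ee_0 : ee 0 = 1%C.
Proof. unfold ee. rewrite Cmult_0_r. apply cexp_0. Qed.

Lemma ee_opp_r (x : C) : (ee x * ee (- x))%C = 1%C.
Proof. rewrite <- ee_plus. replace (x + - x)%C with (RtoC 0) by ring. apply ee_0. Qed.

Lemma Cmod_ee (x : C) : Cmod (ee x) = exp (- (2 * PI * Im x)).
Proof. unfold ee. rewrite Cmod_cexp. f_equal. destruct x as [a b]. simpl. ring. Qed.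

Lemma ee_neq_0 (x : C) : ee x <> 0%C.
Proof. apply Cmod_gt_0. rewrite Cmod_ee. apply exp_pos. Qed.

Lemma ee_opp (x : C) : ee (- x) = (/ ee x)%C.
Proof.
  pose proof (ee_neq_0 x). rewrite <- (Cmult_1_l (/ ee x)), <- (ee_opp_r x). field. assumption.
Qed.

Lemma ee_half : ee (1 / 2) = (-1)%C.
Proof.
  unfold ee. replace (2 * PI * Ci * (1 / 2))%C with (RtoC PI * Ci)%C by field.
  unfold cexp. simpl. replace (PI * 0 - 0 * 1) with 0 by ring.
  replace (PI * 1 + 0 * 0) with PI by ring. rewrite exp_0, cos_PI, sin_PI.
  unfold RtoC; f_equal; ring.
Qed.

Lemma IZC_plus (a b : Z) : IZC (a + b) = (IZC a + IZC b)%C.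
Proof. unfold IZC. rewrite plus_IZR, RtoC_plus. reflexivity. Qed.

Lemma IZC_mult (a b : Z) : IZC (a * b) = (IZC a * IZC b)%C.
Proof. unfold IZC. rewrite mult_IZR, RtoC_mult. reflexivity. Qed.

Lemma IZC_opp (a : Z) : IZC (- a) = (- IZC a)%C.
Proof. unfold IZC. rewrite opp_IZR, RtoC_opp. reflexivity. Qed.

Lemma IZC_of_nat (n : nat) : IZC (Z.of_nat n) = RtoC (INR n).
Proof. unfold IZC. rewrite <- INR_IZR_INZ. reflexivity. Qed.

Lemma msign_sq (a : Z) : (msign a * msign a)%C = 1%C.
Proof. unfold msign. destruct (Z.even a); ring. Qed.

Lemma msign_plus (a b : Z) : msign (a + b) = (msign a * msign b)%C.
Proof. unfold msign. rewrite Z.even_add. destruct (Z.even a), (Z.even b); simpl; ring. Qed.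

Lemma msign_opp (a : Z) : msign (- a) = msign a.
Proof. unfold msign. rewrite Z.even_opp. reflexivity. Qed.

Lemma Cmod_msign (a : Z) : Cmod (msign a) = 1.
Proof. unfold msign. destruct (Z.even a); rewrite Cmod_R; [apply Rabs_R1|]. unfold Rabs; destruct Rcase_abs; lra. Qed.

Lemma ee_half_int (j : Z) : ee (IZC j / 2) = msign j.
Proof.
  revert j. apply Z.peano_ind.
  - unfold IZC, msign; simpl. replace (0 / 2)%C with (RtoC 0) by (unfold Cdiv; ring). apply ee_0.
  - intros j IH. unfold Z.succ. rewrite IZC_plus, msign_plus, <- IH.
    change (msign 1) with (RtoC (-1)). rewrite <- ee_half, <- ee_plus.
    apply (f_equal ee). unfold IZC. field.
  - intros j IH. unfold Z.pred. rewrite IZC_plus, msign_plus, <- IH.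
    replace (msign (-1)) with (ee (- (1 / 2)))
      by (rewrite ee_opp, ee_half; change (msign (-1)) with (RtoC (-1)); field; intro E;
          apply (f_equal Re) in E; simpl in E; lra).
    rewrite <- ee_plus. apply (f_equal ee). unfold IZC. field.
Qed.

Lemma ee_IZC (n : Z) : ee (IZC n) = 1%C.
Proof.
  replace (IZC n) with (IZC (2 * n) / 2)%C by (rewrite IZC_mult; unfold IZC; field).
  rewrite ee_half_int. unfold msign. rewrite Z.even_mul. reflexivity.
Qed.

(** The modulus gives [Im x = 0]. For the fractional part [s] of [Re x], [cos (2 pi s) = 1] gives
    [sin (pi s) = 0], which excludes [0 < s < 1]. *)
Lemma ee_eq_1 (x : C) : ee x = 1%C -> exists n, x = IZC n.
Proof.
  intros E. pose proof PI_RGT_0 as HPI.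
  assert (Hi : Im x = 0).
  { pose proof (Cmod_ee x) as H. rewrite E, Cmod_1, <- exp_0 in H. apply exp_inv in H. nra. }
  set (n := Int_part (Re x)). exists n.
  assert (Hs : Re x - IZR n = 0).
  { destruct (base_Int_part (Re x)) as [H1 H2]. fold n in H1, H2.
    assert (Ec : ee (RtoC (Re x - IZR n)) = 1%C).
    { rewrite RtoC_minus. unfold Cminus. change (RtoC (IZR n)) with (IZC n).
      rewrite <- IZC_opp, ee_plus, ee_IZC, Cmult_1_r.
      rewrite <- E. f_equal. destruct x; simpl in *; unfold RtoC; subst; reflexivity. }
    assert (Hc : cos (2 * PI * (Re x - IZR n)) = 1).
    { apply (f_equal Re) in Ec. unfold ee, cexp in Ec. simpl in Ec.
      match type of Ec with exp ?a * cos ?b = 1 =>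
        replace a with 0 in Ec by ring; replace b with (2 * PI * (Re x - IZR n)) in Ec by (simpl; ring)
      end. rewrite exp_0 in Ec. lra. }
    set (s := Re x - IZR n) in *.
    assert (Hsin : sin (PI * s) = 0).
    { replace (2 * PI * s) with (2 * (PI * s)) in Hc by ring. rewrite cos_2a_sin in Hc. nra. }
    apply NNPP. intros Hn.
    assert (Hs1 : 0 < s < 1) by (unfold s in *; lra).
    assert (0 < sin (PI * s)); [|lra]. apply sin_gt_0; nra. }
  destruct x as [a b]; simpl in *. unfold IZC, RtoC. f_equal; lra.
Qed.

Definition in_lattice (tau w : C) : Prop := exists n m : Z, w = (IZC n * tau + IZC m)%C.

Definition al_term (k : nat) (eps : Z) (tau z v : C) (n : Z) : C :=
  (msign (n * eps)%Z * ee (- 2 * (RtoC (INR k) / 2) * IZC n * v) *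
   ee (RtoC (INR k) / 2 * IZC n * (IZC n + 1) * tau) /
   (1 - ee (IZC n * tau) * ee (z - v)))%C.

Lemma AL_al_term (k : nat) (eps : Z) (tau z v : C) :
  AL k eps tau z v = (ee (RtoC (INR k) / 2 * (z - v)) * Zsum (al_term k eps tau z v))%C.
Proof. reflexivity. Qed.

Lemma al_denominator_neq_0 (tau z v : C) (n : Z) :
  ~ in_lattice tau (v - z) -> (1 - ee (IZC n * tau) * ee (z - v) <> 0)%C.
Proof.
  intros H E. apply H. rewrite <- ee_plus in E.
  destruct (ee_eq_1 (IZC n * tau + (z - v))) as [m Hm].
  { symmetry. apply Ceq_minus, E. }
  exists n, (- m)%Z. rewrite IZC_opp, <- Hm. ring.
Qed.

Lemma cdiff_al_term (k : nat) (eps : Z) (tau z v : C) (n : Z) :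
  (1 - ee (IZC n * tau) * ee (z - v) <> 0)%C -> cdiff (fun v => al_term k eps tau z v n) v.
Proof.
  intros H. unfold al_term. apply cdiff_div; [exact H| |].
  - apply cdiff_mult; [|apply cdiff_const]. apply cdiff_mult; [apply cdiff_const|].
    apply cdiff_ee, cdiff_mult; [apply cdiff_const|apply cdiff_id].
  - apply cdiff_minus; [apply cdiff_const|]. apply cdiff_mult; [apply cdiff_const|].
    apply cdiff_ee, cdiff_minus; [apply cdiff_const|apply cdiff_id].
Qed.

Lemma holo_at_al_term (k : nat) (eps : Z) (tau z v : C) (n : Z) :
  (1 - ee (IZC n * tau) * ee (z - v) <> 0)%C -> holo_at (fun v => al_term k eps tau z v n) v.
Proof.
  intros H. set (g := fun v => (1 - ee (IZC n * tau) * ee (z - v))%C).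
  assert (Hg : cdiff g v).
  { apply cdiff_minus; [apply cdiff_const|]. apply cdiff_mult; [apply cdiff_const|].
    apply cdiff_ee, cdiff_minus; [apply cdiff_const|apply cdiff_id]. }
  change (g v <> 0%C) in H. apply Cmod_gt_0 in H.
  destruct (cdiff_ccont g v Hg _ H) as [d [Hd H']].
  apply holo_at_cdiff. exists d. split; [exact Hd|]. intros w Hw. apply cdiff_al_term.
  intros E. change (g w = 0%C) in E. specialize (H' w Hw). rewrite E in H'.
  rewrite Cmod_sub_sym in H'. replace (g v - 0)%C with (g v) in H' by ring. lra.
Qed.

Lemma exp_m1_le_half : exp (-1) <= 1 / 2.
Proof.
  replace (exp (-1)) with (/ exp 1) by (rewrite <- exp_Ropp; f_equal; lra). pose proof (exp_ineq1 1 ltac:(lra)).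
  replace (1 / 2) with (/ 2) by field. apply Rinv_le_contravar; lra.
Qed.

Lemma exp_le (a b : R) : a <= b -> exp a <= exp b.
Proof. intros [H| ->]; [left; apply exp_increasing, H|lra]. Qed.

Lemma Cmod_al_numerator (k : nat) (eps : Z) (tau v : C) (n : Z) :
  Cmod (msign (n * eps)%Z * ee (- 2 * (RtoC (INR k) / 2) * IZC n * v) *
    ee (RtoC (INR k) / 2 * IZC n * (IZC n + 1) * tau)) =
  exp (INR k * (2 * PI * IZR n * Im v - PI * (IZR n * (IZR n + 1)) * Im tau)).
Proof.
  rewrite !Cmod_mult, Cmod_msign, !Cmod_ee, Rmult_1_l, <- exp_plus. f_equal.
  replace (- 2 * (RtoC (INR k) / 2) * IZC n * v)%C with (RtoC (- (INR k * IZR n)) * v)%C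
    by (unfold IZC; rewrite RtoC_opp, RtoC_mult; field).
  replace (RtoC (INR k) / 2 * IZC n * (IZC n + 1) * tau)%C
    with (RtoC (INR k * / 2 * (IZR n * (IZR n + 1))) * tau)%C.
  2:{ unfold IZC. rewrite !RtoC_mult, RtoC_plus, RtoC_inv by lra. field. }
  rewrite !im_scal_l. field.
Qed.

(** On a horizontal strip the numerator decays like a Gaussian in [j], while [q^j e(z - v)] has
    modulus at most [1/e] for large positive [j] and at least [e] for large negative [j], so that
    the denominator is at least 1/2. The geometric bound is crude but uniform, as the holomorphy of
    the sum requires. *)
Lemma al_term_bound (k : nat) (eps : Z) (tau z : C) (Y : R) : 0 < Im tau -> (1 <= k)%nat ->
  exists n0, forall n v, (n0 <= n)%nat -> Rabs (Im v) <= Y -> Rabs (Im (z - v)) <= Y ->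
    forall j, j = Z.of_nat n \/ j = (- Z.of_nat (S n))%Z ->
    (1 - ee (IZC j * tau) * ee (z - v) <> 0)%C /\
    Cmod (al_term k eps tau z v j) <= 2 * exp (-1) ^ n.
Proof.
  intros Ht Hk. pose proof PI_RGT_0 as HPI.
  assert (Hk1 : 1 <= INR k) by (apply (le_INR 1), Hk).
  assert (HPt : 0 < PI * Im tau) by (apply Rmult_lt_0_compat; lra).
  (* [n0] is chosen with [2 pi Y + 1 <= pi Im(tau) n0]: the quadratic exponent then outweighs the
     linear one with a margin of 1 per index. *)
  destruct (archimed_cor1 (PI * Im tau / (2 * PI * Rabs Y + 1))) as [n0 [Hn0 Hn0p]].
  { apply Rdiv_lt_0_compat; [lra|]. pose proof (Rabs_pos Y). nra. }
  exists n0. intros n v Hn HY1 HY2 j Hj.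
  assert (HYp : 0 <= Y) by (pose proof (Rabs_pos (Im v)); lra).
  rewrite (Rabs_right Y) in Hn0 by lra.
  assert (HPY : 0 <= 2 * PI * Y) by (apply Rmult_le_pos; lra).
  assert (HX : 2 * PI * Y + 1 <= PI * Im tau * INR n).
  { assert (0 < INR n0) by (apply lt_0_INR, Hn0p). apply le_INR in Hn.
    apply (Rmult_lt_compat_r (INR n0 * (2 * PI * Y + 1))) in Hn0; [|nra].
    replace (/ INR n0 * (INR n0 * (2 * PI * Y + 1))) with (2 * PI * Y + 1) in Hn0 by (field; lra).
    replace (PI * Im tau / (2 * PI * Y + 1) * (INR n0 * (2 * PI * Y + 1)))
      with (PI * Im tau * INR n0) in Hn0 by (field; lra).
    assert (PI * Im tau * INR n0 <= PI * Im tau * INR n) by (apply Rmult_le_compat_l; lra). lra. }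
  assert (Habs : forall x, Rabs x <= Y -> - (2 * PI * Y) <= 2 * PI * x <= 2 * PI * Y).
  { intros x Hx. apply Rabs_le_between in Hx. split; nra. }
  pose proof (Habs _ HY1) as B1. pose proof (Habs _ HY2) as B2.
  assert (Hpos : 0 <= INR n) by apply pos_INR.
  assert (Hexpn : exp (-1) ^ n = exp (- INR n)).
  { clear. induction n as [|n IH]; [simpl; rewrite Ropp_0, exp_0; reflexivity|].
    rewrite S_INR. simpl pow. rewrite IH, <- exp_plus. f_equal. ring. }
  assert (Hden : Cmod (ee (IZC j * tau) * ee (z - v)) =
    exp (- (2 * (PI * Im tau * IZR j)) - 2 * PI * Im (z - v))).
  { rewrite Cmod_mult, !Cmod_ee, <- exp_plus. f_equal.
    unfold IZC. rewrite im_scal_l. ring. }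
  pose proof exp_m1_le_half as Hh.
  assert (H12 : 1 / 2 <= Cmod (1 - ee (IZC j * tau) * ee (z - v))).
  { destruct Hj as [-> | ->].
    - rewrite <- INR_IZR_INZ in Hden.
      assert (Hs : exp (- (2 * (PI * Im tau * INR n)) - 2 * PI * Im (z - v)) <= exp (-1))
        by (apply exp_le; lra).
      pose proof (Cmod_le_add 1 (ee (IZC (Z.of_nat n) * tau) * ee (z - v))).
      rewrite Cmod_1 in H. lra.
    - rewrite opp_IZR, <- INR_IZR_INZ, S_INR in Hden.
      assert (Hs : exp 1 <= exp (- (2 * (PI * Im tau * - (INR n + 1))) - 2 * PI * Im (z - v)))
        by (apply exp_le; lra).
      pose proof (exp_ineq1 1 ltac:(lra)).
      pose proof (Cmod_le_add (ee (IZC (- Z.of_nat (S n)) * tau) * ee (z - v)) 1) as H1.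
      rewrite Cmod_1, Cmod_sub_sym in H1. lra. }
  destruct (Cmod_inv_le _ (1 / 2) ltac:(lra) H12) as [Hne Hinv]. split; [exact Hne|].
  unfold al_term. rewrite Cmod_div by exact Hne. rewrite Cmod_al_numerator.
  unfold Rdiv. rewrite <- Cmod_inv by exact Hne. rewrite Rmult_comm, Hexpn.
  apply Rmult_le_bound; [split; [apply Cmod_ge_0|lra]|]. split; [left; apply exp_pos|].
  apply exp_le.
  set (p := PI * Im tau) in *.
  destruct Hj as [-> | ->].
  - rewrite <- INR_IZR_INZ.
    replace (2 * PI * INR n * Im v - PI * (INR n * (INR n + 1)) * Im tau)
      with (- (INR n * (p * INR n + p - 2 * PI * Im v))) by (unfold p; ring).
    assert (INR n * 1 <= INR n * (p * INR n + p - 2 * PI * Im v)) by (apply Rmult_le_compat_l; lra).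
    nra.
  - rewrite opp_IZR, <- INR_IZR_INZ, S_INR.
    replace (2 * PI * - (INR n + 1) * Im v - PI * (- (INR n + 1) * (- (INR n + 1) + 1)) * Im tau)
      with (- ((INR n + 1) * (p * INR n + 2 * PI * Im v))) by (unfold p; ring).
    assert ((INR n + 1) * 1 <= (INR n + 1) * (p * INR n + 2 * PI * Im v))
      by (apply Rmult_le_compat_l; lra).
    nra.
Qed.

Lemma ex_series_geom_scal : ex_series (fun n => 2 * exp (-1) ^ n).
Proof.
  apply (@ex_series_scal R_AbsRing R_NormedModule 2 (fun n => exp (-1) ^ n)).
  apply ex_series_geom. pose proof exp_m1_le_half. pose proof (exp_pos (-1)).
  rewrite Rabs_right; lra.
Qed.

(** Only the tail matters, and its denominators stay away from 0. The result thus covers the poles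
    in [v] too, which makes the law for [v + tau] an identity at every [v]. *)
Lemma summable_al_term (k : nat) (eps : Z) (tau z v : C) : 0 < Im tau -> (1 <= k)%nat ->
  summable (fun n => al_term k eps tau z v (Z.of_nat n)) /\
  summable (fun n => al_term k eps tau z v (- Z.of_nat (S n))%Z).
Proof.
  intros Ht Hk.
  destruct (al_term_bound k eps tau z (Rabs (Im v) + Rabs (Im (z - v))) Ht Hk) as [n0 H].
  pose proof (Rabs_pos (Im v)). pose proof (Rabs_pos (Im (z - v))).
  assert (HA : ex_series (fun n => 2 * exp (-1) ^ (n0 + n)))
    by apply (ex_series_incr_n (fun n => 2 * exp (-1) ^ n) n0), ex_series_geom_scal.
  split; apply (summable_tail _ n0).
  - apply (summable_dominated _ _ (fun n => proj2 (H (n0 + n)%nat v ltac:(lia) ltac:(lra) ltac:(lra)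
      _ (or_introl eq_refl))) HA).
  - apply (summable_dominated _ _ (fun n => proj2 (H (n0 + n)%nat v ltac:(lia) ltac:(lra) ltac:(lra)
      _ (or_intror eq_refl))) HA).
Qed.

Lemma holo_at_plus (f g : C -> C) (u : C) :
  holo_at f u -> holo_at g u -> holo_at (fun w => f w + g w)%C u.
Proof.
  intros Hf Hg. apply holo_at_cdiff in Hf. apply holo_at_cdiff in Hg.
  destruct Hf as [r [Hr Hf]], Hg as [r' [Hr' Hg]]. apply holo_at_cdiff.
  exists (Rmin r r'). split; [apply Rmin_pos; lra|]. intros w Hw.
  pose proof (Rmin_l r r'). pose proof (Rmin_r r r'). apply cdiff_plus; [apply Hf|apply Hg]; lra.
Qed.

Lemma holo_at_mult (f g : C -> C) (u : C) :
  holo_at f u -> holo_at g u -> holo_at (fun w => f w * g w)%C u.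
Proof.
  intros Hf Hg. apply holo_at_cdiff in Hf. apply holo_at_cdiff in Hg.
  destruct Hf as [r [Hr Hf]], Hg as [r' [Hr' Hg]]. apply holo_at_cdiff.
  exists (Rmin r r'). split; [apply Rmin_pos; lra|]. intros w Hw.
  pose proof (Rmin_l r r'). pose proof (Rmin_r r r'). apply cdiff_mult; [apply Hf|apply Hg]; lra.
Qed.

Lemma holo_at_ext_loc (f g : C -> C) (u : C) (r : R) : 0 < r ->
  (forall w, Cmod (w - u) < r -> f w = g w) -> holo_at f u -> holo_at g u.
Proof.
  intros Hr Hfg Hf. apply holo_at_cdiff in Hf. destruct Hf as [r' [Hr' Hf]].
  apply holo_at_cdiff. exists (Rmin r r'). split; [apply Rmin_pos; lra|]. intros w Hw.
  pose proof (Rmin_l r r'). pose proof (Rmin_r r r').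
  apply (cdiff_ext_loc f g w (r - Cmod (w - u))); [lra| |apply Hf; lra].
  intros w' Hw'. apply Hfg. pose proof (Cmod_sub_triangle w' w u). lra.
Qed.

Lemma holo_at_entire (f : C -> C) (u : C) : (forall w, cdiff f w) -> holo_at f u.
Proof. intros H. apply holo_at_cdiff. exists 1. split; [lra|auto]. Qed.

(** The domination starts at [n0]; the head is split off as a finite sum of holomorphic terms. *)
Lemma holo_at_Csum (a : nat -> C -> C) (A : nat -> R) (v0 : C) (n0 : nat) :
  (forall n, holo_at (a n) v0) -> ex_series A ->
  (exists r, 0 < r /\ forall n v, (n0 <= n)%nat -> Cmod (v - v0) < r ->
     cdiff (a n) v /\ Cmod (a n v) <= A n) ->
  holo_at (fun v => Csum (fun n => a n v)) v0.
Proof.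
  intros Ha HA [r [Hr H]].
  assert (HA' : ex_series (fun n => A (n0 + n)%nat)) by apply (ex_series_incr_n A n0), HA.
  apply (holo_at_ext_loc (fun v => psum n0 (fun n => a n v) + Csum (fun n => a (n0 + n)%nat v))%C _ v0 r Hr).
  - intros w Hw. symmetry. apply Csum_tail. apply (summable_tail _ n0).
    apply (summable_dominated _ (fun n => A (n0 + n)%nat)); [|exact HA'].
    intros n. apply H; [lia|exact Hw].
  - apply holo_at_plus.
    + clear - Ha. induction n0 as [|n IH]; [apply holo_at_entire; intro; exact (cdiff_const 0 w)|].
      apply (holo_at_plus (fun v => psum n (fun n => a n v))); [exact IH|apply Ha].
    + apply (cdiff_Csum_dominated (fun n => a (n0 + n)%nat) (fun n => A (n0 + n)%nat) v0 r Hr HA').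
      intros n v Hv. apply H; [lia|exact Hv].
Qed.

(** [i = 0] gives the holomorphy of [AL] off the lattice; [i = 1] leaves out the polar term for the
    expansion at [v = z]. *)
Lemma holo_at_al_sums (k : nat) (eps : Z) (tau z v : C) (i : nat) : 0 < Im tau -> (1 <= k)%nat ->
  (forall n, (i <= n)%nat -> (1 - ee (IZC (Z.of_nat n) * tau) * ee (z - v) <> 0)%C) ->
  (forall n, (1 - ee (IZC (- Z.of_nat (S n)) * tau) * ee (z - v) <> 0)%C) ->
  holo_at (fun v => Csum (fun n => al_term k eps tau z v (Z.of_nat (i + n)))) v /\
  holo_at (fun v => Csum (fun n => al_term k eps tau z v (- Z.of_nat (S n)))) v.
Proof.
  intros Ht Hk H1 H2.
  destruct (al_term_bound k eps tau z (Rabs (Im v) + Rabs (Im (z - v)) + 1) Ht Hk) as [n0 H].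
  pose proof (Rabs_pos (Im v)). pose proof (Rabs_pos (Im (z - v))).
  assert (Hb : forall w, Cmod (w - v) < 1 -> Rabs (Im w) <= Rabs (Im v) + Rabs (Im (z - v)) + 1 /\
    Rabs (Im (z - w)) <= Rabs (Im v) + Rabs (Im (z - v)) + 1).
  { intros w Hw. pose proof (im_le_Cmod (w - v)) as Hi.
    replace (Im w) with (Im v + Im (w - v)) by (unfold Cminus; rewrite im_plus, im_opp; ring).
    replace (Im (z - w)) with (Im (z - v) + - Im (w - v))
      by (unfold Cminus; rewrite !im_plus, !im_opp; ring).
    pose proof (Rabs_triang (Im v) (Im (w - v))).
    pose proof (Rabs_triang (Im (z - v)) (- Im (w - v))). rewrite Rabs_Ropp in H5. lra. }
  split.
  - apply (holo_at_Csum (fun n v => al_term k eps tau z v (Z.of_nat (i + n)))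
      (fun n => 2 * exp (-1) ^ (i + n)) v n0).
    + intros n. apply holo_at_al_term, H1. lia.
    + apply (ex_series_incr_n (fun n => 2 * exp (-1) ^ n) i), ex_series_geom_scal.
    + exists 1. split; [lra|]. intros n w Hn Hw. destruct (Hb w Hw) as [B1 B2].
      destruct (H (i + n)%nat w ltac:(lia) B1 B2 _ (or_introl eq_refl)) as [N B].
      split; [apply cdiff_al_term, N|exact B].
  - apply (holo_at_Csum (fun n v => al_term k eps tau z v (- Z.of_nat (S n)))
      (fun n => 2 * exp (-1) ^ n) v n0).
    + intros n. apply holo_at_al_term, H2.
    + apply ex_series_geom_scal.
    + exists 1. split; [lra|]. intros n w Hn Hw. destruct (Hb w Hw) as [B1 B2].
      destruct (H n w Hn B1 B2 _ (or_intror eq_refl)) as [N B].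
      split; [apply cdiff_al_term, N|exact B].
Qed.

Lemma cdiff_al_factor (k : nat) (z v : C) : cdiff (fun v => ee (RtoC (INR k) / 2 * (z - v)))%C v.
Proof.
  apply cdiff_ee, cdiff_mult; [apply cdiff_const|].
  apply cdiff_minus; [apply cdiff_const|apply cdiff_id].
Qed.

Lemma holo_at_AL (k : nat) (eps : Z) (tau z v : C) : 0 < Im tau -> (1 <= k)%nat ->
  ~ in_lattice tau (v - z) -> holo_at (fun v => AL k eps tau z v) v.
Proof.
  intros Ht Hk Hv.
  destruct (holo_at_al_sums k eps tau z v 0 Ht Hk) as [A B];
    try (intros; apply al_denominator_neq_0, Hv).
  apply (holo_at_mult (fun v => ee (RtoC (INR k) / 2 * (z - v)))%C).
  - apply holo_at_entire. intro; apply cdiff_al_factor.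
  - apply holo_at_plus; assumption.
Qed.

Lemma cderiv_ee_sub (z v : C) : cderiv (fun v => ee (z - v)) v (- twopii * ee (z - v))%C.
Proof.
  eapply cderiv_ext; [intro; reflexivity| |apply (cderiv_comp cexp (fun v => twopii * (z - v))%C);
    [apply cderiv_scal, (cderiv_plus (fun _ => z) (fun w => - (w))%C);
      [apply cderiv_const|apply (cderiv_ext (fun w => - (1) * w)%C _ _ (- (1) * 1)%C _);
        [intro; ring|reflexivity|apply cderiv_scal, cderiv_id]]
    |apply cderiv_cexp]].
  unfold ee. change (2 * PI * Ci)%C with twopii. ring.
Qed.

(* The term [n = 0] is [1 / (1 - ee (z - v))], which has the simple pole. *)
Lemma AL_pole (k : nat) (eps : Z) (tau z : C) : 0 < Im tau -> (1 <= k)%nat ->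
  exists r K, 0 < r /\ forall v, 0 < Cmod (v - z) < r ->
    Cmod (AL k eps tau z v - / (twopii * (v - z))) <= K.
Proof.
  intros Ht Hk. pose proof twopii_neq_0 as Hp.
  set (G := fun v => ee (RtoC (INR k) / 2 * (z - v))%C).
  set (E := fun v => (1 - ee (z - v))%C).
  assert (Hz0 : (z - z = 0)%C) by ring.
  assert (HGz : G z = 1%C) by (unfold G; rewrite Hz0, Cmult_0_r; apply ee_0).
  assert (HEz : E z = 0%C) by (unfold E; rewrite Hz0, ee_0; ring).
  assert (HdE : cderiv E z twopii).
  { eapply cderiv_ext; [| |apply (cderiv_plus (fun _ => 1%C) (fun v => - (1) * ee (z - v))%C);
      [apply cderiv_const|apply cderiv_scal, cderiv_ee_sub]].
    - intro; unfold E; ring.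
    - rewrite Hz0, ee_0. ring. }
  assert (HGd : forall v, cdiff G v) by (intro; apply cdiff_al_factor).
  assert (HEd : forall v, cdiff E v).
  { intro. apply cdiff_minus; [apply cdiff_const|]. eexists; apply cderiv_ee_sub. }
  (* [G / E - 1 / (2 pi i (v - z))] has the numerator [N], which vanishes to second order at [z],
     over [2 pi i (v - z) E], whose zero there is exactly double; so the quotient is bounded. *)
  set (N := fun v => (twopii * (v - z) * G v + - (1) * E v)%C).
  assert (HNz : N z = 0%C) by (unfold N; rewrite Hz0, HEz; ring).
  assert (HdN : cderiv N z 0).
  { destruct (HGd z) as [g Hg].
    eapply cderiv_ext; [intro; reflexivity| |apply cderiv_plus; [apply cderiv_mult;
      [apply cderiv_scal, cderiv_plus; [apply cderiv_id|apply cderiv_const]|exact Hg]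
      |apply cderiv_scal, HdE]].
    cbv beta. rewrite HGz. ring. }
  assert (HNh : holo_at N z).
  { apply holo_at_entire. intro w. apply cdiff_plus.
    - apply cdiff_mult; [|apply HGd]. apply cdiff_mult; [apply cdiff_const|].
      apply cdiff_minus; [apply cdiff_id|apply cdiff_const].
    - apply cdiff_mult; [apply cdiff_const|apply HEd]. }
  destruct (holo_at_quadratic N z HNh) as [r1 [B [Hr1 HB]]].
  rewrite (cderiv_unique _ _ _ HdN) in HB.
  assert (Hpm : 0 < Cmod twopii) by (apply Cmod_gt_0, Hp). set (p := Cmod twopii) in *.
  (* [E] has slope [2 pi i] at [z]; half of it remains as a lower bound,
     [|E v| >= (p/2) |v - z|]. *)
  destruct (HdE (p / 2)) as [r2 [Hr2 HE]]; [lra|].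
  destruct (holo_at_al_sums k eps tau z z 1 Ht Hk) as [S1 S2].
  { intros n Hn Ez. rewrite Hz0, ee_0, Cmult_1_r in Ez.
    assert (Em : Cmod (ee (IZC (Z.of_nat n) * tau)) = 1).
    { rewrite <- Cmod_1. f_equal. symmetry. apply Ceq_minus, Ez. }
    rewrite Cmod_ee, <- exp_0 in Em. apply exp_inv in Em. unfold IZC in Em.
    rewrite im_scal_l, <- INR_IZR_INZ in Em. apply (le_INR 1) in Hn. simpl in Hn.
    pose proof PI_RGT_0. assert (0 < PI * (INR n * Im tau)); [|lra].
    apply Rmult_lt_0_compat; [lra|apply Rmult_lt_0_compat; lra]. }
  { intros n Ez. rewrite Hz0, ee_0, Cmult_1_r in Ez.
    assert (Em : Cmod (ee (IZC (- Z.of_nat (S n)) * tau)) = 1).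
    { rewrite <- Cmod_1. f_equal. symmetry. apply Ceq_minus, Ez. }
    rewrite Cmod_ee, <- exp_0 in Em. apply exp_inv in Em. unfold IZC in Em.
    rewrite im_scal_l, opp_IZR, <- INR_IZR_INZ, S_INR in Em. pose proof (pos_INR n).
    pose proof PI_RGT_0. assert (0 < PI * ((INR n + 1) * Im tau)); [|lra].
    apply Rmult_lt_0_compat; [lra|apply Rmult_lt_0_compat; lra]. }
  set (rest := fun v => (G v * (Csum (fun n => al_term k eps tau z v (Z.of_nat (1 + n))) +
    Csum (fun n => al_term k eps tau z v (- Z.of_nat (S n)))))%C).
  assert (HR : holo_at rest z).
  { apply holo_at_mult; [apply holo_at_entire, HGd|apply holo_at_plus; assumption]. }
  destruct (cdiff_ccont rest z (holo_at_cdiff_self _ _ HR) 1 Rlt_0_1) as [r3 [Hr3 HR3]].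
  exists (Rmin r1 (Rmin r2 r3)), (Rabs B * / (p * (p / 2)) + (Cmod (rest z) + 1)).
  split; [repeat apply Rmin_pos; lra|]. intros v Hv.
  pose proof (Rmin_l r1 (Rmin r2 r3)). pose proof (Rmin_r r1 (Rmin r2 r3)).
  pose proof (Rmin_l r2 r3). pose proof (Rmin_r r2 r3).
  destruct (HB v ltac:(lra)) as [_ HB1]. rewrite HNz in HB1.
  replace (N v - 0 - 0 * (v - z))%C with (N v) in HB1 by ring.
  specialize (HE v ltac:(lra)). rewrite HEz in HE.
  specialize (HR3 v ltac:(lra)).
  set (h := Cmod (v - z)) in *.
  assert (HEl : p / 2 * h <= Cmod (E v)).
  { pose proof (Cmod_le_add (twopii * (v - z)) (E v)) as Q. rewrite Cmod_mult in Q. fold p h in Q.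
    rewrite Cmod_sub_sym in Q. replace (E v - 0 - twopii * (v - z))%C
      with (E v - twopii * (v - z))%C in HE by ring. lra. }
  assert (Hph : 0 < p / 2 * h) by (apply Rmult_lt_0_compat; lra).
  assert (HEv : E v <> 0%C) by (apply Cmod_gt_0; lra).
  assert (Hvz : (v - z)%C <> 0%C) by (apply Cmod_gt_0; fold h; lra).
  assert (Eal : (AL k eps tau z v - / (twopii * (v - z)) =
    N v * / ((twopii * (v - z)) * E v) + rest v)%C).
  { assert (Hs : AL k eps tau z v = (G v * / E v + rest v)%C).
    { rewrite AL_al_term. unfold Zsum.
      rewrite (Csum_tail (fun n => al_term k eps tau z v (Z.of_nat n)) 1)
        by apply (summable_al_term k eps tau z v Ht Hk).
      assert (E0 : al_term k eps tau z v 0 = (/ E v)%C).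
      { unfold al_term, E, IZC, msign; simpl.
        replace (- 2 * (RtoC (INR k) / 2) * 0 * v)%C with (RtoC 0) by ring.
        replace (RtoC (INR k) / 2 * 0 * (0 + 1) * tau)%C with (RtoC 0) by ring.
        rewrite Cmult_0_l, !ee_0. unfold Cdiv. rewrite !Cmult_1_l. reflexivity. }
      unfold psum. change (Z.of_nat 0) with 0%Z. rewrite E0. unfold rest. fold (G v). ring. }
    rewrite Hs. unfold N. field. repeat split; assumption. }
  rewrite Eal. eapply Rle_trans; [apply Cmod_triangle|]. apply Rplus_le_compat.
  - rewrite Cmod_mult, Cmod_inv, !Cmod_mult by (apply Cmult_neq_0; [apply Cmult_neq_0|]; assumption). fold p h.
    assert (Hhh : 0 < h * h) by nra.
    assert (HNB : Cmod (N v) <= Rabs B * (h * h)).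
    { eapply Rle_trans; [exact HB1|]. apply Rmult_le_compat_r; [lra|apply RRle_abs]. }
    replace (Rabs B * / (p * (p / 2))) with (Rabs B * (h * h) * / (p * h * (p / 2 * h)))
      by (field; lra).
    apply Rmult_le_bound; [split; [apply Cmod_ge_0|exact HNB]|].
    assert (Hq : 0 < p * h * (p / 2 * h)) by (repeat apply Rmult_lt_0_compat; lra).
    assert (p * h * (p / 2 * h) <= p * h * Cmod (E v))
      by (apply Rmult_le_compat_l; [nra|lra]).
    split; [left; apply Rinv_0_lt_compat; lra|]. apply Rinv_le_contravar; assumption.
  - pose proof (Cmod_le_add (rest v) (rest z)). lra.
Qed.

(** * Transformation of the Appell--Lerch sum under [v + 1] and [v + tau] *)

Lemma Csum_ext (a b : nat -> C) : (forall n, a n = b n) -> Csum a = Csum b.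
Proof. intros H. unfold Csum. f_equal; apply Series_ext; intros n; rewrite H; reflexivity. Qed.

Lemma Csum_scal (c : C) (a : nat -> C) : summable a ->
  Csum (fun n => c * a n)%C = (c * Csum a)%C.
Proof.
  intros [H1 H2].
  assert (Hs : forall (k : R) (s : nat -> R), ex_series s -> ex_series (fun n => k * s n))
    by (intros k s Hs; apply (@ex_series_scal R_AbsRing R_NormedModule k s Hs)).
  unfold Csum. apply injective_projections; simpl.
  - rewrite <- !Series_scal_l, <- Series_minus by (apply Hs; assumption).
    reflexivity.
  - rewrite <- !Series_scal_l, <- Series_plus by (apply Hs; assumption).
    apply Series_ext. intros; reflexivity.
Qed.

(** [Zsum] is split at 0, so the shift merely moves [a 0] from the head of the nonnegative half to
    the head of the negative one. *)
Lemma Zsum_shift (a : Z -> C) : summable (fun n => a (Z.of_nat n)) ->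
  summable (fun n => a (- Z.of_nat (S n))%Z) -> Zsum (fun n => a (n + 1)%Z) = Zsum a.
Proof.
  intros H1 H2. unfold Zsum.
  rewrite (Csum_tail (fun n => a (Z.of_nat n)) 1 H1).
  assert (H3 : summable (fun n => a (- Z.of_nat (S n) + 1)%Z)).
  { apply (summable_tail _ 1). destruct H2 as [A B]. split.
    - eapply ex_series_ext; [|exact A]. intros n. apply (f_equal (fun j => Re (a j))). lia.
    - eapply ex_series_ext; [|exact B]. intros n. apply (f_equal (fun j => Im (a j))). lia. }
  rewrite (Csum_tail (fun n => a (- Z.of_nat (S n) + 1)%Z) 1 H3).
  rewrite (Csum_ext (fun n => a (Z.of_nat n + 1)%Z) (fun n => a (Z.of_nat (1 + n))))
    by (intro; apply (f_equal a); lia).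
  rewrite (Csum_ext (fun n => a (- Z.of_nat (S (1 + n)) + 1)%Z) (fun n => a (- Z.of_nat (S n))%Z))
    by (intro; apply (f_equal a); lia).
  unfold psum. change (- Z.of_nat 1 + 1)%Z with 0%Z. change (Z.of_nat 0) with 0%Z. ring.
Qed.

(** Since [2M = k] is an integer, every term is unchanged; the sign comes from the prefactor, as
    [e(-k/2) = (-1)^k]. *)
Lemma AL_shift_1 (k : nat) (eps : Z) (tau z v : C) :
  AL k eps tau z (v + 1) = (msign (Z.of_nat k) * AL k eps tau z v)%C.
Proof.
  rewrite !AL_al_term.
  assert (Et : forall n, al_term k eps tau z (v + 1) n = al_term k eps tau z v n).
  { intros n. unfold al_term.
    replace (- 2 * (RtoC (INR k) / 2) * IZC n * (v + 1))%C
      with (- 2 * (RtoC (INR k) / 2) * IZC n * v + IZC (- (Z.of_nat k * n)))%C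
      by (rewrite IZC_opp, IZC_mult, IZC_of_nat; field).
    replace (z - (v + 1))%C with (z - v + IZC (-1))%C by (unfold IZC; simpl; ring).
    rewrite !ee_plus, !ee_IZC, !Cmult_1_r. reflexivity. }
  unfold Zsum. rewrite (Csum_ext _ _ (fun n => Et (Z.of_nat n))), (Csum_ext _ _ (fun n => Et _)).
  replace (RtoC (INR k) / 2 * (z - (v + 1)))%C
    with (IZC (- Z.of_nat k) / 2 + RtoC (INR k) / 2 * (z - v))%C
    by (rewrite IZC_opp, IZC_of_nat; field).
  rewrite ee_plus, ee_half_int, msign_opp. ring.
Qed.

(** The term of index [n + 1] at [v + tau] has the denominator of the term of index [n] at [v].
    After reindexing, the terms differ by the constant factor [c]. *)
Lemma AL_shift_tau (k : nat) (eps : Z) (tau z v : C) : 0 < Im tau -> (1 <= k)%nat ->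
  AL k eps tau z (v + tau) =
  (msign eps * ee (- (RtoC (INR k) / 2 * (tau + 2 * v))) * AL k eps tau z v)%C.
Proof.
  intros Ht Hk. rewrite !AL_al_term. set (M := (RtoC (INR k) / 2)%C).
  destruct (summable_al_term k eps tau z (v + tau) Ht Hk) as [A B].
  rewrite <- (Zsum_shift _ A B).
  set (c := (msign eps * ee (- 2 * M * v))%C).
  assert (Et : forall n, al_term k eps tau z (v + tau) (n + 1) = (c * al_term k eps tau z v n)%C).
  { intros n. unfold al_term, c. fold M.
    replace ((n + 1) * eps)%Z with (n * eps + eps)%Z by ring. rewrite msign_plus.
    replace (ee (IZC (n + 1) * tau) * ee (z - (v + tau)))%C with (ee (IZC n * tau) * ee (z - v))%C.
    2:{ rewrite <- !ee_plus. f_equal. rewrite IZC_plus. unfold IZC. ring. }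
    assert (En : (ee (- 2 * M * IZC (n + 1) * (v + tau)) * ee (M * IZC (n + 1) * (IZC (n + 1) + 1) * tau)
      = ee (- 2 * M * v) * (ee (- 2 * M * IZC n * v) * ee (M * IZC n * (IZC n + 1) * tau)))%C).
    { rewrite <- !ee_plus. f_equal. rewrite IZC_plus. change (IZC 1) with (RtoC 1). ring. }
    unfold Cdiv. rewrite <- (Cmult_assoc (msign _ * msign _)), En. ring. }
  destruct (summable_al_term k eps tau z v Ht Hk) as [A' B'].
  unfold Zsum. rewrite (Csum_ext _ _ (fun n => Et (Z.of_nat n))), (Csum_ext _ _ (fun n => Et _)).
  rewrite !Csum_scal by assumption. unfold c.
  replace (M * (z - (v + tau)))%C with (M * (z - v) + - (M * tau))%C by ring.
  replace (- (M * (tau + 2 * v)))%C with (- (M * tau) + - 2 * M * v)%C by ring.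
  rewrite !ee_plus. ring.
Qed.

(** * Ellipticity *)

Lemma in_lattice_opp (tau w : C) : in_lattice tau w -> in_lattice tau (- w).
Proof. intros [n [m ->]]. exists (- n)%Z, (- m)%Z. rewrite !IZC_opp. ring. Qed.

Lemma in_lattice_plus (tau w w' : C) :
  in_lattice tau w -> in_lattice tau w' -> in_lattice tau (w + w').
Proof. intros [n [m ->]] [n' [m' ->]]. exists (n + n')%Z, (m + m')%Z. rewrite !IZC_plus. ring. Qed.

Lemma in_lattice_coord (tau w w' : C) : 0 < Im tau -> in_lattice tau (w - w') ->
  exists n m : Z, cy tau w - cy tau w' = IZR n /\ cx tau w - cx tau w' = IZR m.
Proof.
  intros Ht [n [m E]]. exists n, m.
  assert (Ep : pt tau (cx tau w - cx tau w') (cy tau w - cy tau w') = pt tau (IZR m) (IZR n)).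
  { rewrite <- pt_sub, !pt_coord, E by exact Ht. unfold pt, IZC. ring. }
  apply pt_inj in Ep; [tauto|exact Ht].
Qed.

Lemma IZR_small (n : Z) : -1 < IZR n < 1 -> IZR n = 0.
Proof. intros [H1 H2]. apply lt_IZR in H1, H2. replace n with 0%Z by lia. reflexivity. Qed.

Lemma in_lattice_eq (tau w w' : C) : 0 < Im tau -> in_lattice tau (w - w') ->
  -1 < cx tau w - cx tau w' < 1 -> -1 < cy tau w - cy tau w' < 1 -> w = w'.
Proof.
  intros Ht H Hx Hy. destruct (in_lattice_coord tau w w' Ht H) as [n [m [E1 E2]]].
  rewrite E1 in Hy. rewrite E2 in Hx. apply IZR_small in Hx, Hy.
  rewrite <- (pt_coord tau w Ht), <- (pt_coord tau w' Ht). f_equal; lra.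
Qed.

(** Chooses a corner coordinate of the generic parallelogram. Every small positive [x] works: less
    than the fractional part of each non-integral [r], and less than 1 for the integral ones. *)
Lemma avoid_integers (l : list R) : exists x, forall r, In r l -> forall n : Z, r - x <> IZR n.
Proof.
  assert (H : exists d, 0 < d /\ forall x, 0 < x < d -> forall r, In r l -> forall n : Z, r - x <> IZR n).
  { induction l as [|r l [d [Hd IH]]]; [exists 1; split; [lra|intros x _ r []]|].
    destruct (base_Int_part r) as [H1 H2]. set (p := r - IZR (Int_part r)) in *.
    set (e := if Req_EM_T p 0 then 1 else p).
    assert (He : 0 < e /\ forall x, 0 < x < e -> forall n : Z, r - x <> IZR n).
    { unfold e. destruct (Req_EM_T p 0) as [E|E].
      - split; [lra|]. intros x Hx n En. assert (Ex : IZR (Int_part r - n) = x)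
          by (rewrite minus_IZR; unfold p in E; lra).
        assert (IZR (Int_part r - n) = 0) by (apply IZR_small; lra). lra.
      - assert (Hp : 0 < p) by (unfold p in *; lra). split; [exact Hp|]. intros x Hx n En.
        assert (Ex : IZR (n - Int_part r) = p - x) by (rewrite minus_IZR; unfold p; lra).
        assert (IZR (n - Int_part r) = 0) by (apply IZR_small; unfold p in *; lra). lra. }
    exists (Rmin d e). split; [apply Rmin_pos; lra|]. pose proof (Rmin_l d e). pose proof (Rmin_r d e).
    intros x Hx r' [<-|Hr]; [apply He; lra|apply IH; [lra|exact Hr]]. }
  destruct H as [d [Hd H]]. exists (d / 2). apply H. lra.
Qed.

(** Reconciles the bound [N] common to all poles with the length of the principal part at each
    single one. *)
Lemma sum1N_zero_tail (N N' : nat) (g : nat -> C) : (N <= N')%nat ->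
  (forall n, (N < n)%nat -> g n = 0%C) -> sum1N N' g = sum1N N g.
Proof.
  intros HN Hg. unfold sum1N. replace N' with (N + (N' - N))%nat by lia.
  rewrite seq_app, fold_right_app. f_equal.
  generalize (N' - N)%nat. intros j.
  assert (H : forall a, (N < a)%nat -> fold_right (fun n acc => (g n + acc)%C) 0%C (seq a j) = 0%C).
  { induction j as [|j IH]; intros a Ha; [reflexivity|]. simpl. rewrite IH by lia.
    rewrite Hg by lia. ring. }
  apply H. lia.
Qed.

(** The primitive, the exact term and the bound are translated by [L]. Periodicity on a punctured
    disc suffices, whatever the values at the pole. *)
Lemma has_res_translate (f : C -> C) (u c L : C) :
  (exists r, 0 < r /\ forall w, 0 < Cmod (w - u) < r -> f (w + L)%C = f w) ->
  has_res f u c -> has_res f (u + L) c.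
Proof.
  intros [r' [Hr' HL]] [Q [q [r [M [Hr H]]]]].
  exists (fun w => Q (w - L)%C), (fun w => q (w - L)%C), (Rmin r r'), M.
  split; [apply Rmin_pos; lra|]. intros w Hw.
  pose proof (Rmin_l r r'). pose proof (Rmin_r r r').
  assert (Ew : (w - L - u = w - (u + L))%C) by ring.
  destruct (H (w - L)%C) as [A [B D]]; [rewrite Ew; lra|].
  specialize (HL (w - L)%C ltac:(rewrite Ew; lra)).
  assert (HdL : cderiv (fun w => w - L)%C w 1).
  { eapply cderiv_ext; [intro; reflexivity| |apply cderiv_plus; [apply cderiv_id|apply cderiv_const]].
    ring. }
  split; [|split].
  - eapply cderiv_ext; [intro; reflexivity| |apply (cderiv_comp Q (fun w => w - L)%C); [exact HdL|exact A]].
    ring.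
  - apply (cdiff_comp q (fun w => w - L)%C); [exists 1%C; exact HdL|exact B].
  - rewrite <- Ew. rewrite <- HL in D. replace (w - L + L)%C with w in D by ring. exact D.
Qed.

Lemma holo_at_bounded (f : C -> C) (u : C) : holo_at f u ->
  exists r M, 0 < r /\ 0 <= M /\ forall w, Cmod (w - u) < r -> Cmod (f w) <= M.
Proof.
  intros H. destruct (cdiff_ccont f u (holo_at_cdiff_self _ _ H) 1 Rlt_0_1) as [r [Hr Hc]].
  pose proof (Cmod_ge_0 (f u)). exists r, (Cmod (f u) + 1). split; [exact Hr|]. split; [lra|].
  intros w Hw. specialize (Hc w Hw). pose proof (Cmod_le_add (f w) (f u)). lra.
Qed.

(** Up to a bounded function, [f F] is the principal part of [f] times [F], and [has_res_pole]
    treats each power separately; powers start at 1, hence the index [n - 1]. *)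
Lemma has_res_principal_part (f F : C -> C) (u : C) (d : nat -> C) (N : nat) :
  holo_at F u -> principal_part f u d N ->
  has_res (fun w => f w * F w)%C u
    (sum1N N (fun n => d n / RtoC (INR (fact (n - 1))) * Dn (n - 1) F u) / twopii)%C.
Proof.
  intros HF [_ [r [M [Hr H]]]].
  destruct (holo_at_bounded F u HF) as [r' [M' [Hr' [HM' HFb]]]].
  apply (has_res_bounded_diff (fun w => sum1N N (fun n => d n / (twopii * (w - u)) ^ n) * F w)%C).
  - exists (Rmin r r'), (M * M'). split; [apply Rmin_pos; lra|]. intros w Hw.
    pose proof (Rmin_l r r'). pose proof (Rmin_r r r').
    specialize (H w ltac:(lra)). specialize (HFb w ltac:(lra)).
    replace (f w * F w - sum1N N (fun n => d n / (twopii * (w - u)) ^ n) * F w)%C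
      with ((f w - sum1N N (fun n => d n / (twopii * (w - u)) ^ n)) * F w)%C by ring.
    rewrite Cmod_mult. apply Rmult_le_bound; split; auto using Cmod_ge_0.
  - unfold sum1N.
    assert (Hl : forall n, In n (seq 1 N) -> (1 <= n)%nat) by (intros n Hn; apply in_seq in Hn; lia).
    revert Hl. generalize (seq 1 N) as l. induction l as [|n l IH]; intros Hl; simpl.
    + apply (has_res_ext (fun _ => 0%C)); [exists 1; split; [lra|intros; ring]|].
      replace (0 / twopii)%C with (RtoC 0) by (unfold Cdiv; ring).
      apply (has_res_primitive (fun _ => 0%C) _ _ 1); [lra|]. intros w _.
      split; [apply cderiv_const|apply cdiff_const].
    + pose proof twopii_neq_0 as Hp.
      assert (Hf : RtoC (INR (fact (n - 1))) <> 0%C).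
      { intros E. apply RtoC_inj in E. revert E. apply INR_fact_neq_0. }
      apply (has_res_ext (fun w => d n * (F w / (twopii * (w - u)) ^ S (n - 1)) +
        fold_right (fun n acc => d n / (twopii * (w - u)) ^ n + acc) 0 l * F w)%C).
      * exists 1. split; [lra|]. intros w _. specialize (Hl n (or_introl eq_refl)).
        replace (S (n - 1)) with n by lia. unfold Cdiv. ring.
      * match goal with |- has_res _ _ ((?a + ?b) / _)%C =>
          replace ((a + b) / twopii)%C with
            (d n * (Dn (n - 1) F u / (RtoC (INR (fact (n - 1))) * twopii)) + b / twopii)%C
            by (field; auto) end.
        apply has_res_plus; [apply has_res_scal, has_res_pole, HF|].
        apply IH. intros j Hj. apply Hl. right; exact Hj.
Qed.

(** The transformation law of [phi] with [2m = -k], asked where [phi] is holomorphic. *)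
Definition quasi_periodic (k : nat) (eps : Z) (tau : C) (phi : C -> C) : Prop :=
  forall (lam mu : Z) (w : C), holo_at phi w ->
     phi (w + IZC lam * tau + IZC mu)%C =
     (msign (- Z.of_nat k * mu + lam * eps)%Z *
      ee (RtoC (INR k) / 2 * (IZC lam * IZC lam * tau + 2 * IZC lam * w)) * phi w)%C.

(** Near [w + L], [phi] is an entire multiplier times [phi] near [w], so holomorphy, and hence the
    set of poles, is lattice-invariant. *)
Lemma quasi_periodic_holo (k : nat) (eps : Z) (tau : C) (phi : C -> C) (w L : C) :
  quasi_periodic k eps tau phi -> in_lattice tau L -> holo_at phi w -> holo_at phi (w + L).
Proof.
  intros Hq [lam [mu EL]] Hw.
  destruct (holo_at_open phi w Hw) as [r [Hr Ho]].
  set (g := fun w => (msign (- Z.of_nat k * mu + lam * eps)%Z *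
    ee (RtoC (INR k) / 2 * (IZC lam * IZC lam * tau + 2 * IZC lam * w)) * phi w)%C).
  assert (Hg : holo_at g w).
  { apply (holo_at_mult _ phi); [|exact Hw]. apply holo_at_entire. intros v.
    apply cdiff_mult; [apply cdiff_const|]. apply cdiff_ee, cdiff_mult; [apply cdiff_const|].
    apply cdiff_plus; [apply cdiff_const|]. apply cdiff_mult; [apply cdiff_const|apply cdiff_id]. }
  apply (holo_at_ext_loc (fun v => g (v - L)%C) phi (w + L)%C r Hr).
  - intros v Hv. specialize (Hq lam mu (v - L)%C).
    replace (v - L + IZC lam * tau + IZC mu)%C with v in Hq by (rewrite EL; ring).
    symmetry. apply Hq, Ho. replace (v - L - w)%C with (v - (w + L))%C by ring. exact Hv.
  - apply holo_at_cdiff in Hg. destruct Hg as [r' [Hr' Hg]]. apply holo_at_cdiff.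
    exists r'. split; [exact Hr'|]. intros v Hv. apply (cdiff_comp g (fun v => v - L)%C).
    + apply cdiff_minus; [apply cdiff_id|apply cdiff_const].
    + apply Hg. replace (v - L - w)%C with (v - (w + L))%C by ring. exact Hv.
Qed.

(* The multipliers of [phi] and of [AL] in [v] are inverse to each other. *)
Lemma phi_AL_elliptic (k : nat) (eps : Z) (tau : C) (phi : C -> C) (z v L : C) :
  0 < Im tau -> (1 <= k)%nat -> quasi_periodic k eps tau phi -> in_lattice tau L -> holo_at phi v ->
  (phi (v + L) * AL k eps tau z (v + L) = phi v * AL k eps tau z v)%C.
Proof.
  intros Ht Hk Hq HL Hv. set (f := fun v => (phi v * AL k eps tau z v)%C).
  change (f (v + L)%C = f v).
  assert (H1 : forall v, holo_at phi v -> f (v + 1)%C = f v).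
  { clear v Hv. intros v Hv. unfold f. rewrite AL_shift_1.
    pose proof (Hq 0%Z 1%Z v Hv) as E.
    replace (v + IZC 0 * tau + IZC 1)%C with (v + 1)%C in E by (unfold IZC; ring). rewrite E.
    replace (RtoC (INR k) / 2 * (IZC 0 * IZC 0 * tau + 2 * IZC 0 * v))%C with (RtoC 0)
      by (unfold IZC; ring).
    replace (- Z.of_nat k * 1 + 0 * eps)%Z with (- Z.of_nat k)%Z by ring.
    rewrite ee_0, msign_opp.
    transitivity (msign (Z.of_nat k) * msign (Z.of_nat k) * (phi v * AL k eps tau z v))%C; [ring|].
    rewrite msign_sq. ring. }
  assert (Ht1 : forall v, holo_at phi v -> f (v + tau)%C = f v).
  { clear v Hv H1. intros v Hv. unfold f. rewrite AL_shift_tau by assumption.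
    pose proof (Hq 1%Z 0%Z v Hv) as E.
    replace (v + IZC 1 * tau + IZC 0)%C with (v + tau)%C in E by (unfold IZC; ring). rewrite E.
    replace (RtoC (INR k) / 2 * (IZC 1 * IZC 1 * tau + 2 * IZC 1 * v))%C
      with (RtoC (INR k) / 2 * (tau + 2 * v))%C by (unfold IZC; ring).
    replace (- Z.of_nat k * 0 + 1 * eps)%Z with eps by ring.
    set (X := (RtoC (INR k) / 2 * (tau + 2 * v))%C).
    transitivity (msign eps * msign eps * (ee X * ee (- X)) * (phi v * AL k eps tau z v))%C; [ring|].
    rewrite msign_sq, ee_opp_r. ring. }
  (* From one period to its integer multiples, by induction in both directions;
     [quasi_periodic_holo] keeps the intermediate points holomorphic for [phi]. *)
  assert (Hsh : forall a, in_lattice tau a -> (forall v, holo_at phi v -> f (v + a)%C = f v) ->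
    forall n v, holo_at phi v -> f (v + IZC n * a)%C = f v).
  { clear v Hv. intros a Ha Hfa.
    assert (Hla : forall n, in_lattice tau (IZC n * a)).
    { destruct Ha as [p [q ->]]. intros n. exists (n * p)%Z, (n * q)%Z. rewrite !IZC_mult. ring. }
    apply (Z.peano_ind (fun n => forall v, holo_at phi v -> f (v + IZC n * a)%C = f v)).
    - intros v Hv. f_equal. unfold IZC. ring.
    - intros n IH v Hv. rewrite <- (IH v Hv), <- (Hfa (v + IZC n * a)%C).
      + f_equal. unfold Z.succ. rewrite IZC_plus. change (IZC 1) with (RtoC 1). ring.
      + eapply quasi_periodic_holo; eauto.
    - intros n IH v Hv. rewrite <- (IH v Hv), <- (Hfa (v + IZC (Z.pred n) * a)%C).
      + f_equal. unfold Z.pred. rewrite IZC_plus. unfold IZC. ring.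
      + eapply quasi_periodic_holo; eauto. }
  assert (L1 : in_lattice tau 1) by (exists 0%Z, 1%Z; unfold IZC; ring).
  assert (Lt : in_lattice tau tau) by (exists 1%Z, 0%Z; unfold IZC; ring).
  destruct HL as [n [m ->]].
  replace (v + (IZC n * tau + IZC m))%C with (v + IZC n * tau + IZC m * 1)%C by ring.
  rewrite (Hsh 1%C L1 H1), (Hsh tau Lt Ht1); auto.
  apply (quasi_periodic_holo k eps tau phi v _ Hq); [|exact Hv].
  exists n, 0%Z. unfold IZC. ring.
Qed.

(** * Representatives modulo the lattice in a parallelogram *)

Definition reduce (tau : C) (x1 y1 : R) (u : C) : C :=
  (u + - (IZC (Int_part (cy tau u - y1)) * tau + IZC (Int_part (cx tau u - x1))))%C.

Lemma reduce_lattice (tau : C) (x1 y1 : R) (u : C) : in_lattice tau (reduce tau x1 y1 u - u).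
Proof.
  unfold reduce.
  exists (- Int_part (cy tau u - y1))%Z, (- Int_part (cx tau u - x1))%Z. rewrite !IZC_opp. ring.
Qed.

Lemma reduce_coord (tau : C) (x1 y1 : R) (u : C) : 0 < Im tau ->
  cx tau (reduce tau x1 y1 u) = cx tau u - IZR (Int_part (cx tau u - x1)) /\
  cy tau (reduce tau x1 y1 u) = cy tau u - IZR (Int_part (cy tau u - y1)).
Proof.
  intros Ht. unfold reduce.
  set (a := Int_part (cx tau u - x1)). set (b := Int_part (cy tau u - y1)).
  replace (u + - (IZC b * tau + IZC a))%C with (pt tau (cx tau u - IZR a) (cy tau u - IZR b)).
  - apply coord_pt, Ht.
  - rewrite <- pt_sub, pt_coord by exact Ht. unfold pt, IZC. ring.
Qed.

Lemma reduce_bounds (tau : C) (x1 y1 : R) (u : C) : 0 < Im tau ->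
  x1 <= cx tau (reduce tau x1 y1 u) < x1 + 1 /\ y1 <= cy tau (reduce tau x1 y1 u) < y1 + 1.
Proof.
  intros Ht. destruct (reduce_coord tau x1 y1 u Ht) as [-> ->].
  destruct (base_Int_part (cx tau u - x1)), (base_Int_part (cy tau u - y1)). lra.
Qed.

(** The parameter [a] of [in_P] multiplies [tau] and is thus the second coordinate, [b] the
    first. *)
Lemma in_P_coord (tau z0 u : C) : 0 < Im tau -> in_P z0 tau u <->
  cx tau z0 <= cx tau u < cx tau z0 + 1 /\ cy tau z0 <= cy tau u < cy tau z0 + 1.
Proof.
  intros Ht. split.
  - intros [a [b [Ha [Hb ->]]]].
    replace (z0 + RtoC a * tau + RtoC b)%C with (pt tau (cx tau z0 - - b) (cy tau z0 - - a)).
    + destruct (coord_pt tau (cx tau z0 - - b) (cy tau z0 - - a) Ht) as [-> ->]. lra.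
    + rewrite <- pt_sub, pt_coord by exact Ht. unfold pt. rewrite !RtoC_opp. ring.
  - intros [Hx Hy]. exists (cy tau u - cy tau z0), (cx tau u - cx tau z0).
    split; [lra|]. split; [lra|].
    rewrite <- (pt_coord tau u Ht) at 1. rewrite <- (pt_coord tau z0 Ht) at 1.
    unfold pt. rewrite !RtoC_minus. ring.
Qed.

(** The representative of [w] in the parallelogram at [z0] is again a pole: were it holomorphic, so
    would be [w]. *)
Lemma pole_mod_lattice (k : nat) (eps : Z) (tau z0 : C) (phi : C -> C) (s : list C) (w : C) :
  0 < Im tau -> quasi_periodic k eps tau phi -> meromorphic phi ->
  (forall u, In u s <-> (is_pole phi u /\ in_P z0 tau u)) ->
  ~ holo_at phi w -> exists u, In u s /\ in_lattice tau (w - u).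
Proof.
  intros Ht Hq Hm Hs Hw. set (u := reduce tau (cx tau z0) (cy tau z0) w).
  assert (Hl : in_lattice tau (w - u)).
  { replace (w - u)%C with (- (u - w))%C by ring. apply in_lattice_opp, reduce_lattice. }
  exists u. split; [|exact Hl]. apply Hs. split.
  - destruct (Hm u) as [Hu|Hu]; [|exact Hu]. exfalso. apply Hw.
    replace w with (u + (w - u))%C by ring. eapply quasi_periodic_holo; eauto.
  - apply in_P_coord; [exact Ht|]. apply reduce_bounds, Ht.
Qed.

Lemma sum_list_map (g : C -> C) (l : list C) (c : C -> C) :
  sum_list (map g l) c = sum_list l (fun u => c (g u)).
Proof. induction l as [|u l IH]; [reflexivity|]. simpl. rewrite IH. reflexivity. Qed.

Lemma sum_list_scal_r (l : list C) (f : C -> C) (a : C) :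
  sum_list l (fun u => f u * a)%C = (sum_list l f * a)%C.
Proof. induction l as [|u l IH]; simpl; [ring|rewrite IH; ring]. Qed.

(* m = -k/2 with k >= 1, so -m = k/2; eps in {0,1}; D u n = D_{n,u} *)
Theorem theorem1p1 (tau : C) (k : nat) (eps : Z) (phi : C -> C) (z0 : C)
  (D : C -> nat -> C) (s : list C) (z : C) :
  0 < Im tau ->
  (1 <= k)%nat ->
  (eps = 0%Z \/ eps = 1%Z) ->
  meromorphic phi ->
  (forall (lam mu : Z) (w : C), holo_at phi w ->
     phi (w + IZC lam * tau + IZC mu)%C =
     (msign (- Z.of_nat k * mu + lam * eps)%Z *
      ee (RtoC (INR k) / 2 * (IZC lam * IZC lam * tau + 2 * IZC lam * w)) * phi w)%C) ->
  (forall u, on_boundary_P z0 tau u -> ~ is_pole phi u) ->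
  (forall u, is_pole phi u -> exists N, principal_part phi u (D u) N) ->
  NoDup s ->
  (forall u, In u s <-> (is_pole phi u /\ in_P z0 tau u)) ->
  holo_at phi z ->
  forall N : nat, (forall u n, In u s -> (N < n)%nat -> D u n = 0%C) ->
  phi z = (- sum_list s (fun u =>
              sum1N N (fun n => D u n / RtoC (INR (fact (n - 1))) *
                                Dn (n - 1) (fun v => AL k eps tau z v) u)))%C.
Proof.
  intros Ht Hk _ Hm Hq _ HD Hnd Hs Hz N HN.
  change (quasi_periodic k eps tau phi) in Hq.
  set (AF := fun v => AL k eps tau z v). set (f := fun v => (phi v * AF v)%C).
  (* The residues of [f] at [z] and at the poles in [s], as coefficients of [1 / (w - u)]; hence the
     common division by [2 pi i]. *)
  set (r := fun u => if Ceq_dec u z then (phi z / twopii)%C else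
    (sum1N N (fun n => D u n / RtoC (INR (fact (n - 1))) * Dn (n - 1) AF u) / twopii)%C).
  assert (Hell : forall v L, in_lattice tau L -> holo_at phi v -> f (v + L)%C = f v)
    by (intros v L HL Hv; apply phi_AL_elliptic; assumption).
  assert (Hsne : forall u, In u s -> ~ holo_at phi u) by (intros u Hu; apply Hs in Hu; apply Hu).
  assert (Hzs : forall u, In u s -> ~ in_lattice tau (u - z)).
  { intros u Hu HL. apply (Hsne u Hu). replace u with (z + (u - z))%C by ring.
    eapply quasi_periodic_holo; eauto. }
  assert (Hss : forall u v, In u s -> In v s -> in_lattice tau (u - v) -> u = v).
  { intros u v Hu Hv HL. apply Hs in Hu. apply Hs in Hv. destruct Hu as [_ Hu], Hv as [_ Hv].
    apply in_P_coord in Hu; [|exact Ht]. apply in_P_coord in Hv; [|exact Ht].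
    apply (in_lattice_eq tau); [exact Ht|exact HL|lra|lra]. }
  (* The points of [z :: s] are pairwise incongruent, so that no two of them merge when moved into
     the generic parallelogram. *)
  assert (Hmod : forall u v, In u (z :: s) -> In v (z :: s) -> in_lattice tau (u - v) -> u = v).
  { intros u v [<-|Hu] [<-|Hv] HL; auto; exfalso.
    - apply (Hzs v Hv). replace (v - z)%C with (- (z - v))%C by ring. apply in_lattice_opp, HL.
    - apply (Hzs u Hu HL). }
  assert (Hnz : ~ In z s) by (intro Hi; apply (Hsne z Hi Hz)).
  assert (Hres : forall u, In u (z :: s) -> has_res f u (r u) /\
    exists d, 0 < d /\ forall w, 0 < Cmod (w - u) < d -> holo_at phi w).
  { intros u Hu. unfold r. destruct (Ceq_dec u z) as [->|Hne].
    - split.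
      + destruct (AL_pole k eps tau z Ht Hk) as [d [K [Hd HK]]].
        destruct (holo_at_bounded phi z Hz) as [d' [M [Hd' [HM Hb]]]].
        (* Near [z] the sum [AL] is [1 / (2 pi i (w - z))] plus a bounded function, and [phi] is
           bounded. *)
        apply (has_res_bounded_diff (fun w => / twopii * (phi w * / (w - z)))%C).
        * exists (Rmin d d'), (M * K). split; [apply Rmin_pos; lra|]. intros w Hw.
          pose proof (Rmin_l d d'). pose proof (Rmin_r d d').
          assert (w - z <> 0)%C by (apply Cmod_gt_0, Hw). pose proof twopii_neq_0.
          replace (f w - / twopii * (phi w * / (w - z)))%C
            with (phi w * (AL k eps tau z w - / (twopii * (w - z))))%C
            by (unfold f, AF; field; auto).
          rewrite Cmod_mult. apply Rmult_le_bound; split; try apply Cmod_ge_0;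
            [apply Hb|apply HK]; lra.
        * replace (phi z / twopii)%C with (/ twopii * phi z)%C by (unfold Cdiv; ring).
          apply has_res_scal, has_res_simple, holo_at_cdiff_self, Hz.
      + destruct (holo_at_open phi z Hz) as [d [Hd Ho]]. exists d. split; [exact Hd|].
        intros w Hw. apply Ho, Hw.
    - destruct Hu as [E|Hu]; [congruence|]. pose proof (proj1 (Hs u) Hu) as [Hpole _].
      split; [|apply Hpole].
      destruct (HD u Hpole) as [N' HN'].
      assert (Hz0 : forall n, D u n = 0%C ->
        (D u n / RtoC (INR (fact (n - 1))) * Dn (n - 1) AF u)%C = 0%C)
        by (intros n ->; unfold Cdiv; ring).
      replace (sum1N N (fun n => D u n / RtoC (INR (fact (n - 1))) * Dn (n - 1) AF u)%C)
        with (sum1N N' (fun n => D u n / RtoC (INR (fact (n - 1))) * Dn (n - 1) AF u)%C).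
      + apply has_res_principal_part; [apply holo_at_AL; auto|exact HN'].
      + destruct (Nat.le_ge_cases N N') as [Hle|Hle].
        * apply sum1N_zero_tail; [exact Hle|]. intros n Hn. apply Hz0, HN; assumption.
        * symmetry. apply sum1N_zero_tail; [exact Hle|]. intros n Hn. apply Hz0, HN', Hn. }
  (* The corner [(x1, y1)] is incongruent modulo 1 to [z] and all poles in each coordinate, so every
     representative falls strictly inside. *)
  destruct (avoid_integers (map (cx tau) (z :: s))) as [x1 Hx1].
  destruct (avoid_integers (map (cy tau) (z :: s))) as [y1 Hy1].
  set (red := reduce tau x1 y1).
  assert (Hred_inj : forall u v, In u (z :: s) -> In v (z :: s) -> red u = red v -> u = v).
  { intros u v Hu Hv E. apply Hmod; [exact Hu|exact Hv|].
    replace (u - v)%C with ((red v - v) + - (red u - u))%C by (rewrite E; ring).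
    apply in_lattice_plus; [|apply in_lattice_opp]; apply reduce_lattice. }
  assert (Hins : forall u, In u (z :: s) -> inside tau x1 (x1 + 1) y1 (y1 + 1) (red u)).
  { intros u Hu. destruct (reduce_bounds tau x1 y1 u Ht) as [B1 B2].
    destruct (reduce_coord tau x1 y1 u Ht) as [C1 C2].
    specialize (Hx1 (cx tau u) (in_map _ _ _ Hu) (Int_part (cx tau u - x1))).
    specialize (Hy1 (cy tau u) (in_map _ _ _ Hu) (Int_part (cy tau u - y1))).
    unfold inside. fold red in B1, B2, C1, C2. lra. }
  (* [residue_theorem] takes the residue as a function of the point; [back] recovers the original
     point from its representative. *)
  set (back := fun p => epsilon (inhabits z) (fun u => In u (z :: s) /\ red u = p)).
  assert (Hback : forall u, In u (z :: s) -> back (red u) = u).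
  { intros u Hu.
    destruct (epsilon_spec (inhabits z) (fun v => In v (z :: s) /\ red v = red u)) as [A B];
      [exists u; auto|]. apply Hred_inj; assumption. }
  (* [red u] is strictly inside, so it differs from any point of the closed parallelogram by less
     than 1 in each coordinate; congruence then means equality. *)
  assert (Hlat : forall w u x y, In u (z :: s) -> in_lattice tau (w - u) -> w = pt tau x y ->
    x1 <= x <= x1 + 1 -> y1 <= y <= y1 + 1 -> w = red u).
  { intros w u x y Hu HL -> Hx Hy. destruct (Hins u Hu) as [B1 B2].
    destruct (coord_pt tau x y Ht) as [E1 E2].
    apply (in_lattice_eq tau); [exact Ht| |lra|lra].
    replace (pt tau x y - red u)%C with ((pt tau x y - u) + - (red u - u))%C by ring.
    apply in_lattice_plus; [exact HL|apply in_lattice_opp, reduce_lattice]. }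
  assert (Hgood : forall x y, x1 <= x <= x1 + 1 -> y1 <= y <= y1 + 1 ->
    ~ In (pt tau x y) (map red (z :: s)) ->
    holo_at phi (pt tau x y) /\ ~ in_lattice tau (pt tau x y - z)).
  { intros x y Hx Hy Hni. split.
    - apply NNPP. intros Hnh.
      destruct (pole_mod_lattice k eps tau z0 phi s _ Ht Hq Hm Hs Hnh) as [u [Hu HL]].
      apply Hni. rewrite (Hlat _ u x y (or_intror Hu) HL eq_refl Hx Hy).
      apply in_map. right; exact Hu.
    - intros HL. apply Hni. rewrite (Hlat _ z x y (or_introl eq_refl) HL eq_refl Hx Hy).
      apply in_map. left; reflexivity. }
  assert (Hedge : forall x y, on_edge x1 (x1 + 1) y1 (y1 + 1) x y ->
    ~ In (pt tau x y) (map red (z :: s))).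
  { intros x y [Hx [Hy He]] Hi. apply in_map_iff in Hi. destruct Hi as [u [E Hu]].
    destruct (Hins u Hu) as [B1 B2]. rewrite E in B1, B2.
    destruct (coord_pt tau x y Ht) as [E1 E2]. lra. }
  assert (Hbox : box tau f x1 (x1 + 1) y1 (y1 + 1) =
    (W0 tau * res_sum tau (fun p => r (back p)) (map red (z :: s)) x1 (x1 + 1) y1 (y1 + 1))%C).
  { apply residue_theorem; [exact Ht| | |lra|lra|exact Hedge|].
    - apply NoDup_map_NoDup_ForallPairs; [intros u v Hu Hv; apply Hred_inj; assumption|].
      constructor; assumption.
    - intros p Hp. apply in_map_iff in Hp. destruct Hp as [u [<- Hu]]. rewrite Hback by exact Hu.
      destruct (Hres u Hu) as [Hr [d [Hd Hh]]].
      pose proof (reduce_lattice tau x1 y1 u) as HL. fold red in HL.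
      replace (red u) with (u + (red u - u))%C by ring.
      apply has_res_translate; [|exact Hr]. exists d. split; [exact Hd|].
      intros w Hw. apply Hell; [exact HL|apply Hh, Hw].
    - intros x y Hx Hy Hni. destruct (Hgood x y Hx Hy Hni) as [G1 G2].
      apply cdiff_mult; apply holo_at_cdiff_self; [exact G1|].
      apply holo_at_AL; assumption. }
  (* Opposite sides are translates of each other by a period and are traversed in opposite
     directions. *)
  assert (Hzero : box tau f x1 (x1 + 1) y1 (y1 + 1) = 0%C).
  { unfold box.
    rewrite (CI_ext (fun x => f (pt tau x (y1 + 1))) (fun x => f (pt tau x y1))).
    2: lra.
    2:{ intros x Hx. replace (pt tau x (y1 + 1)) with (pt tau x y1 + tau)%C
          by (unfold pt; rewrite RtoC_plus; ring).
        apply Hell; [exists 1%Z, 0%Z; unfold IZC; ring|].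
        apply Hgood; [lra|lra|]. apply Hedge. unfold on_edge. lra. }
    rewrite (CI_ext (fun y => f (pt tau (x1 + 1) y)) (fun y => f (pt tau x1 y))).
    2: lra.
    2:{ intros y Hy. replace (pt tau (x1 + 1) y) with (pt tau x1 y + 1)%C
          by (unfold pt; rewrite RtoC_plus; ring).
        apply Hell; [exists 0%Z, 1%Z; unfold IZC; ring|].
        apply Hgood; [lra|lra|]. apply Hedge. unfold on_edge. lra. }
    ring. }
  rewrite Hzero, res_sum_all in Hbox.
  2:{ intros p Hp. apply in_map_iff in Hp. destruct Hp as [u [<- Hu]]. apply Hins, Hu. }
  rewrite sum_list_map, (sum_list_ext _ _ r) in Hbox
    by (intros u Hu; rewrite Hback by exact Hu; reflexivity).
  pose proof twopii_neq_0 as Hp.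
  (* Dividing by [W0], which is nonzero, leaves the vanishing of the sum of residues. *)
  assert (Hsum : sum_list (z :: s) r = 0%C).
  { apply NNPP. intros Hne. apply (Cmult_neq_0 _ _ (W0_neq_0 tau Ht) Hne). symmetry; exact Hbox. }
  assert (Esum : sum_list (z :: s) r = ((phi z + sum_list s (fun u =>
    sum1N N (fun n => D u n / RtoC (INR (fact (n - 1))) * Dn (n - 1) AF u))) * / twopii)%C).
  { change (sum_list (z :: s) r) with (r z + sum_list s r)%C.
    rewrite (sum_list_ext s r (fun u => sum1N N (fun n => D u n / RtoC (INR (fact (n - 1))) *
      Dn (n - 1) AF u) * / twopii)%C), sum_list_scal_r.
    - unfold r at 1. destruct (Ceq_dec z z) as [_|n]; [unfold Cdiv; ring|congruence].
    - intros u Hu. unfold r. destruct (Ceq_dec u z) as [->|_]; [contradiction|reflexivity]. }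
  rewrite Esum in Hsum. fold AF.
  assert (Hfin : (phi z + sum_list s (fun u =>
    sum1N N (fun n => D u n / RtoC (INR (fact (n - 1))) * Dn (n - 1) AF u)))%C = 0%C).
  { apply NNPP. intros Hne. apply (Cmult_neq_0 _ (/ twopii)%C Hne); [|exact Hsum].
    intros E. apply C1_nz. rewrite <- (Cinv_r twopii Hp), E. ring. }
  set (S := sum_list s _) in *.
  replace (phi z) with ((phi z + S) + - S)%C by ring. rewrite Hfin. ring.
Qed.
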